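(* Let $X=(X(t))$ be a continuous centered Gaussian process on an interval including $[a,b]$, $a<b$, with covariance function $R_X(s,t)=\operatorname{cov}(X(s),X(t))$, and let $\Psi_{a,b}(u)=P(X(t)>u,\ a\le t\le b)$. Let $\mathcal L$ denote the closure in mean square of the finite linear combinations $\sum_j a_j X(t_j)$, and let $M_1^+([0,1])$ denote the Borel probability measures on $[0,1]$. Then the limit \[ -\tfrac12 C_X(a,b):=\lim_{u\to\infty}\frac1{u^2}\log\Psi_{a,b}(u) \] exists, and \[ C_X(a,b)=\inf\bigl\{E H^2:\ H\in\mathcal L,\ E[X(a+(b-a)v)H]\ge 1,\ 0\le v\le 1\bigr\} \] \[ =\Bigl[\min_{\mu\in M_1^+([0,1])}\int_0^1\!\!\int_0^1 R_X\bigl(a+(b-a)u,\,a+(b-a)v\bigr)\,\mu(du)\,\mu(dv)\Bigr]^{-1}. \] If $X$ is stationary, with covariance $R_X(t)$ and spectral measure $F_X$ (so $R_X(t)=\int e^{itx}F_X(dx)$), then $C_X(a):=C_X(0,a)$, $a>0$, is also given by \[ C_X(a)=\inf\Bigl\{\int_{-\infty}^{\infty}|h(x)|^2F_X(dx):\ \int_{-\infty}^{\infty}e^{ivax}\overline{h(x)}\,F_X(dx)>1,\ 0\le v\le1\Bigr\}. \] The set $\mathcal W_{a,b}$ of $\mu\in M_1^+([0,1])$ at which the minimum in the double-integral formula for $C_X(a,b)$ is achieved is a weakly compact convex subset of $M_1^+([0,1])$, and $\mu\in\mathcal W_{a,b}$ if and only if \[ \min_{0\le v\le1}\int_0^1R_X\bigl(a+(b-a)u,a+(b-a)v\bigr)\mu(du)=\int_0^1\!\!\int_0^1R_X\bigl(a+(b-a)u_1,a+(b-a)u_2\bigr)\mu(du_1)\mu(du_2).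 \] Suppose further that the infimum problem over $H\in\mathcal L$ (with constraints $E[X(a+(b-a)v)H]\ge1$, $0\le v\le1$) has a feasible solution. Then the double integral in the last display is positive for every $\mu\in\mathcal W_{a,b}$, and that infimum problem has a unique optimal solution $H_{a,b}$, satisfying, for each $\mu\in\mathcal W_{a,b}$, \[ H_{a,b}=C_X(a,b)\int_0^1X(a+(b-a)v)\,\mu(dv)\quad\text{a.s.} \] In the stationary case, the infimum problem over $h$ (in the spectral formula for $C_X(a)$) has a unique optimal solution $h_a$, and for each $\mu\in\mathcal W_a:=\mathcal W_{0,a}$, \[ h_a(x)=C_X(a)\int_0^1e^{iavx}\mu(dv)\quad\text{for }F_X\text{-almost all }x. \] The conditional law on $C[a,b]$ of $u^{-1}X$ restricted to $[a,b]$, given $X(t)>u$ for all $a\le t\le b$, converges as $u\to\infty$ to the Dirac measure at \[ x_{a,b}(t)=C_X(a,b)\int_0^1R_X\bigl(t,a+(b-a)v\bigr)\mu(dv),\qquad a\le t\le b, \] and $\mu(\{0\le v\le1:\ x_{a,b}(a+(b-a)v)>1\})=0$. Finally, if $X$ is stationary and the support of $F_X$ is the entire real line, then $\mathcal W_a$ consists of a single probability measure $\mu_a$.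
   Context: One-dimensional specialization of the large deviation results for the probability that a continuous Gaussian process stays above a high level $u$ along an entire interval. $\mathcal L$ is identified with the reproducing kernel Hilbert space of $X$ via $H\mapsto (E(X(t)H))_t$, and in the stationary case that space is identified with functions in $L^2(F_X)$ via $h\mapsto(\int e^{itx}\overline{h(x)}F_X(dx))_t$.
   Formalization: The spectral constraint ''> 1'' is read as ''≥ 1'': with the strict inequality the infimum is the same but is not attained, so no optimal h_a would exist (e.g. F_X a unit mass at 0). Weak compactness is stated as sequential compactness, equivalent because the weak topology is metrizable. *)

(* Defs.v *)
From HB Require Import structures.
From mathcomp Require Import all_boot all_order all_algebra.
From mathcomp Require Import all_classical all_reals all_analysis.
Set Implicit Arguments. Unset Strict Implicit. Unset Printing Implicit Defensive.
Import Order.TTheory GRing.Theory Num.Theory.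
Import numFieldNormedType.Exports.
Local Open Scope classical_set_scope.
Local Open Scope ring_scope.

Section unit_interval.
Context {R : realType}.

Definition aff (a b v : R) : R := a + (b - a) * v.

(* M_1^+([0,1]): Borel probability measures on [0,1], represented as
   Borel probability measures on R carried by [0,1]. *)
Definition prob01 (mu : probability R R) : Prop :=
  mu (~` `[0%R, 1%R]%classic) = 0%E.

Definition weak_cvg01 (mus : nat -> probability R R) (mu : probability R R) : Prop :=
  forall f : R -> R, {within `[0%R, 1%R]%classic, continuous f} ->
    ((fun n => \int[mus n]_(x in `[0%R, 1%R]%classic) (f x)%:E) @ \oo -->
       \int[mu]_(x in `[0%R, 1%R]%classic) (f x)%:E)%E.

Definition weakly_compact01 (W : set (probability R R)) : Prop :=
  forall mus : nat -> probability R R, (forall n, W (mus n)) ->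
    exists (phi : nat -> nat) (mu : probability R R),
      (forall n, (phi n < phi n.+1)%N) /\ W mu /\ weak_cvg01 (mus \o phi) mu.

Definition convex_meas (W : set (probability R R)) : Prop :=
  forall (mu1 mu2 mu : probability R R) (lam : R),
    W mu1 -> W mu2 -> 0 <= lam <= 1 ->
    (forall A, measurable A -> mu A = (lam%:E * mu1 A + (1 - lam)%:E * mu2 A)%E) ->
    W mu.

Definition einv (m : \bar R) : \bar R :=
  match m with
  | EFin r => if r == 0 then +oo%E else (r^-1)%:E
  | +oo%E => 0%E
  | -oo%E => -oo%E
  end.

End unit_interval.

Section gaussian.
Context {d : measure_display} {T : measurableType d} {R : realType}.
Variable P : probability T R.

Definition centered_gaussian_rv (Y : T -> R) : Prop :=
  measurable_fun setT Y /\
  exists s : R, forall A : set R, measurable A ->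
    P (Y @^-1` A) = (if s == 0 then @dirac _ R 0 R A else normal_prob 0 s A).

Definition lin_comb (X : R -> T -> R) (n : nat) (t c : 'I_n -> R) : T -> R :=
  fun w => \sum_(j < n) c j * X (t j) w.

Definition centered_gaussian_process (I : set R) (X : R -> T -> R) : Prop :=
  forall (n : nat) (t c : 'I_n -> R), (forall j, I (t j)) ->
    centered_gaussian_rv (lin_comb X t c).

Definition continuous_paths (I : set R) (X : R -> T -> R) : Prop :=
  forall w, {within I, continuous (fun t => X t w)}.

Definition covX (X : R -> T -> R) (s t : R) : R := fine (covariance P (X s) (X t)).

Definition exceed (X : R -> T -> R) (a b u : R) : set T :=
  [set w | forall t, a <= t <= b -> u < X t w].

Definition Psi (X : R -> T -> R) (a b u : R) : R := fine (P (exceed X a b u)).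

Definition logPsi (X : R -> T -> R) (a b u : R) : \bar R :=
  if Psi X a b u == 0 then -oo%E else (ln (Psi X a b u))%:E.

Definition in_L (I : set R) (X : R -> T -> R) (H : T -> R) : Prop :=
  measurable_fun setT H /\ ('E_P[fun w => (H w ^+ 2)%R] < +oo)%E /\
  forall e : R, 0 < e -> exists n (t c : 'I_n -> R),
    (forall j, I (t j)) /\
    ('E_P[fun w => ((H w - lin_comb X t c w) ^+ 2)%R] < e%:E)%E.

Definition feasibleH (I : set R) (X : R -> T -> R) (a b : R) (H : T -> R) : Prop :=
  in_L I X H /\
  forall v, 0 <= v <= 1 -> (1 <= 'E_P[fun w => (X (aff a b v) w * H w)%R])%E.

Definition CX (I : set R) (X : R -> T -> R) (a b : R) : \bar R :=
  ereal_inf [set ('E_P[fun w => (H w ^+ 2)%R])%E | H in feasibleH I X a b].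

Definition DI (X : R -> T -> R) (a b : R) (mu : probability R R) : \bar R :=
  (\int[mu]_(u in `[0%R, 1%R]%classic) \int[mu]_(v in `[0%R, 1%R]%classic)
      (covX X (aff a b u) (aff a b v))%:E)%E.

Definition Wab (X : R -> T -> R) (a b : R) (mu : probability R R) : Prop :=
  prob01 mu /\ forall nu, prob01 nu -> (DI X a b mu <= DI X a b nu)%E.

Definition covint (X : R -> T -> R) (a b : R) (mu : probability R R) (t : R) : \bar R :=
  (\int[mu]_(v in `[0%R, 1%R]%classic) (covX X t (aff a b v))%:E)%E.

Definition Xint (X : R -> T -> R) (a b : R) (mu : probability R R) (w : T) : R :=
  fine (\int[mu]_(v in `[0%R, 1%R]%classic) (X (aff a b v) w)%:E)%E.

(* bounded continuous test functionals on C[a,b]; a function g on C[a,b]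
   is represented by any g : R -> R continuous on [a,b] *)
Definition test_functional (a b : R) (f : (R -> R) -> R) : Prop :=
  (exists M : R, forall g, `|f g| <= M) /\
  (forall g g', (forall t, a <= t <= b -> g t = g' t) -> f g = f g') /\
  (forall g, {within `[a%R, b%R]%classic, continuous g} ->
     forall e : R, 0 < e -> exists2 del : R, 0 < del &
       forall g', {within `[a%R, b%R]%classic, continuous g'} ->
         (forall t, a <= t <= b -> `|g t - g' t| < del) -> `|f g - f g'| < e).

Definition cond_exp_f (X : R -> T -> R) (a b : R) (f : (R -> R) -> R) (u : R) : R :=
  fine (\int[P]_(w in exceed X a b u) (f (fun t => X t w / u))%:E)%E / Psi X a b u.

(* spectral measure F of a stationary X on I:
   R_X(s,t) = int e^{i(t-s)x} F(dx), s,t in I  (real and imaginary parts) *)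
Definition spectral_measure (I : set R) (X : R -> T -> R)
    (F : {finite_measure set R -> \bar R}) : Prop :=
  forall s t, I s -> I t ->
    (covX X s t)%:E = (\int[F]_x (cos ((t - s) * x))%:E)%E /\
    (\int[F]_x (sin ((t - s) * x))%:E)%E = 0%E.

End gaussian.

(* Spectral problem: complex h = h1 + i h2 in L^2(F)                   *)

Section spectral.
Context {R : realType}.
Variable F : {finite_measure set R -> \bar R}.

Definition in_L2F (h1 h2 : R -> R) : Prop :=
  measurable_fun setT h1 /\ measurable_fun setT h2 /\
  (\int[F]_x (h1 x ^+ 2 + h2 x ^+ 2)%:E < +oo)%E.

(* int e^{i v a x} conj(h(x)) F(dx) >= 1 (a real number >= 1):
   real part >= 1, imaginary part = 0 *)
Definition feasible_spec (a : R) (h1 h2 : R -> R) : Prop :=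
  in_L2F h1 h2 /\
  forall v, 0 <= v <= 1 ->
    (1 <= \int[F]_x (cos (v * a * x) * h1 x + sin (v * a * x) * h2 x)%:E)%E /\
    (\int[F]_x (sin (v * a * x) * h1 x - cos (v * a * x) * h2 x)%:E)%E = 0%E.

Definition normF (h1 h2 : R -> R) : \bar R :=
  (\int[F]_x (h1 x ^+ 2 + h2 x ^+ 2)%:E)%E.

Definition CXspec (a : R) : \bar R :=
  ereal_inf [set normF h.1 h.2 | h in [set h | feasible_spec a h.1 h.2]].

End spectral.

(* Main.v *)
(** Rescale time to [0, 1]. Let [mu] minimize the energy E Z^2 of the mixtures
    Z = \int X dmu, and let m be the minimum. Perturbing [mu] towards Dirac masses
    gives E[X(v) Z] >= m for all v, so H = Z / m is feasible when m > 0; since every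
    feasible H' satisfies E[H' Z] >= 1, we get E[H' H] >= E H^2, which gives the value
    1 / m and the uniqueness of the optimum. Stationarity turns the same computation
    into one in L^2(F), and if F has full support, then two minimizers have equal
    characteristic functions. Weak compactness follows from a Helly selection of
    quantile functions.

    For the large deviations put x(v) = E[X(v) Z] / m >= 1. The path is x Z + Y with a
    residual Y independent of Z. The event implies Z > u, and it contains
    {Z > u + K, |Y| <= K}; hence the rate is that of Z. Given the event, Z / u is close
    to 1, while Y / u is negligible because sup |Y| has tails lighter than any
    exponential, by a Fernique-type doubling inequality. *)
Require Import Defs.
From HB Require Import structures.
From mathcomp Require Import all_boot all_order all_algebra.
From mathcomp Require Import all_classical all_reals all_analysis.
From mathcomp Require Import measurable_realfun ring lra.
Set Implicit Arguments. Unset Strict Implicit. Unset Printing Implicit Defensive.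
Import Order.TTheory GRing.Theory Num.Theory.
Import numFieldNormedType.Exports.
Local Open Scope classical_set_scope.
Local Open Scope ring_scope.

(** Laws enter through the integrals of [cos (Y w + a)]: this is what [gaussian_cf] records, it
    passes to mean square limits, and the phase [a] carries the sine part along. One statement,
    [weighted_char_le], must then turn equality of such integrals into equality of distribution
    functions; its bounded weight also yields joint laws and independence, by treating one variable
    at a time. The lower bound for [Psi] loses a factor of order [exp (- 2 k L u)], k = 1/(2m),
    against the tail of Z, because the level has to be raised by a constant L. A residual tail of
    one fixed exponential rate could not absorb this, so all rates are needed. The doubling
    inequality provides them: the level grows by the factor 9/5 per step while the logarithm of the
    probability doubles, and 2 > 9/5. If m = 0, then Z vanishes almost surely, no H is feasible and
    both sides of the limit are [-oo]; this case runs separately. A test functional along the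
    process is not assumed measurable, so conditional expectations are estimated by sandwiching the
    integrand between simple functions. *)

Section finite_measure_integrals.
Context {d : measure_display} {T : measurableType d} {R : realType}.
Variable P : {finite_measure set T -> \bar R}.

Lemma integrable_cst (k : R) : P.-integrable setT (EFin \o (fun=> k)).
Proof. exact: (@finite_measure_integrable_cst _ _ _ P setT k). Qed.

Lemma integrable_scale (k : R) (f : T -> R) : P.-integrable setT (EFin \o f) ->
  P.-integrable setT (EFin \o (fun w => k * f w)).
Proof.
by move=> /(integrableZl measurableT k); apply: eq_integrable => // w _.
Qed.

Lemma integrable_add (f g : T -> R) : P.-integrable setT (EFin \o f) ->
  P.-integrable setT (EFin \o g) -> P.-integrable setT (EFin \o (fun w => f w + g w)).
Proof.
by move=> fi gi; apply: eq_integrable (integrableD measurableT fi gi) => // w _.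
Qed.

Lemma integrable_sub (f g : T -> R) : P.-integrable setT (EFin \o f) ->
  P.-integrable setT (EFin \o g) -> P.-integrable setT (EFin \o (fun w => f w - g w)).
Proof.
by move=> fi gi; apply: eq_integrable (integrableB measurableT fi gi) => // w _.
Qed.

Lemma Rintegral_EFin (f : T -> R) : P.-integrable setT (EFin \o f) ->
  (\int[P]_w f w)%:E = (\int[P]_w (f w)%:E)%E.
Proof. by move=> fi; rewrite /Rintegral fineK// integrable_fin_num. Qed.

Lemma integrable_dominated (f g : T -> R) : measurable_fun setT f ->
  (forall w, `|f w| <= g w) -> P.-integrable setT (EFin \o g) ->
  P.-integrable setT (EFin \o f).
Proof.
move=> mf fg; apply: le_integrable => //; first exact/measurable_EFinP.
by move=> w _ /=; rewrite lee_fin (le_trans (fg w))// ler_norm.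
Qed.

Lemma bounded_int (f : T -> R) (B : R) : measurable_fun setT f ->
  (forall w, `|f w| <= B) -> P.-integrable setT (EFin \o f).
Proof.
move=> mf fB; apply: (le_integrable _ _ _ (integrable_cst B)) => //.
  exact/measurable_EFinP.
by move=> x _ /=; rewrite lee_fin (le_trans (fB x)) // ler_norm.
Qed.

Lemma integrable_bigsum n (F : nat -> T -> R) :
  (forall k, P.-integrable setT (EFin \o F k)) ->
  P.-integrable setT (EFin \o (fun w => \sum_(k < n) F k w)).
Proof.
move=> iF; elim: n => [|n IHn].
  under [X in EFin \o X]eq_fun do rewrite big_ord0.
  exact: (integrable_cst 0).
under [X in EFin \o X]eq_fun do rewrite big_ord_recr/=.
exact: integrable_add.
Qed.

Lemma Rintegral_bigsum n (F : nat -> T -> R) :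
  (forall k, P.-integrable setT (EFin \o F k)) ->
  \int[P]_w (\sum_(k < n) F k w) = \sum_(k < n) \int[P]_w F k w.
Proof.
move=> iF; elim: n => [|n IHn].
  rewrite big_ord0; under eq_Rintegral do rewrite big_ord0.
  by rewrite Rintegral_cst// mul0r.
rewrite big_ord_recr/= -IHn; under eq_Rintegral do rewrite big_ord_recr/=.
by rewrite RintegralD//; exact: integrable_bigsum.
Qed.

Lemma Rintegral_dct (f : nat -> T -> R) (g : T -> R) (h : T -> R) :
  (forall n, measurable_fun setT (f n)) ->
  P.-integrable setT (EFin \o h) ->
  (forall n w, `|f n w| <= h w) ->
  (forall w, f ^~ w @ \oo --> g w) ->
  \int[P]_w f n w @[n --> \oo] --> \int[P]_w g w.
Proof.
move=> mf ih fB fg; have mg := measurable_fun_cvg mf (fun w _ => fg w).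
have [] := @dominated_convergence _ _ _ P setT measurableT
  (fun n w => (f n w)%:E) (EFin \o g) (EFin \o h).
- by move=> n; exact/measurable_EFinP.
- exact/measurable_EFinP.
- by apply/aeW => w _; apply: cvg_EFin; [exact: nearW|exact: fg].
- exact: ih.
- by apply/aeW => w n _ /=; rewrite lee_fin.
move=> ig _ c; apply: fine_cvg; rewrite fineK //; exact: integrable_fin_num.
Qed.

Lemma Rintegral_bdct (f : nat -> T -> R) (g : T -> R) (B : R) :
  (forall n, measurable_fun setT (f n)) ->
  (forall n w, `|f n w| <= B) ->
  (forall w, f ^~ w @ \oo --> g w) ->
  \int[P]_w f n w @[n --> \oo] --> \int[P]_w g w.
Proof.
move=> mf fB fg; apply: (@Rintegral_dct _ _ (cst B)) => //.
exact: integrable_cst.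
Qed.

Lemma Rintegral_bdct_ae (f : nat -> T -> R) (g : T -> R) (B : R) :
  (forall n, measurable_fun setT (f n)) -> measurable_fun setT g ->
  (forall n w, `|f n w| <= B) ->
  {ae P, forall w, f ^~ w @ \oo --> g w} ->
  \int[P]_w f n w @[n --> \oo] --> \int[P]_w g w.
Proof.
move=> mf mg fB fg.
have [] := @dominated_convergence _ _ _ P setT measurableT
  (fun n w => (f n w)%:E) (EFin \o g) (EFin \o cst B).
- by move=> n; exact/measurable_EFinP.
- exact/measurable_EFinP.
- by apply: filterS fg => w fgw _; apply: cvg_EFin; [exact: nearW|exact: fgw].
- exact: integrable_cst.
- by apply/aeW => w n _ /=; rewrite lee_fin.
move=> ig _ c; apply: fine_cvg; rewrite fineK //; exact: integrable_fin_num.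
Qed.

End finite_measure_integrals.

Lemma Rintegral_prob_cst (d : measure_display) (T : measurableType d) (R : realType)
  (P : probability T R) (c : R) : \int[P]_w c = c.
Proof. by rewrite Rintegral_cst// [X in fine X](@probability_setT _ _ _ P) mulr1. Qed.

Lemma cvgn_unique (R : realType) (u : nat -> R) (l l' : R) :
  u @ \oo --> l -> u @ \oo --> l' -> l = l'.
Proof. by move=> ul ul'; exact: (cvg_unique _ ul ul'). Qed.

Lemma cvgn_dist_le (R : realType) (u e : nat -> R) (l : R) :
  (forall n, `|u n - l| <= e n) -> e @ \oo --> 0 -> u @ \oo --> l.
Proof.
move=> ue e0.
apply: (@squeeze_cvgr _ _ _ _ (fun n => l - e n) (fun n => l + e n)).
- apply: nearW => n; have := ue n; rewrite ler_norml => /andP[h1 h2].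
  by apply/andP; split; lra.
- by rewrite -[X in _ --> X]subr0; apply: cvgB => //; exact: cvg_cst.
- by rewrite -[X in _ --> X]addr0; apply: cvgD => //; exact: cvg_cst.
Qed.

(** Continuity is reduced to sequences so that the convergence theorems for integrals, which run
    along [\oo], apply. *)
Lemma sequentially_continuous (R : realType) (f : R -> R) :
  (forall (p : R) (u : nat -> R), u @ \oo --> p -> f (u n) @[n --> \oo] --> f p) ->
  continuous f.
Proof.
move=> h p; apply/continuous_withinNx/cvgr_dnbhsP => u [_ up]; exact: h.
Qed.

(** * Polynomial approximation of the sign *)

Section sign_approximation.
Context {R : realType}.

(* Iterating y |-> (3y - y^3)/2 on [-1, 1] converges to the sign of y; this
   turns trigonometric polynomials into square waves. *)
Fixpoint sgn_iter (n : nat) (y : R) : R :=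
  if n is m.+1 then (3 * sgn_iter m y - sgn_iter m y ^+ 3) / 2 else y.

Lemma sgn_iterN n y : sgn_iter n (- y) = - sgn_iter n y.
Proof. by elim: n => //= n ->; field. Qed.

Lemma sgn_iter0 n : sgn_iter n 0 = 0.
Proof. by elim: n => //= n ->; field. Qed.

(** The map [y |-> (3y - y^3)/2] fixes 0 and 1; the two factorizations show that on [0, 1] it moves
    points up without passing 1. *)
Lemma sgn_iter_ge y n : 0 <= y -> y <= 1 -> y <= sgn_iter n y <= 1.
Proof.
move=> y0 y1; elim: n => [|n /andP[]] /=; first by rewrite lexx y1.
set g := sgn_iter n y => yg g1.
have g0 : 0 <= g by exact: le_trans yg.
apply/andP; split.
- apply: le_trans yg _; rewrite -subr_ge0.
  have -> : (3 * g - g ^+ 3) / 2 - g = g * (1 - g) * (1 + g) / 2 by field.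
  by rewrite divr_ge0 // !mulr_ge0 //; lra.
- rewrite -subr_ge0.
  have -> : 1 - (3 * g - g ^+ 3) / 2 = (1 - g) ^+ 2 * (2 + g) / 2 by field.
  by rewrite divr_ge0 // mulr_ge0 ?sqr_ge0//; lra.
Qed.

Lemma sgn_iter_bound y n : `|y| <= 1 -> `|sgn_iter n y| <= 1.
Proof.
wlog y0 : y / 0 <= y => [H y1|].
  have [|y0] := leP 0 y; first by move/H; apply.
  by rewrite -normrN -sgn_iterN; apply: H; rewrite ?normrN// oppr_ge0 ltW.
rewrite ger0_norm// => y1.
have /andP[h1 h2] := sgn_iter_ge n y0 y1.
by rewrite ger0_norm// (le_trans y0).
Qed.

(** One step multiplies the gap [1 - g] by [(1 - g)(2 + g)/2 = 1 - (g + g^2)/2], which is at most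
    [1 - y/2] because the iterates stay above the starting point y. *)
Lemma sgn_iter_rate y n : 0 < y -> y <= 1 -> 1 - sgn_iter n y <= (1 - y / 2) ^+ n.
Proof.
move=> y0 y1; elim: n => [|n IHn] /=; first by rewrite expr0; lra.
have /andP[] := sgn_iter_ge n (ltW y0) y1.
set g := sgn_iter n y in IHn * => yg g1.
have -> : 1 - (3 * g - g ^+ 3) / 2 = ((1 - g) * (2 + g) / 2) * (1 - g) by field.
rewrite exprS ler_pM//; first by rewrite divr_ge0// mulr_ge0//; lra.
  by lra.
have : 0 <= g * (g - y) by rewrite mulr_ge0//; lra.
by nra.
Qed.

Lemma sgn_iter_cvg y : `|y| <= 1 -> sgn_iter ^~ y @ \oo --> Num.sg y.
Proof.
wlog y0 : y / 0 <= y => [H y1|].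
  have [|y0] := leP 0 y; first by move/H; apply.
  rewrite -(opprK y) sgrN; under eq_fun do rewrite sgn_iterN.
  by apply: cvgN; apply: H; rewrite ?normrN// oppr_ge0 ltW.
rewrite ger0_norm//; move: y0; rewrite le_eqVlt => /predU1P[<- _|y0 y1].
  by rewrite sgr0; under eq_fun do rewrite sgn_iter0; exact: cvg_cst.
rewrite gtr0_sg//.
have c : (fun n => 1 - (1 - y / 2) ^+ n) @ \oo --> (1 : R).
  rewrite -[X in _ --> X]subr0; apply: cvgB; first exact: cvg_cst.
  by apply: cvg_expr; rewrite ger0_norm; lra.
apply: (@squeeze_cvgr _ _ _ _ _ (cst 1) _ _ _ c); last exact: cvg_cst.
apply: nearW => n.
have /andP[_ ->] := sgn_iter_ge n (ltW y0) y1.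
by have := sgn_iter_rate n y0 y1; rewrite andbT; lra.
Qed.

End sign_approximation.
(** * A weighted Cramer-Wold theorem *)

Section trigonometric_sums.
Context {R : realType}.
Implicit Types (s : seq (R * R * R)) (f g : R -> R).

(** Each triple lists an amplitude, a frequency and a phase. With phases allowed, sums of cosines
    include sines and constants and are closed under products. *)
Definition trig_sum s (z : R) : R :=
  \sum_(p <- s) p.1.1 * cos (p.1.2 * z + p.2).

Definition is_trig f := exists s, f = trig_sum s.

Lemma is_trig_cos (x a : R) : is_trig (fun z => cos (x * z + a)).
Proof.
by exists [:: (1, x, a)]; apply/funext => z; rewrite /trig_sum big_seq1 mul1r.
Qed.

Lemma is_trig_sin (x a : R) : is_trig (fun z => sin (x * z + a)).
Proof.
exists [:: (1, x, a - pi / 2)]; apply/funext => z.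
by rewrite /trig_sum big_seq1 mul1r addrA cosBpihalf.
Qed.

Lemma is_trigZ (k : R) f : is_trig f -> is_trig (fun z => k * f z).
Proof.
move=> [s ->]; exists [seq (k * p.1.1, p.1.2, p.2) | p <- s].
apply/funext => z; rewrite /trig_sum big_map mulr_sumr.
by apply: eq_bigr => p _ /=; rewrite mulrA.
Qed.

Lemma is_trigD f g : is_trig f -> is_trig g -> is_trig (fun z => f z + g z).
Proof.
by move=> [s ->] [t ->]; exists (s ++ t); apply/funext => z; rewrite /trig_sum big_cat.
Qed.

Lemma is_trig_cst (k : R) : is_trig (fun=> k).
Proof.
have := is_trigZ k (is_trig_cos 0 0).
by under eq_fun do rewrite mul0r add0r cos0 mulr1.
Qed.

Lemma cosM (x y : R) : cos x * cos y = 2^-1 * cos (x + y) + 2^-1 * cos (x - y).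
Proof. by rewrite cosD cosB; field. Qed.

Lemma is_trigM f g : is_trig f -> is_trig g -> is_trig (fun z => f z * g z).
Proof.
move=> [s ->] [t ->].
exists ([seq (2^-1 * (p.1.1 * q.1.1), p.1.2 + q.1.2, p.2 + q.2) | p <- s, q <- t]
     ++ [seq (2^-1 * (p.1.1 * q.1.1), p.1.2 - q.1.2, p.2 - q.2) | p <- s, q <- t]).
apply/funext => z; rewrite /trig_sum big_cat !big_allpairs_dep/= mulr_suml -big_split.
apply: eq_bigr => p _; rewrite mulr_sumr -big_split; apply: eq_bigr => q _ /=.
rewrite mulrACA cosM mulrDr; congr (_ + _); rewrite !mulrA; congr (_ * cos _); ring.
Qed.

Lemma is_trig_sgn_iter n f : is_trig f -> is_trig (fun z => sgn_iter n (f z)).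
Proof.
move=> tf; elim: n => [//|n IHn] /=.
have -> : (fun z => (3 * sgn_iter n (f z) - sgn_iter n (f z) ^+ 3) / 2) =
    (fun z => 3 / 2 * sgn_iter n (f z) +
      - 2^-1 * (sgn_iter n (f z) * (sgn_iter n (f z) * sgn_iter n (f z)))).
  by apply/funext => z; field.
by apply: is_trigD; apply: is_trigZ => //; apply: is_trigM => //; exact: is_trigM.
Qed.

Lemma measurable_cos : measurable_fun setT (@cos R).
Proof. by apply: continuous_measurable_fun; exact: continuous_cos. Qed.

Lemma measurable_sin : measurable_fun setT (@sin R).
Proof. by apply: continuous_measurable_fun; exact: continuous_sin. Qed.

Lemma measurable_trig f : is_trig f -> measurable_fun setT f.
Proof.
move=> [s ->]; rewrite /trig_sum; apply: measurable_sum => p.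
apply: measurable_funM => //.
apply: measurableT_comp; first exact: measurable_cos.
by apply: measurable_funD => //; exact: measurable_funM.
Qed.

(** The quadratic with values 1, 1, 0 at -1, 0, 1: composed with the sign of [z - s] it gives the
    indicator of [z <= s], endpoint included. *)
Definition sgn_half (y : R) : R := (2 - y - y ^+ 2) / 2.

Lemma sgn_half_sg (s z : R) : sgn_half (Num.sg (z - s)) = (z <= s)%R%:R.
Proof.
rewrite /sgn_half; have [zs|sz|->] := ltgtP z s.
- by rewrite ltr0_sg ?subr_lt0//=; field.
- by rewrite gtr0_sg ?subr_gt0//=; field.
- by rewrite subrr sgr0/=; field.
Qed.

Lemma sgn_half_bound (y : R) : `|y| <= 1 -> `|sgn_half y| <= 2.
Proof. by rewrite /sgn_half !ler_norml => /andP[? ?]; apply/andP; split; nra. Qed.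

(** For fixed y the argument [y / (n+1)] eventually lies in (-pi, pi), where the sine has the sign
    of its argument: the square wave widens until its half period covers y. *)
Lemma sgn_sin_cvg (y : R) :
  Num.sg (sin (n.+1%:R^-1 * y)) @[n --> \oo] --> Num.sg y.
Proof.
wlog y0 : y / 0 <= y => [H|].
  have [|y0] := leP 0 y; first by move/H.
  rewrite -(opprK y) sgrN; under eq_fun do rewrite mulrN sinN sgrN.
  by apply: cvgN; apply: H; rewrite oppr_ge0 ltW.
move: y0; rewrite le_eqVlt => /predU1P[<-|y0].
  by under eq_fun do rewrite mulr0 sin0; exact: cvg_cst.
apply: cvg_near_cst; near=> n.
rewrite (gtr0_sg y0) gtr0_sg// sin_gt0_pi// mulr_gt0//=.
rewrite mulrC ltr_pdivrMr// (@lt_le_trans _ _ (2 * n%:R))//.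
  near: n; exists (Num.Def.archi_bound y) => // n /= bn.
  rewrite (lt_le_trans (archi_boundP (ltW y0)))// -natrM ler_nat.
  by rewrite (leq_trans bn)// leq_pmull.
by rewrite ler_pM ?pi_ge2// ler_nat.
Unshelve. all: end_near. Qed.

Lemma measurable_leP (d : measure_display) (T : measurableType d) (Z : T -> R) (s : R) :
  measurable_fun setT Z -> measurable_fun setT (fun w => (Z w <= s)%R%:R : R).
Proof.
move=> mZ; have -> : (fun w => (Z w <= s)%R%:R : R) = \1_(`]-oo, s]%classic) \o Z.
  by apply/funext => w /=; rewrite indicE mem_setE in_itv.
by apply: measurableT_comp => //; exact: measurable_indic.
Qed.

End trigonometric_sums.

Section cramer_wold.
Context {d1 d2 : measure_display} {T1 : measurableType d1} {T2 : measurableType d2}.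
Context {R : realType} (P1 : {finite_measure set T1 -> \bar R}).
Context (P2 : {finite_measure set T2 -> \bar R}).

Section one_variable.
Variables (W1 Z1 : T1 -> R) (W2 Z2 : T2 -> R) (B : R).
Hypotheses (mW1 : measurable_fun setT W1) (mZ1 : measurable_fun setT Z1).
Hypotheses (mW2 : measurable_fun setT W2) (mZ2 : measurable_fun setT Z2).
Hypotheses (bW1 : forall w, `|W1 w| <= B) (bW2 : forall w, `|W2 w| <= B).
Hypothesis eq_cos : forall x a,
  \int[P1]_w (W1 w * cos (x * Z1 w + a)) = \int[P2]_w (W2 w * cos (x * Z2 w + a)).

Let same f := \int[P1]_w (W1 w * f (Z1 w)) = \int[P2]_w (W2 w * f (Z2 w)).

Let int_trig (d : measure_display) (T : measurableType d)
   (P : {finite_measure set T -> \bar R}) (W Z : T -> R) :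
  measurable_fun setT W -> measurable_fun setT Z -> (forall w, `|W w| <= B) ->
  forall (f : R -> R) (C : R), measurable_fun setT f -> (forall z, `|f z| <= C) ->
  P.-integrable setT (EFin \o (fun w => W w * f (Z w))).
Proof.
move=> mW mZ bW f C mf bf; apply: (@bounded_int _ _ _ _ _ (B * C)).
  by apply: measurable_funM => //; exact: measurableT_comp.
by move=> w; rewrite normrM ler_pM.
Qed.

Let trig_bounded (f : R -> R) : is_trig f -> exists C : R, forall z, `|f z| <= C.
Proof.
move=> [s ->]; elim: s => [|p s [C IH]].
  by exists 0 => z; rewrite /trig_sum big_nil normr0.
exists (`|p.1.1| + C) => z; rewrite /trig_sum big_cons (le_trans (ler_normD _ _))//.
by apply: lerD; [rewrite normrM ler_piMr// ler_norml cos_geN1 cos_le1|exact: IH].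
Qed.

Let same_trig f : is_trig f -> same f.
Proof.
move=> [s ->]; elim: s => [|p s IH].
  rewrite /same /trig_sum; under eq_Rintegral do rewrite big_nil mulr0.
  under [RHS]eq_Rintegral do rewrite big_nil mulr0.
  by rewrite !Rintegral_cst// !mul0r.
have tp : is_trig (fun z => p.1.1 * cos (p.1.2 * z + p.2)).
  by apply: is_trigZ; exact: is_trig_cos.
have ts : is_trig (trig_sum s) by exists s.
have i1 g : is_trig g -> P1.-integrable setT (EFin \o (fun w => W1 w * g (Z1 w))).
  by move=> tg; have [C b] := trig_bounded tg; apply: int_trig b => //; exact: measurable_trig.
have i2 g : is_trig g -> P2.-integrable setT (EFin \o (fun w => W2 w * g (Z2 w))).
  by move=> tg; have [C b] := trig_bounded tg; apply: int_trig b => //; exact: measurable_trig.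
have tc := is_trig_cos p.1.2 p.2.
rewrite /same /trig_sum.
under eq_Rintegral do rewrite big_cons mulrDr.
under [RHS]eq_Rintegral do rewrite big_cons mulrDr.
rewrite (RintegralD measurableT (i1 _ tp) (i1 _ ts)) (RintegralD measurableT (i2 _ tp) (i2 _ ts)).
congr (_ + _); last exact: IH.
under eq_Rintegral do rewrite mulrCA.
under [RHS]eq_Rintegral do rewrite mulrCA.
rewrite (RintegralZl _ measurableT (i1 _ tc)) (RintegralZl _ measurableT (i2 _ tc)).
by rewrite eq_cos.
Qed.

Let same_cvg (f : nat -> R -> R) (g : R -> R) (C : R) :
  (forall n, measurable_fun setT (f n)) -> (forall n z, `|f n z| <= C) ->
  (forall z, f ^~ z @ \oo --> g z) -> (forall n, same (f n)) -> same g.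
Proof.
move=> mf bf fg sf.
have H (d : measure_display) (T : measurableType d)
   (P : {finite_measure set T -> \bar R}) (W Z : T -> R) :
  measurable_fun setT W -> measurable_fun setT Z -> (forall w, `|W w| <= B) ->
  \int[P]_w (W w * f n (Z w)) @[n --> \oo] --> \int[P]_w (W w * g (Z w)).
  move=> mW mZ bW; apply: (@Rintegral_bdct _ _ _ _ _ _ (B * C)).
  - by move=> n; apply: measurable_funM => //; exact: measurableT_comp.
  - by move=> n w; rewrite normrM ler_pM.
  - by move=> w; apply: cvgM; [exact: cvg_cst|exact: fg].
have c1 := H _ _ P1 _ _ mW1 mZ1 bW1; have c2 := H _ _ P2 _ _ mW2 mZ2 bW2.
have e : (fun n => \int[P1]_w (W1 w * f n (Z1 w))) =
  (fun n => \int[P2]_w (W2 w * f n (Z2 w))) by apply/funext => n; exact: sf.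
by rewrite e in c1; exact: (cvg_unique _ c1 c2).
Qed.

(** The indicator of a half line is a double limit of trigonometric polynomials: iterating
    [sgn_iter] on a sine produces a square wave, and letting its period tend to infinity leaves a
    single jump at s. Everything stays bounded, so both limits pass under the integrals. *)
Lemma weighted_char_le s :
  \int[P1]_w (W1 w * (Z1 w <= s)%R%:R) = \int[P2]_w (W2 w * (Z2 w <= s)%R%:R).
Proof.
pose q (k : nat) z : R := sin (k.+1%:R^-1 * (z - s)).
have q1 k z : `|q k z| <= 1 by rewrite ler_norml sin_geN1 sin_le1.
have tq k : is_trig (q k).
  have := is_trig_sin k.+1%:R^-1 (- (k.+1%:R^-1 * s)).
  by rewrite /q; under [X in _ -> is_trig X]eq_fun do rewrite mulrBr.
pose f (k n : nat) z := sgn_half (sgn_iter n (q k z)).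
have tf k n : is_trig (f k n).
  have ti := is_trig_sgn_iter n (tq k).
  have -> : f k n = fun z => 1 + (- 2^-1 * sgn_iter n (q k z) +
      - 2^-1 * (sgn_iter n (q k z) * sgn_iter n (q k z))).
    by apply/funext => z; rewrite /f /sgn_half; field.
  apply: is_trigD; first exact: is_trig_cst.
  by apply: is_trigD; apply: is_trigZ => //; exact: is_trigM.
pose g (k : nat) z := sgn_half (Num.sg (q k z)).
have sgc (u : nat -> R) l :
    u @ \oo --> l -> sgn_half (u n) @[n --> \oo] --> sgn_half l.
  move=> ul; apply: cvgM; last exact: cvg_cst.
  by apply: cvgB; [apply: cvgB => //; exact: cvg_cst|exact: cvgM].
have fg k z : f k ^~ z @ \oo --> g k z by apply: sgc; exact: sgn_iter_cvg.
have fb k n z : `|f k n z| <= 2 by apply: sgn_half_bound; exact: sgn_iter_bound.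
have sg1 (y : R) : `|Num.sg y| <= 1 by rewrite normr_sg; case: (y != 0).
have mf k n : measurable_fun setT (f k n) by exact: measurable_trig.
apply: (@same_cvg g (fun z => (z <= s)%R%:R) 2).
- by move=> k; exact: (measurable_fun_cvg (mf k) (fun z _ => fg k z)).
- by move=> k z; exact: sgn_half_bound.
- by move=> z; rewrite -sgn_half_sg; apply: sgc; exact: sgn_sin_cvg.
- by move=> k; apply: (@same_cvg (f k) (g k) 2) => // n; exact: same_trig.
Qed.

End one_variable.

(* Integrating out one coordinate at a time: the indicator of the last
   coordinate is absorbed into the weight. *)
Lemma cramer_wold (n : nat) (Z1 : nat -> T1 -> R) (Z2 : nat -> T2 -> R)
    (W1 : T1 -> R) (W2 : T2 -> R) (B : R) :
  measurable_fun setT W1 -> measurable_fun setT W2 ->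
  (forall w, `|W1 w| <= B) -> (forall w, `|W2 w| <= B) ->
  (forall j, measurable_fun setT (Z1 j)) -> (forall j, measurable_fun setT (Z2 j)) ->
  (forall (c : nat -> R) a,
     \int[P1]_w (W1 w * cos (\sum_(j < n) c j * Z1 j w + a)) =
     \int[P2]_w (W2 w * cos (\sum_(j < n) c j * Z2 j w + a))) ->
  forall s : nat -> R,
    \int[P1]_w (W1 w * \prod_(j < n) (Z1 j w <= s j)%R%:R) =
    \int[P2]_w (W2 w * \prod_(j < n) (Z2 j w <= s j)%R%:R).
Proof.
elim: n W1 W2 => [|n IHn] W1 W2 mW1 mW2 bW1 bW2 mZ1 mZ2 H s.
  have := H (fun=> 0) 0.
  under eq_Rintegral do rewrite big_ord0 addr0 cos0.
  under [X in _ = X -> _]eq_Rintegral do rewrite big_ord0 addr0 cos0.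
  under [X in _ -> X = _]eq_Rintegral do rewrite big_ord0.
  by under [X in _ -> _ = X]eq_Rintegral do rewrite big_ord0.
under eq_Rintegral do rewrite big_ord_recr/= mulrA mulrAC.
under [RHS]eq_Rintegral do rewrite big_ord_recr/= mulrA mulrAC.
have bnd (T : Type) (W : T -> R) (b : T -> bool) : (forall w, `|W w| <= B) ->
    forall w, `|W w * (b w)%:R| <= B.
  by move=> bW w; rewrite normrM; case: (b w); rewrite ?normr1 ?mulr1// normr0 mulr0 (le_trans _ (bW w)).
have bndc (T : Type) (W Z : T -> R) : (forall w, `|W w| <= B) ->
    forall w, `|W w * cos (Z w)| <= B.
  by move=> bW w; rewrite normrM (le_trans _ (bW w))// ler_piMr// ler_norml cos_geN1 cos_le1.
have mcos (d : measure_display) (T : measurableType d) (Z : T -> R) :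
    measurable_fun setT Z -> measurable_fun setT (fun w => cos (Z w)).
  by move=> mZ; apply: measurableT_comp mZ; exact: measurable_cos.
have mlin (d : measure_display) (T : measurableType d) (Z : nat -> T -> R) (c : nat -> R) a:
    (forall j, measurable_fun setT (Z j)) ->
    measurable_fun setT (fun w => \sum_(j < n) c j * Z j w + a).
  move=> mZ; apply: measurable_funD => //; apply: measurable_sum => j.
  exact: measurable_funM.
apply: (IHn (fun w => W1 w * (Z1 n w <= s n)%R%:R) (fun w => W2 w * (Z2 n w <= s n)%R%:R)) => //.
- by apply: measurable_funM => //; exact: measurable_leP.
- by apply: measurable_funM => //; exact: measurable_leP.
- exact: bnd.
- exact: bnd.
move=> c a.
under eq_Rintegral do rewrite mulrAC.
under [RHS]eq_Rintegral do rewrite mulrAC.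
apply: (@weighted_char_le _ _ _ _ B) => //.
- by apply: measurable_funM => //; apply: mcos; exact: mlin.
- by apply: measurable_funM => //; apply: mcos; exact: mlin.
- exact: bndc.
- exact: bndc.
move=> x b.
(* The product of two cosines is half the sum of two cosines, so the factor in the last coordinate
   merges with the others, at the price of the two frequencies x and [- x]. *)
have E (T : Type) (W : T -> R) (Z : nat -> T -> R) (w : T) :
    W w * cos (\sum_(j < n) c j * Z j w + a) * cos (x * Z n w + b) =
    2^-1 * (W w * cos (\sum_(j < n.+1) (if (j < n)%N then c j else x) * Z j w + (a + b))) +
    2^-1 * (W w * cos (\sum_(j < n.+1) (if (j < n)%N then c j else - x) * Z j w + (a - b))).
  have S x' : \sum_(j < n.+1) (if (j < n)%N then c j else x') * Z j w =
      \sum_(j < n) c j * Z j w + x' * Z n w.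
    rewrite big_ord_recr/= ltnn; congr (_ + _).
    by apply: eq_bigr => j _; rewrite ltn_ord.
  rewrite !S.
  rewrite -mulrA cosM mulrDr mulrCA [W w * (_ * _)]mulrCA.
  by congr (_ * (_ * cos _) + _ * (_ * cos _)); ring.
have int (d : measure_display) (T : measurableType d)
   (P : {finite_measure set T -> \bar R}) (W : T -> R) (Z : nat -> T -> R) c' a' :
   measurable_fun setT W -> (forall w, `|W w| <= B) -> (forall j, measurable_fun setT (Z j)) ->
   P.-integrable setT (EFin \o (fun w => W w * cos (\sum_(j < n.+1) c' j * Z j w + a'))).
  move=> mW bW mZ; apply: (@bounded_int _ _ _ _ _ B).
    apply: measurable_funM => //; apply: mcos; apply: measurable_funD => //.
    by apply: measurable_sum => j; exact: measurable_funM.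
  exact: bndc.
under eq_Rintegral do rewrite E.
under [RHS]eq_Rintegral do rewrite E.
rewrite !RintegralD//; try by apply: integrable_scale; exact: int.
rewrite !RintegralZl//; try exact: int.
congr (_ * _ + _ * _).
- exact: (H (fun j => if (j < n)%N then c j else x)).
- exact: (H (fun j => if (j < n)%N then c j else - x)).
Qed.

End cramer_wold.

(** * Derivatives used in the Gaussian integrations by parts *)

Section derivatives.
Context {R : realType}.

Lemma is_derive_affine (k a z : R) : is_derive z (1 : R) (fun z : R => k * z + a) k.
Proof.
have h := is_deriveD (is_deriveM (is_derive_cst k z (1 : R)) (is_derive_id z (1 : R)))
  (is_derive_cst a z (1 : R)).
by apply: is_derive_eq h _; rewrite scaler0 !addr0 -[LHS]/(k * 1) mulr1.
Qed.

Lemma is_derive_cos_affine (k a z : R) :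
  is_derive z (1 : R) (fun z : R => cos (k * z + a)) (- k * sin (k * z + a)).
Proof.
have h := @is_derive1_comp _ cos (fun z : R => k * z + a) _ _ _ (is_derive_cos (k * z + a)) (is_derive_affine k a z).
by apply: is_derive_eq h _; rewrite !mulNr mulrC.
Qed.

Lemma is_derive_sin_affine (k a z : R) :
  is_derive z (1 : R) (fun z : R => sin (k * z + a)) (k * cos (k * z + a)).
Proof.
have h := @is_derive1_comp _ sin (fun z : R => k * z + a) _ _ _ (is_derive_sin (k * z + a)) (is_derive_affine k a z).
by apply: is_derive_eq h _; rewrite -[LHS]/(_ * _) mulrC.
Qed.

Lemma is_derive_gauss (k z : R) :
  is_derive z (1 : R) (fun z : R => expR (- (k * z ^+ 2))) (- (2 * k * z) * expR (- (k * z ^+ 2))).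
Proof.
have h0 := is_deriveN (is_deriveM (is_derive_cst k z (1 : R))
  (is_deriveX 2 (is_derive_id z (1 : R)))).
have h := @is_derive1_comp _ expR (fun z : R => - (k * z ^+ 2)) _ _ _ (is_derive_expR _) h0.
apply: is_derive_eq h _.
by rewrite scaler0 addr0 -![_ *: _]/(_ * _) /cst expr1; ring.
Qed.

Lemma is_derive_mul (f g : R -> R) (z df dg : R) :
  is_derive z (1 : R) f df -> is_derive z (1 : R) g dg ->
  is_derive z (1 : R) (fun z => f z * g z) (df * g z + f z * dg).
Proof.
move=> hf hg; have h := is_deriveM hf hg.
by apply: is_derive_eq h _; rewrite -![_ *: _]/(_ * _) addrC mulrC [X in _ + X]mulrC.
Qed.

End derivatives.

(** * Normal laws *)

Section real_laws.
Context {R : realType}.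

(* The library's Borel sigma-algebra on [measurableTypeR R] and the one carried
   by [R] have the same sets but different displays: [real_law] moves a
   probability from the former to the latter. *)
Definition id_measurableTypeR : measurableTypeR R -> R := idfun.

HB.instance Definition _ :=
  @isMeasurableFun.Build _ _ _ _ id_measurableTypeR (@measurable_id _ _ setT).

Definition real_law (N : probability (measurableTypeR R) R) : probability R R :=
  distribution N (id_measurableTypeR : {RV N >-> R}).

Variable N : probability (measurableTypeR R) R.

Lemma real_law_integrable (f : R -> R) :
  (real_law N).-integrable setT (EFin \o f) -> N.-integrable setT (EFin \o f).
Proof.
move=> /integrableP[mf fi]; apply/integrableP; split => //.
apply: le_lt_trans fi.
rewrite /real_law ge0_integral_distribution//; exact: measurableT_comp.
Qed.

Lemma integral_real_law (f : R -> R) : (real_law N).-integrable setT (EFin \o f) ->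
  (\int[real_law N]_x (f x)%:E = \int[N]_x (f x)%:E)%E.
Proof.
move=> intf; rewrite integral_distribution//; first exact: measurable_int intf.
exact: real_law_integrable.
Qed.

End real_laws.

Definition normal_law {R : realType} (s : R) : probability R R :=
  real_law (normal_prob 0 s : probability (measurableTypeR R) R).

Section normal_law.
Context {R : realType}.
Variable s : R.
Hypothesis s0 : s != 0.
Let v := s ^+ 2.
Let v0 : 0 < v. Proof. by rewrite exprn_even_gt0. Qed.
Notation N := (normal_law s).
Notation leb := (@lebesgue_measure R).
Let p (x : R) := normal_pdf 0 s x.

Let pE x : p x = normal_peak s * expR (- ((2 * v)^-1 * x ^+ 2)).
Proof.
rewrite /p (normal_pdfE _ s0) /normal_fun subr0; congr (_ * expR _).
by rewrite /v -mulr_natl mulNr [in RHS]mulrC.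
Qed.

Let mp : measurable_fun setT p. Proof. exact: measurable_normal_pdf. Qed.

(** The Radon-Nikodym derivative of the normal law is determined almost everywhere by its integrals,
    and the density [p] has the same ones. *)
Let integral_normal (f : R -> R) : N.-integrable setT (EFin \o f) ->
  (\int[N]_x (f x)%:E = \int[leb]_x (f x * p x)%:E)%E.
Proof.
move=> intfN; rewrite (integral_real_law intfN).
have intf := real_law_integrable intfN.
have dom := @normal_prob_dominates R 0 s.
rewrite -(Radon_Nikodym_change_of_variables dom)//=.
have mf := measurable_int _ intf.
under [RHS]eq_integral do rewrite EFinM.
apply: ae_eq_integral => //.
1,2: by apply: emeasurable_funM => //; exact/measurable_EFinP.
- apply: ae_eqe_mul2l => /=.
  rewrite Radon_NikodymE//=.
  case: cid => /= h [h1 h2 h3].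
  apply: integral_ae_eq => //=.
  + exact/measurable_EFinP.
  + by move=> E E01 mE; rewrite -h3.
Qed.

Let dp x : is_derive x (1 : R) p (- (x / v) * p x).
Proof.
have -> : p = fun x => normal_peak s * expR (- ((2 * v)^-1 * x ^+ 2)) by apply/funext.
have h := is_derive_mul (is_derive_cst (normal_peak s) x 1) (is_derive_gauss (2 * v)^-1 x).
apply: is_derive_eq h _; rewrite mul0r add0r /cst.
by have := v0; move=> /lt0r_neq0 vn0; field.
Qed.

Let cvg_p1 : (n.+1%:R * p n.+1%:R : R) @[n --> \oo] --> 0.
Proof.
apply: (@squeeze_cvgr _ _ _ _ (cst 0) (fun n => (normal_peak s * (2 * v)) * n.+1%:R^-1)).
- apply: nearW => n; rewrite pE; apply/andP; split.
    by rewrite !mulr_ge0// ?normal_peak_ge0// expR_ge0.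
  rewrite mulrCA -mulrA ler_wpM2l ?normal_peak_ge0//.
  rewrite expRN ler_pdivrMr ?expR_gt0//.
  have x0 : (0 : R) < n.+1%:R by [].
  set x : R := n.+1%:R in x0 *.
  (* With [y = x^2 / (2v)], the inequality [expR y >= y] bounds [x / expR y] by [x / y = 2v / x]. *)
  have e : x = 2 * v / x * ((2 * v)^-1 * x ^+ 2) by field; rewrite !lt0r_neq0.
  rewrite [leLHS]e; apply: ler_wpM2l; first by apply: divr_ge0; [apply: mulr_ge0 => //; exact: ltW|exact: ltW].
  by rewrite (le_trans _ (expR_ge1Dx _))// lerDr.
- exact: cvg_cst.
- by rewrite -[X in _ --> X](mulr0 (normal_peak s * (2 * v))); apply: cvgM; [exact: cvg_cst|exact: cvg_harmonic].
Qed.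

Let cvg_p : (p n.+1%:R : R) @[n --> \oo] --> 0.
Proof.
apply: (@squeeze_cvgr _ _ _ _ (cst 0) _ _ _ _ _ cvg_p1); last exact: cvg_cst.
apply: nearW => n; rewrite normal_pdf_ge0/= ler_peMl ?normal_pdf_ge0//.
by rewrite ler1n.
Qed.

Let pN x : p (- x) = p x. Proof. by rewrite !pE sqrrN. Qed.

Let J (n : nat) : set R := `[- n.+1%:R, n.+1%:R]%classic.

Let J1 n x : (\1_(J n) x : R) = (`|x| <= n.+1%:R)%R%:R.
Proof. by rewrite indicE /J mem_setE in_itv/= ler_norml. Qed.

(** The density satisfies [p' = - (x/v) p], so [(g p)' = (g' - (x/v) g) p]. This is Stein's identity
    on a bounded interval; g is the identity for the variance, a constant for the mean and a sine
    for the characteristic function. *)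
Let ibp_bounded (g g' : R -> R) (n : nat) :
  (forall x, is_derive x (1 : R) g (g' x)) -> continuous g' ->
  \int[N]_x (\1_(J n) x * (g' x - x / v * g x)) =
  g n.+1%:R * p n.+1%:R - g (- n.+1%:R) * p n.+1%:R.
Proof.
move=> dg cg'.
have cg : continuous g by move=> x; apply: differentiable_continuous; apply/derivable1_diffP; case: (dg x).
pose h x := (g' x - x / v * g x) * p x.
have cp : continuous p by exact: continuous_normal_pdf.
have cf : continuous (fun x => g' x - x / v * g x).
  move=> x; apply: cvgB; first exact: cg'.
  by apply: cvgM; [apply: cvgM; [exact: cvg_id|exact: cvg_cst]|exact: cg].
have ch : continuous h by move=> x; apply: cvgM; [exact: cf|exact: cp].
have mf : measurable_fun setT (fun x => \1_(J n) x * (g' x - x / v * g x)).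
  by apply: measurable_funM; [apply: measurable_indic; exact: measurable_itv|exact: continuous_measurable_fun].
have intf : N.-integrable setT (EFin \o (fun x => \1_(J n) x * (g' x - x / v * g x))).
  have [M [_ HM]] := compact_bounded (continuous_compact (continuous_subspaceT cf) (@segment_compact R (- n.+1%:R) n.+1%:R)).
  apply: (@bounded_int _ _ _ _ _ (`|M| + 1)) => // x.
  rewrite normrM J1; have [xn|_] := boolP (`|x| <= _); last by rewrite normr0 mul0r addr_ge0.
   rewrite normr1 mul1r; apply: (HM (`|M| + 1)).
    by rewrite (le_lt_trans (ler_norm _))// ltrDl.
  by exists x => //=; rewrite in_itv/= -ler_norml.
rewrite /Rintegral integral_normal//.
transitivity (fine (\int[leb]_(x in J n) (h x)%:E)%E).
  congr fine; rewrite [RHS]integral_mkcond; apply: eq_integral => x _.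
  rewrite patchE indicE; case: (x \in J n); first by rewrite mul1r.
  by rewrite !mul0r.
have dG x : is_derive x (1 : R) (fun x => g x * p x) (h x).
  apply: is_derive_eq (is_derive_mul (dg x) (dp x)) _.
  by rewrite /h; ring.
have n0 : - n.+1%:R < n.+1%:R :> R by rewrite -subr_gt0 opprK.
have cG : continuous (fun x => g x * p x) by move=> x; apply: cvgM; [exact: cg|exact: cp].
rewrite (@continuous_FTC2 _ h (fun x => g x * p x))//=.
- by rewrite pN.
- exact: continuous_subspaceT.
- split.
  + by move=> x _; case: (dG x).
  + by apply: cvg_at_right_filter; exact: cG.
  + by apply: cvg_at_left_filter; exact: cG.
- by move=> x _; rewrite derive1E; case: (dG x).
Qed.

Let J_cvg (f : R -> R) x : (\1_(J n) x * f x : R) @[n --> \oo] --> f x.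
Proof.
apply: cvg_near_cst; near=> n.
rewrite J1 (_ : _ <= _) ?mul1r//.
apply: (@le_trans _ _ (Num.Def.archi_bound x)%:R).
  by apply: ltW; exact: unstable.ltr_norm_bound.
rewrite ler_nat; near: n; exists (Num.Def.archi_bound x) => // n /= bn.
exact: leqW.
Unshelve. all: end_near. Qed.

Let J_dct (f : R -> R) : N.-integrable setT (EFin \o f) ->
  \int[N]_x (\1_(J n) x * f x) @[n --> \oo] --> \int[N]_x f x.
Proof.
move=> intf; have mf := proj1 (measurable_EFinP _ _) (measurable_int N intf).
apply: (@Rintegral_dct _ _ _ _ _ _ (fun x => `|f x|)).
- move=> n; apply: measurable_funM => //; apply: measurable_indic; exact: measurable_itv.
- exact: integrable_norm.
- move=> n x; rewrite normrM J1; case: (`|x| <= _); first by rewrite normr1 mul1r.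
  by rewrite normr0 mul0r.
- by move=> x; exact: J_cvg.
Qed.

(** For [g = id] the boundary terms of [ibp_bounded] are nonnegative, so every truncated second
    moment is at most v; monotone convergence removes the truncation. *)
Lemma normal_sqr_integrable : N.-integrable setT (EFin \o (fun x => x ^+ 2)).
Proof.
have msq : measurable_fun setT (fun x : R => x ^+ 2) by exact: measurable_funX.
have mJ n : measurable_fun setT (\1_(J n) : R -> R).
  by apply: measurable_indic; exact: measurable_itv.
pose F n (x : R) := (\1_(J n) x * x ^+ 2)%:E.
have mF n : measurable_fun setT (F n).
  by apply/measurable_EFinP; exact: measurable_funM.
have F0 n x : (0 <= F n x)%E by rewrite lee_fin mulr_ge0 ?sqr_ge0.
have Fi n : N.-integrable setT (EFin \o (fun x => \1_(J n) x * x ^+ 2)).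
  apply: (@bounded_int _ _ _ _ _ (n.+1%:R ^+ 2)); first exact: measurable_funM.
  move=> x; rewrite J1; have [xn|_] := boolP (`|x| <= _); last first.
    by rewrite mul0r normr0 sqr_ge0.
  by rewrite mul1r normrX ler_pXn2r// nnegrE.
have Fle n : (\int[N]_x F n x <= v%:E)%E.
  have : \int[N]_x (\1_(J n) x * x ^+ 2) <= v.
    have hc : continuous (fun _ : R => 1 : R) by move=> x; exact: cvg_cst.
    have h := @ibp_bounded id (fun=> 1) n (fun x => is_derive_id x (1 : R)) hc.
    have ilin : N.-integrable setT (EFin \o (fun x => \1_(J n) x)).
      apply: (@bounded_int _ _ _ _ _ 1) => // x; rewrite J1.
      by case: (`|x| <= _); rewrite ?normr1 ?normr0.
    have e : (fun x => \1_(J n) x * (1 - x / v * id x)) =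
       (fun x => \1_(J n) x - v^-1 * (\1_(J n) x * x ^+ 2)).
      by apply/funext => x /=; ring.
    rewrite e RintegralB// in h; last exact: integrable_scale.
    rewrite RintegralZl// in h.
    have p0 : 0 <= p n.+1%:R by exact: normal_pdf_ge0.
    have h1 : \int[N]_x (\1_(J n) x) <= 1.
      rewrite /Rintegral integral_indic//; last exact: measurable_itv.
      rewrite setIT -lee_fin fineK ?fin_num_measure//; last exact: measurable_itv.
      by apply: probability_le1; exact: measurable_itv.
    have : v^-1 * \int[N]_x (\1_(J n) x * x ^+ 2) <= 1.
      apply: le_trans h1; rewrite -subr_ge0 h mulNr opprK.
      by rewrite addr_ge0// mulr_ge0.
    by rewrite mulrC ler_pdivrMr// mul1r.
  by rewrite -lee_fin (Rintegral_EFin (Fi n)).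
apply/integrableP; split; first exact/measurable_EFinP.
have c : (\int[N]_x F n x @[n --> \oo] --> \int[N]_x (x ^+ 2)%:E)%E.
  have -> : (\int[N]_x (x ^+ 2)%:E = \int[N]_x limn (F ^~ x))%E.
    apply: eq_integral => x _; apply/esym/cvg_lim => //.
    by apply: cvg_EFin; [exact: nearW|exact: J_cvg].
  apply: cvg_monotone_convergence => //.
  move=> x _ m n mn; rewrite lee_fin ler_wpM2r ?sqr_ge0// !J1 ler_nat.
  have [xm|//] := boolP (`|x| <= m.+1%:R).
  by rewrite (le_trans xm)// ler_nat.
under eq_integral do rewrite /= ger0_norm ?sqr_ge0//.
apply: (@le_lt_trans _ _ v%:E); last exact: ltry.
rewrite -(cvg_lim _ c)//; apply: lime_le; first by apply/cvg_ex; eexists; exact: c.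
by apply: nearW => n.
Qed.

Let id_integrable : N.-integrable setT (EFin \o (@id R)).
Proof.
apply: (@integrable_dominated _ _ _ _ _ (fun x : R => 1 + x ^+ 2)) => //.
- move=> x; rewrite -[X in _ <= 1 + X](@real_normK _ x) ?num_real//.
  by have := normr_ge0 x; nra.
- apply: integrable_add; first exact: integrable_cst.
  exact: normal_sqr_integrable.
Qed.

Lemma normal_sqr : \int[N]_x (x ^+ 2) = v.
Proof.
have hc : continuous (fun _ : R => 1 : R) by move=> x; exact: cvg_cst.
have h n := @ibp_bounded id (fun=> 1) n (fun x => is_derive_id x (1 : R)) hc.
have i2 : N.-integrable setT (EFin \o (fun x => 1 - v^-1 * x ^+ 2)).
  apply: integrable_sub; first exact: integrable_cst.
  by apply: integrable_scale; exact: normal_sqr_integrable.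
have c1 := J_dct i2.
have c2 : \int[N]_x (\1_(J n) x * (1 - v^-1 * x ^+ 2)) @[n --> \oo] --> (0 : R).
  have -> : (fun n => \int[N]_x (\1_(J n) x * (1 - v^-1 * x ^+ 2))) =
    (fun n => n.+1%:R * p n.+1%:R + n.+1%:R * p n.+1%:R).
    apply/funext => n.
    transitivity (\int[N]_x (\1_(J n) x * (1 - x / v * id x))).
      by apply: eq_Rintegral => x _ /=; congr (_ * (_ - _)); ring.
    by rewrite (h n) mulNr opprK.
  by rewrite -[X in _ --> X](addr0 0); apply: cvgD; exact: cvg_p1.
have := cvgn_unique c1 c2.
rewrite RintegralB//.
- rewrite RintegralZl//; last exact: normal_sqr_integrable.
  rewrite Rintegral_prob_cst => /eqP; rewrite subr_eq0 => /eqP e.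
  by apply: (@mulfI _ v^-1); rewrite ?invr_neq0 ?lt0r_neq0// -e mulVf// lt0r_neq0.
- exact: integrable_cst.
- by apply: integrable_scale; exact: normal_sqr_integrable.
Qed.

Lemma normal_mean : \int[N]_x x = 0.
Proof.
have h n := @ibp_bounded (fun=> 1) (fun=> 0) n (fun x => is_derive_cst (1 : R) x (1 : R)) _.
have i2 : N.-integrable setT (EFin \o (fun x : R => - v^-1 * x)).
  by apply: integrable_scale; exact: id_integrable.
have c1 := J_dct i2.
have c2 : \int[N]_x (\1_(J n) x * (- v^-1 * x)) @[n --> \oo] --> (0 : R).
  have -> : (fun n => \int[N]_x (\1_(J n) x * (- v^-1 * x))) = fun=> 0.
    apply/funext => n.
    transitivity (\int[N]_x (\1_(J n) x * (0 - x / v * 1))).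
      by apply: eq_Rintegral => x _; congr (_ * _); rewrite sub0r mulr1 mulNr mulrC.
    by rewrite h ?mul1r ?subrr// => x; exact: cvg_cst.
  exact: cvg_cst.
have := cvgn_unique c1 c2.
rewrite (RintegralZl _ measurableT id_integrable).
by move/eqP; rewrite mulf_eq0 oppr_eq0 invr_eq0 (gt_eqF v0) => /eqP.
Qed.

Let trig_integrable (f : R -> R) : is_trig f -> N.-integrable setT (EFin \o f).
Proof.
move=> [t ->]; elim: t => [|q t IH].
  apply: (@bounded_int _ _ _ _ _ 0); first by apply: measurable_trig; exists [::].
  by move=> x; rewrite /trig_sum big_nil normr0.
have -> : trig_sum (q :: t) = (fun x => q.1.1 * cos (q.1.2 * x + q.2) + trig_sum t x).
  by apply/funext => x; rewrite /trig_sum big_cons.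
apply: integrable_add => //; apply: integrable_scale.
apply: (@bounded_int _ _ _ _ _ 1); first by apply: measurable_trig; exact: is_trig_cos.
by move=> x; rewrite ler_norml cos_geN1 cos_le1.
Qed.

Let xtrig_integrable (k a : R) :
  N.-integrable setT (EFin \o (fun x => x * sin (k * x + a))).
Proof.
apply: (@integrable_dominated _ _ _ _ _ (fun x : R => `|x|)); last exact: integrable_norm id_integrable.
- apply: measurable_funM => //.
  by apply: measurable_trig; exact: is_trig_sin.
- by move=> x; rewrite normrM ler_piMr// ler_norml sin_geN1 sin_le1.
Qed.

Let stein (k a : R) :
  \int[N]_x (x * sin (k * x + a)) = v * k * \int[N]_x cos (k * x + a).
Proof.
have icos : N.-integrable setT (EFin \o (fun x => cos (k * x + a))).
  by apply: trig_integrable; exact: is_trig_cos.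
have h n := @ibp_bounded (fun x => sin (k * x + a)) (fun x => k * cos (k * x + a)) n
  (is_derive_sin_affine k a) _.
have i2 : N.-integrable setT (EFin \o (fun x => k * cos (k * x + a) - v^-1 * (x * sin (k * x + a)))).
  by apply: integrable_sub; apply: integrable_scale => //; exact: xtrig_integrable.
have c1 := J_dct i2.
have c2 : \int[N]_x (\1_(J n) x * (k * cos (k * x + a) - v^-1 * (x * sin (k * x + a)))) @[n --> \oo] --> (0 : R).
  have -> : (fun n => \int[N]_x (\1_(J n) x * (k * cos (k * x + a) - v^-1 * (x * sin (k * x + a))))) =
    (fun n => (sin (k * n.+1%:R + a) - sin (k * - n.+1%:R + a)) * p n.+1%:R).
    apply/funext => n; rewrite mulrBl -h.
      by apply: eq_Rintegral => x _; congr (_ * (_ - _)); ring.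
    move=> x; apply: cvgM; first exact: cvg_cst.
    apply: continuous_comp; last exact: continuous_cos.
    by apply: cvgD; [apply: cvgM; [exact: cvg_cst|exact: cvg_id]|exact: cvg_cst].
  apply: norm_cvg0; apply: (@squeeze_cvgr _ _ _ _ (cst 0) (fun n => 2 * p n.+1%:R)).
  - apply: nearW => n; rewrite normr_ge0 normrM/= (ger0_norm (normal_pdf_ge0 _ _ _)).
    rewrite ler_wpM2r ?normal_pdf_ge0// (le_trans (ler_normB _ _))//.
    by rewrite (_ : 2 = 1 + 1)// lerD// ler_norml sin_geN1 sin_le1.
  - exact: cvg_cst.
  - by rewrite -[X in _ --> X](mulr0 2); apply: cvgM; [exact: cvg_cst|exact: cvg_p].
have /eqP := cvgn_unique c1 c2.
have ixs := xtrig_integrable k a.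
rewrite RintegralB//; try exact: integrable_scale.
rewrite !RintegralZl// subr_eq0 => /eqP e.
by rewrite -mulrA e mulrA mulfV ?mul1r// lt0r_neq0.
Qed.

(** Differentiating in the frequency and applying [stein] gives [phi' = - v k phi], so
    [phi k * exp (v k^2 / 2)] is constant, equal to its value [cos a] at 0. *)
Lemma normal_cos (k a : R) :
  \int[N]_x cos (k * x + a) = cos a * expR (- (2^-1 * v * k ^+ 2)).
Proof.
pose phi (k : R) := \int[N]_x cos (k * x + a).
have icos k' : N.-integrable setT (EFin \o (fun x => cos (k' * x + a))).
  by apply: trig_integrable; exact: is_trig_cos.
have dk x k' : is_derive k' (1 : R) (fun k => cos (k * x + a)) (- x * sin (k' * x + a)).
  have := is_derive_cos_affine x a k'.
  under [X in is_derive _ _ X _ -> _]eq_fun do rewrite mulrC.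
  by rewrite [x * k']mulrC.
have dphi k' : is_derive k' (1 : R) phi (- (v * k') * phi k').
  have I1 : (`]k' - 1, k' + 1[%classic : set R) k' by rewrite /= in_itv/= ltrBlDr ltrDl ltr01.
  have D1 (x y : R) : (`]k' - 1, k' + 1[%classic : set R) x -> setT y ->
      derivable ((fun k x => cos (k * x + a)) ^~ y) x 1.
    by move=> _ _; case: (dk y x).
  have iabs : N.-integrable setT (EFin \o (fun x : R => `|x|)) by exact: integrable_norm id_integrable.
  have B1 (x y : R) : (`]k' - 1, k' + 1[%classic : set R) x -> setT y ->
      `|partial1of2 (fun k x => cos (k * x + a)) x y| <= `|y|.
    move=> _ _; rewrite /partial1of2 derive1E; case: (dk y x) => _ ->.
    by rewrite normrM normrN ler_piMr// ler_norml sin_geN1 sin_le1.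
  have := derivable_under_integral measurableT I1 (fun k _ => icos k) D1 (fun y => normr_ge0 y) iabs B1.
  have := differentiation_under_integral measurableT I1 (fun k _ => icos k) D1 (fun y => normr_ge0 y) iabs B1.
  move=> e d; split; first exact: d.
  rewrite -derive1E [LHS]e.
  transitivity (\int[N]_x (-1 * (x * sin (k' * x + a)))).
    apply: eq_Rintegral => x _; rewrite /partial1of2 derive1E; case: (dk x k') => _ ->.
    by rewrite mulN1r mulNr.
  by rewrite RintegralZl// ?stein ?mulN1r ?mulNr//; exact: xtrig_integrable.
have dpsi x : is_derive x (1 : R) (fun k => phi k * expR (- (- (2^-1 * v) * k ^+ 2))) 0.
  apply: is_derive_eq (is_derive_mul (dphi x) (is_derive_gauss _ x)) _.
  by field.
have := is_derive_0_is_cst k 0 dpsi.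
rewrite /phi; under [X in _ = X * _ -> _]eq_Rintegral do rewrite mul0r add0r.
rewrite Rintegral_prob_cst expr0n/= mulr0 oppr0 expR0 mulr1 => <-.
by rewrite -[RHS]mulrA -expRD mulNr opprK addrN expR0 mulr1.
Qed.

(** For x > u >= 0, [x^2 >= u^2 + (x - u)^2]: beyond u the density is at most the exponential factor
    times the density of the law centred at u, whose mass is 1. *)
Lemma normal_tail_le (u : R) : 0 <= u ->
  fine (N `]u, +oo[%classic) <= expR (- ((2 * v)^-1 * u ^+ 2)).
Proof.
move=> u0.
rewrite -lee_fin fineK ?fin_num_measure//.
have -> : N `]u, +oo[%classic = (\int[leb]_(x in `]u, +oo[%classic) (p x)%:E)%E by [].
set k := expR _.
have k0 : 0 <= k by exact: expR_ge0.
have iv0 : 0 <= (2 * v)^-1 by rewrite invr_ge0 mulr_ge0// ltW.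
have aux (x : R) : u < x -> u ^+ 2 + (x - u) ^+ 2 <= x ^+ 2 by nra.
apply: (@le_trans _ _ (\int[leb]_(x in `]u, +oo[%classic) (k * normal_pdf u s x)%:E)%E).
  apply: ge0_le_integral => //.
  - by move=> x _; rewrite lee_fin normal_pdf_ge0.
  - by apply/measurable_EFinP; exact: measurable_funTS.
  - by apply/measurable_EFinP/measurable_funTS/measurable_funM => //; exact: measurable_normal_pdf.
  - move=> x /=; rewrite in_itv/= andbT => ux; rewrite lee_fin pE.
    rewrite (normal_pdfE _ s0) /normal_fun [k * _]mulrCA ler_wpM2l ?normal_peak_ge0//.
    rewrite -expRD ler_expR.
    have -> : - (x - u) ^+ 2 / (s ^+ 2 *+ 2) = - ((2 * v)^-1 * (x - u) ^+ 2).
      by rewrite mulNr mulrC mulr_natl.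
    by rewrite -opprD lerN2 -mulrDr ler_wpM2l// aux.
apply: (@le_trans _ _ (\int[leb]_x (k * normal_pdf u s x)%:E)%E).
  apply: ge0_subset_integral => //.
  - by apply/measurable_EFinP/measurable_funM => //; exact: measurable_normal_pdf.
  - by move=> x _; rewrite lee_fin mulr_ge0// normal_pdf_ge0.
under eq_integral do rewrite EFinM.
rewrite ge0_integralZl//.
- by rewrite integral_normal_pdf mule1.
- by apply/measurable_EFinP; exact: measurable_normal_pdf.
- by move=> x _; rewrite lee_fin normal_pdf_ge0.
Qed.

(** Only the interval []u, u + 1]] is kept; the density there is at least its value at u + 1. *)
Lemma normal_tail_ge (u : R) : 0 <= u ->
  normal_peak s * expR (- ((2 * v)^-1 * (u + 1) ^+ 2)) <= fine (N `]u, +oo[%classic).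
Proof.
move=> u0.
rewrite -lee_fin fineK ?fin_num_measure// -pE.
have iv0 : 0 <= (2 * v)^-1 by rewrite invr_ge0 mulr_ge0// ltW.
have aux (x : R) : u < x -> x <= u + 1 -> x ^+ 2 <= (u + 1) ^+ 2 by nra.
have -> : N `]u, +oo[%classic = (\int[leb]_(x in `]u, +oo[%classic) (p x)%:E)%E by [].
apply: (@le_trans _ _ (\int[leb]_(x in `]u, (u + 1)%R]%classic) (p (u + 1))%:E)%E).
  rewrite integral_cst//= lebesgue_measure_itv/= lte_fin ltrDl ltr01.
  by rewrite -EFinD addrAC subrr add0r mule1.
apply: (@le_trans _ _ (\int[leb]_(x in `]u, (u + 1)%R]%classic) (p x)%:E)%E).
  apply: ge0_le_integral => //.
  - by move=> x _; rewrite lee_fin normal_pdf_ge0.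
  - by apply/measurable_EFinP; exact: measurable_funTS.
  - move=> x /=; rewrite in_itv/= => /andP[ux xu]; rewrite lee_fin !pE.
    rewrite ler_wpM2l ?normal_peak_ge0// ler_expR lerN2.
    by rewrite ler_wpM2l// aux.
apply: ge0_subset_integral => //.
- by apply/measurable_EFinP; exact: measurable_funTS.
- by move=> x _; rewrite lee_fin normal_pdf_ge0.
- by move=> x /=; rewrite !in_itv/= andbT => /andP[].
Qed.

End normal_law.
(** * Square-integrable and Gaussian variables *)

Section square_integrable.
Context {d : measure_display} {T : measurableType d} {R : realType}.
Variable P : {finite_measure set T -> \bar R}.
Implicit Types f g h : T -> R.

Definition sq_int f :=
  measurable_fun setT f /\ P.-integrable setT (EFin \o (fun w => f w ^+ 2)).

Definition ip f g : R := \int[P]_w (f w * g w).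

Lemma sq_int_mul f g : sq_int f -> sq_int g ->
  P.-integrable setT (EFin \o (fun w => f w * g w)).
Proof.
move=> [mf fi] [mg gi].
apply: integrable_dominated (integrable_add fi gi); first exact: measurable_funM.
by move=> w; rewrite ler_norml; apply/andP; split; nra.
Qed.

Lemma sq_intD f g : sq_int f -> sq_int g -> sq_int (fun w => f w + g w).
Proof.
move=> [mf fi] [mg gi]; split; first exact: measurable_funD.
apply: integrable_dominated (integrable_scale 2 (integrable_add fi gi)).
  by apply: measurable_funX; exact: measurable_funD.
by move=> w; rewrite ger0_norm ?sqr_ge0//; have := sqr_ge0 (f w - g w); nra.
Qed.

Lemma sq_intZ k f : sq_int f -> sq_int (fun w => k * f w).
Proof.
move=> [mf fi]; split; first exact: measurable_funM.
apply: integrable_dominated (integrable_scale (k ^+ 2) fi).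
  by apply: measurable_funX; exact: measurable_funM.
by move=> w; rewrite ger0_norm ?sqr_ge0// exprMn.
Qed.

Lemma sq_intB f g : sq_int f -> sq_int g -> sq_int (fun w => f w - g w).
Proof.
move=> lf lg; have := sq_intD lf (sq_intZ (-1) lg).
by under [X in sq_int X -> _]eq_fun do rewrite mulN1r.
Qed.

Lemma sq_int_cst k : sq_int (fun=> k).
Proof.
by split => //; exact: (integrable_cst P (k ^+ 2)).
Qed.

Lemma sq_int_bounded f B : measurable_fun setT f -> (forall w, `|f w| <= B) -> sq_int f.
Proof.
move=> mf fB; split => //; apply: (@bounded_int _ _ _ _ _ (B ^+ 2)).
  exact: measurable_funX.
move=> w; rewrite normrX ler_pXn2r// nnegrE//; exact: le_trans (fB w).
Qed.

Lemma sq_int_integrable f : sq_int f -> P.-integrable setT (EFin \o f).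
Proof.
move=> lf; have := sq_int_mul lf (sq_int_cst 1).
by under [X in P.-integrable _ (EFin \o X) -> _]eq_fun do rewrite mulr1.
Qed.

Lemma sq_int_sum n (c : nat -> R) (F : nat -> T -> R) :
  (forall j, (j < n)%N -> sq_int (F j)) -> sq_int (fun w => \sum_(j < n) c j * F j w).
Proof.
elim: n => [|n IHn] h.
  by under eq_fun do rewrite big_ord0; exact: sq_int_cst.
under eq_fun do rewrite big_ord_recr/=.
by apply: sq_intD; [apply: IHn => j jn; apply: h; exact: ltnW|apply: sq_intZ; exact: h].
Qed.

Lemma ipC f g : ip f g = ip g f.
Proof. by apply: eq_Rintegral => w _; rewrite mulrC. Qed.

Lemma ipDl f g h : sq_int f -> sq_int g -> sq_int h ->
  ip (fun w => f w + g w) h = ip f h + ip g h.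
Proof.
move=> lf lg lh; rewrite /ip; under eq_Rintegral do rewrite mulrDl.
by rewrite RintegralD//; exact: sq_int_mul.
Qed.

Lemma ipZl k f h : sq_int f -> sq_int h -> ip (fun w => k * f w) h = k * ip f h.
Proof.
move=> lf lh; rewrite /ip; under eq_Rintegral do rewrite -mulrA.
by rewrite RintegralZl//; exact: sq_int_mul.
Qed.

Lemma ipBl f g h : sq_int f -> sq_int g -> sq_int h ->
  ip (fun w => f w - g w) h = ip f h - ip g h.
Proof.
move=> lf lg lh; rewrite /ip; under eq_Rintegral do rewrite mulrBl.
by rewrite RintegralB//; exact: sq_int_mul.
Qed.

Lemma ipDr f g h : sq_int f -> sq_int g -> sq_int h ->
  ip h (fun w => f w + g w) = ip h f + ip h g.
Proof. by move=> lf lg lh; rewrite ipC ipDl// ipC [ip g h]ipC. Qed.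

Lemma ipZr k f h : sq_int f -> sq_int h -> ip h (fun w => k * f w) = k * ip h f.
Proof. by move=> lf lh; rewrite ipC ipZl// ipC. Qed.

Lemma ipBr f g h : sq_int f -> sq_int g -> sq_int h ->
  ip h (fun w => f w - g w) = ip h f - ip h g.
Proof. by move=> lf lg lh; rewrite ipC ipBl// ipC [ip g h]ipC. Qed.

Lemma ip_suml n (c : nat -> R) (F : nat -> T -> R) h :
  (forall j, (j < n)%N -> sq_int (F j)) -> sq_int h ->
  ip (fun w => \sum_(j < n) c j * F j w) h = \sum_(j < n) c j * ip (F j) h.
Proof.
move=> + lh; elim: n => [|n IHn] lF.
  rewrite big_ord0 /ip; under eq_Rintegral do rewrite big_ord0 mul0r.
  by rewrite Rintegral_cst// mul0r.
rewrite big_ord_recr/= -ipZl//; last exact: lF.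
rewrite -IHn; last by move=> j jn; apply: lF; exact: ltnW.
rewrite -ipDl//.
- by congr ip; apply/funext => w; rewrite big_ord_recr.
- by apply: sq_int_sum => j jn; apply: lF; exact: ltnW.
- by apply: sq_intZ; exact: lF.
Qed.

Lemma ip_ge0 f : 0 <= ip f f.
Proof. by apply: Rintegral_ge0 => w _; rewrite -expr2 sqr_ge0. Qed.

Lemma ip_sqrB f g : sq_int f -> sq_int g ->
  ip (fun w => f w - g w) (fun w => f w - g w) = ip f f - 2 * ip f g + ip g g.
Proof.
move=> lf lg; rewrite ipBl ?ipBr//; try exact: sq_intB.
by rewrite (ipC g f); ring.
Qed.

Lemma ip_sub_sym f g : ip (fun w => f w - g w) (fun w => f w - g w) =
  ip (fun w => g w - f w) (fun w => g w - f w).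
Proof. by apply: eq_Rintegral => w _; ring. Qed.

Lemma ip_sqrD f g : sq_int f -> sq_int g ->
  ip (fun w => f w + g w) (fun w => f w + g w) = ip f f + 2 * ip f g + ip g g.
Proof.
move=> lf lg; rewrite ipDl ?ipDr//; try exact: sq_intD.
by rewrite (ipC g f); ring.
Qed.

Lemma ip_amgm f g : sq_int f -> sq_int g -> 2 * ip f g <= ip f f + ip g g.
Proof.
move=> lf lg; have := ip_ge0 (fun w => f w - g w).
by rewrite ip_sqrB//; lra.
Qed.

Lemma ip_sqrB_le f g : sq_int f -> sq_int g ->
  ip (fun w => f w - g w) (fun w => f w - g w) <= 2 * ip f f + 2 * ip g g.
Proof.
move=> lf lg; have := ip_ge0 (fun w => f w + g w).
by rewrite ip_sqrB// ip_sqrD//; lra.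
Qed.

Lemma ip_cauchy_schwarz f g : sq_int f -> sq_int g -> ip f g ^+ 2 <= ip f f * ip g g.
Proof.
move=> lf lg.
have H k : 0 <= ip f f - 2 * (k * ip f g) + k ^+ 2 * ip g g.
  have := ip_ge0 (fun w => f w - k * g w).
  rewrite ip_sqrB// ?ipZr ?ipZl//; try exact: sq_intZ.
  by rewrite expr2 !mulrA.
have f0 := ip_ge0 f; have g0 := ip_ge0 g.
have [gp|] := ltP 0 (ip g g).
  have := H (ip f g / ip g g).
  have -> : ip f f - 2 * (ip f g / ip g g * ip f g) + (ip f g / ip g g) ^+ 2 * ip g g =
     ip f f - ip f g ^+ 2 / ip g g by field; rewrite gt_eqF.
  by rewrite subr_ge0 ler_pdivrMr.
move=> g0'; have e : ip g g = 0 by apply/eqP; rewrite eq_le g0' g0.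
have [->|fg0] := eqVneq (ip f g) 0; first by rewrite expr0n/= e mulr0.
(* When [ip g g] vanishes, the quadratic is affine in k, and this k makes it [- ip f f - 2]. *)
have := H ((ip f f + 1) / ip f g).
by rewrite e mulr0 addr0 divfK// => h; exfalso; move: h f0; clear; lra.
Qed.

Lemma ip_norm_le f g : sq_int f -> sq_int g ->
  `|ip f g| <= Num.sqrt (ip f f) * Num.sqrt (ip g g).
Proof.
move=> lf lg; rewrite -sqrtrM ?ip_ge0// -sqrtr_sqr ler_wsqrtr//.
exact: ip_cauchy_schwarz.
Qed.

Lemma ip_eq0 f : sq_int f -> ip f f = 0 -> {ae P, forall w, f w = 0}.
Proof.
move=> [mf fi] e.
have m2 : measurable_fun setT (EFin \o (fun w => f w ^+ 2)).
  by apply/measurable_EFinP; exact: measurable_funX.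
have [/(_ _)] := ae_eq_integral_abs P measurableT m2.
- have -> : (\int[P]_x `|(EFin \o (fun w => (f w ^+ 2)%R)) x| = (ip f f)%:E)%E.
    rewrite /ip; under [in RHS]eq_Rintegral do rewrite -expr2.
    rewrite Rintegral_EFin//; apply: eq_integral => w _ /=.
    by rewrite ger0_norm// sqr_ge0.
  rewrite e => /(_ erefl) h _.
  by apply: filterS h => w /(_ I)/= [] /eqP; rewrite sqrf_eq0 => /eqP.
Qed.

Lemma expectation_sqr f : sq_int f -> (\int[P]_w (f w ^+ 2)%:E)%E = (ip f f)%:E.
Proof. by move=> [_ fi]; rewrite -Rintegral_EFin. Qed.

Lemma ip_cvg (F : nat -> T -> R) f g : (forall n, sq_int (F n)) -> sq_int f -> sq_int g ->
  ip (fun w => F n w - f w) (fun w => F n w - f w) @[n --> \oo] --> 0 ->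
  ip (F n) g @[n --> \oo] --> ip f g.
Proof.
move=> lF lf lg h.
have h2 : Num.sqrt (ip (fun w => F n w - f w) (fun w => F n w - f w)) * Num.sqrt (ip g g)
    @[n --> \oo] --> 0.
  rewrite -(mul0r (Num.sqrt (ip g g))) -sqrtr0; apply: cvgM; last exact: cvg_cst.
  by apply: (cvg_comp _ _ h); exact: sqrt_continuous.
apply: (cvgn_dist_le _ h2) => n; rewrite -ipBl//.
by apply: ip_norm_le => //; exact: sq_intB.
Qed.

Lemma ip_cvg_sqr (F : nat -> T -> R) f : (forall n, sq_int (F n)) -> sq_int f ->
  ip (fun w => F n w - f w) (fun w => F n w - f w) @[n --> \oo] --> 0 ->
  ip (F n) (F n) @[n --> \oo] --> ip f f.
Proof.
move=> lF lf h.
have h1 := ip_cvg lF lf lf h.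
have -> : (fun n => ip (F n) (F n)) = (fun n =>
    ip (fun w => F n w - f w) (fun w => F n w - f w) + 2 * ip (F n) f - ip f f).
  by apply/funext => n; rewrite ip_sqrB//; ring.
rewrite [X in _ --> X](_ : ip f f = 0 + 2 * ip f f - ip f f); last by ring.
apply: cvgB; last exact: cvg_cst.
by apply: cvgD => //; apply: cvgM => //; exact: cvg_cst.
Qed.

End square_integrable.

Lemma expectationE (d : measure_display) (T : measurableType d) (R : realType)
  (P : probability T R) (f : T -> R) : ('E_P[f] = \int[P]_w (f w)%:E)%E.
Proof. by rewrite unlock. Qed.

Section gaussian_laws.
Context {R : realType}.

(** Deviation 0 stands for the Dirac mass at 0, matching the convention of
    [centered_gaussian_rv]. *)
Definition gauss_law (s : R) : probability R R :=
  if s == 0 then (dirac (0 : R) : probability R R) else normal_law s.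

Lemma dirac_integrable (f : R -> R) : measurable_fun setT f ->
  (dirac (0 : R) : probability R R).-integrable setT (EFin \o f).
Proof.
move=> mf; apply/integrableP; split; first exact/measurable_EFinP.
rewrite integral_dirac//; first by rewrite diracT mul1e ltry.
by do 2 apply: measurableT_comp => //.
Qed.

Lemma Rintegral_dirac (v : R) (f : R -> R) : measurable_fun setT f ->
  \int[(dirac v : probability R R)]_x f x = f v.
Proof.
move=> mf; rewrite /Rintegral integral_dirac//; first by rewrite diracT mul1e.
exact/measurable_EFinP.
Qed.

Lemma gauss_law_sqr_integrable s :
  (gauss_law s).-integrable setT (EFin \o (fun x => x ^+ 2)).
Proof.
rewrite /gauss_law; have [_|s0] := eqVneq s 0.
  by apply: dirac_integrable; exact: measurable_funX.
exact: normal_sqr_integrable.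
Qed.

Lemma gauss_law_sqr s : \int[gauss_law s]_x (x ^+ 2) = s ^+ 2.
Proof.
rewrite /gauss_law; have [->|s0] := eqVneq s 0.
  by rewrite Rintegral_dirac ?expr0n//; exact: measurable_funX.
exact: normal_sqr.
Qed.

Lemma gauss_law_mean s : \int[gauss_law s]_x x = 0.
Proof.
rewrite /gauss_law; have [_|s0] := eqVneq s 0; first by rewrite Rintegral_dirac.
exact: normal_mean.
Qed.

Lemma gauss_law_cos s k a :
  \int[gauss_law s]_x cos (k * x + a) = cos a * expR (- (2^-1 * s ^+ 2 * k ^+ 2)).
Proof.
rewrite /gauss_law; have [->|s0] := eqVneq s 0; last exact: normal_cos.
rewrite Rintegral_dirac; last by apply: measurable_trig; exact: is_trig_cos.
by rewrite expr0n/= !mulr0 mul0r oppr0 expR0 mulr1 add0r.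
Qed.

End gaussian_laws.

Section law_transfer.
Context {d : measure_display} {T : measurableType d} {R : realType}.
Variables (P : probability T R) (Y : T -> R) (mu : probability R R).
Hypothesis mY : measurable_fun setT Y.
Hypothesis lawY : forall A, measurable A -> P (Y @^-1` A) = mu A.

Let pY : {mfun T >-> R} := mfun_Sub (mem_set mY).

Lemma law_integrable (f : R -> R) : mu.-integrable setT (EFin \o f) ->
  P.-integrable setT (EFin \o (f \o Y)).
Proof.
move=> /integrableP[/measurable_EFinP mf fi]; apply/integrableP; split.
  by apply/measurable_EFinP; exact: measurableT_comp.
apply: le_lt_trans fi.
have -> : (\int[P]_x `|(EFin \o (f \o Y)) x| = \int[distribution P pY]_x `|(EFin \o f) x|)%E.
  rewrite ge0_integral_distribution//.
  by do 2 apply: measurableT_comp => //.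
by rewrite (eq_measure_integral mu)// => A mA _; exact: lawY.
Qed.

Lemma law_Rintegral (f : R -> R) : mu.-integrable setT (EFin \o f) ->
  \int[P]_w f (Y w) = \int[mu]_x f x.
Proof.
move=> fi; have fPi := law_integrable fi.
have /measurable_EFinP mf := measurable_int _ fi.
congr fine.
have -> : (\int[P]_w (f (Y w))%:E = \int[distribution P pY]_x (f x)%:E)%E.
  by rewrite integral_distribution//; exact/measurable_EFinP.
by apply: eq_measure_integral => A mA _; exact: lawY.
Qed.

End law_transfer.

Section gaussian_variables.
Context {d : measure_display} {T : measurableType d} {R : realType}.
Variable P : probability T R.
Implicit Types Y : T -> R.

(* Characteristic function of a centered Gaussian variable; this form is stable
   under limits in mean square. *)
Definition gaussian_cf Y := sq_int P Y /\
  forall a, \int[P]_w cos (Y w + a) = cos a * expR (- (2^-1 * ip P Y Y)).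

Lemma centered_gaussian_cf Y : centered_gaussian_rv P Y ->
  gaussian_cf Y /\ \int[P]_w Y w = 0.
Proof.
move=> [mY [s lawY]].
have lawY' A : measurable A -> P (Y @^-1` A) = gauss_law s A.
  by move=> mA; rewrite lawY// /gauss_law; case: ifP.
have i2 := law_integrable mY lawY' (gauss_law_sqr_integrable s).
have e2 := law_Rintegral mY lawY' (gauss_law_sqr_integrable s).
have l2 : sq_int (gauss_law s) id by split => //; exact: gauss_law_sqr_integrable.
split; last by rewrite (law_Rintegral mY lawY' (sq_int_integrable l2)) gauss_law_mean.
split => // a.
have -> : ip P Y Y = s ^+ 2 by rewrite -gauss_law_sqr -e2.
have ic : (gauss_law s).-integrable setT (EFin \o (fun x => cos (1 * x + a))).
  apply: (@bounded_int _ _ _ _ _ 1); first by apply: measurable_trig; exact: is_trig_cos.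
  by move=> x; rewrite ler_norml cos_geN1 cos_le1.
have := law_Rintegral mY lawY' ic; rewrite gauss_law_cos expr1n mulr1 => <-.
by apply: eq_Rintegral => w _; rewrite mul1r.
Qed.

Lemma cos_lipschitz (x y : R) : `|cos x - cos y| <= `|x - y|.
Proof.
wlog xy : x y / x <= y => [H|].
  by have [/H//|/ltW/H] := leP x y; rewrite distrC [`|y - x|]distrC.
have [c _ e] := @MVT_segment R cos (fun z => - sin z) x y xy
  (fun z _ => is_derive_cos z) (continuous_subspaceT (@continuous_cos R)).
by rewrite distrC e normrM normrN [`|x - y|]distrC ler_piMl// sin_max.
Qed.

(** The cosine is 1-Lipschitz and, for a probability, the L^1 norm is at most the L^2 norm; hence
    both sides of the identity converge. *)
Lemma gaussian_cf_cvg (F : nat -> T -> R) Y : (forall n, gaussian_cf (F n)) ->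
  sq_int P Y ->
  ip P (fun w => F n w - Y w) (fun w => F n w - Y w) @[n --> \oo] --> 0 ->
  gaussian_cf Y.
Proof.
move=> gF lY h; split => // a.
have lF n : sq_int P (F n) by case: (gF n).
have c1 : cos a * expR (- (2^-1 * ip P (F n) (F n))) @[n --> \oo] -->
    cos a * expR (- (2^-1 * ip P Y Y)).
  apply: cvgM; first exact: cvg_cst.
  apply: (@cvg_comp _ _ _ _ (@expR R)); last exact: continuous_expR.
  apply: cvgN; apply: cvgM; first exact: cvg_cst.
  exact: ip_cvg_sqr.
have icos (Z : T -> R) : measurable_fun setT Z ->
    P.-integrable setT (EFin \o (fun w => cos (Z w + a))).
  move=> mZ; apply: (@bounded_int _ _ _ _ _ 1).
    by apply: measurableT_comp; [exact: measurable_cos|exact: measurable_funD].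
  by move=> x; rewrite ler_norml cos_geN1 cos_le1.
have c2 : \int[P]_w cos (F n w + a) @[n --> \oo] --> \int[P]_w cos (Y w + a).
  have h2 : Num.sqrt (ip P (fun w => F n w - Y w) (fun w => F n w - Y w)) @[n --> \oo] --> 0.
    by rewrite -sqrtr0; apply: (cvg_comp _ _ h); exact: sqrt_continuous.
  apply: (cvgn_dist_le _ h2) => n.
    have [[mF _] [mY _]] := (lF n, lY).
    have lD := sq_intB (lF n) lY.
    rewrite -RintegralB//; try exact: icos.
    apply: le_trans (le_normr_Rintegral measurableT _) _.
      by apply: integrable_sub; exact: icos.
    apply: (@le_trans _ _ (\int[P]_w `|F n w - Y w|)).
      apply: le_Rintegral => //.
      + by apply: integrable_norm => //; apply: integrable_sub; exact: icos.
      + by apply: integrable_norm => //; exact: sq_int_integrable.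
      + move=> w _; apply: le_trans (cos_lipschitz _ _) _.
        by rewrite opprD addrACA subrr addr0.
    have ln : sq_int P (fun w => `|F n w - Y w|).
      split; first by apply: measurableT_comp => //; exact: measurable_funB.
      by under eq_fun do rewrite real_normK ?num_real//; case: lD.
    have := ip_norm_le ln (sq_int_cst P 1).
    rewrite /ip; under [X in Num.sqrt X * _]eq_Rintegral do rewrite -normrM -expr2 ger0_norm ?sqr_ge0// expr2.
    under [X in `|X| <= _]eq_Rintegral do rewrite mulr1.
    rewrite mulr1 Rintegral_prob_cst sqrtr1 mulr1; apply: le_trans.
    exact: ler_norm.
apply: cvgn_unique c2 _.
have -> : (fun n => \int[P]_w cos (F n w + a)) =
  (fun n => cos a * expR (- (2^-1 * ip P (F n) (F n)))).
  by apply/funext => n; case: (gF n).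
exact: c1.
Qed.

End gaussian_variables.

(** * Retraction onto the unit interval and grids *)

Section clamp.
Context {R : realType}.

(** The retraction of the line onto [0, 1]. A continuous function composed with it is continuous and
    bounded on the whole line, so no subspace topology has to be carried along. *)
Definition clamp01 (v : R) : R := Num.max 0 (Num.min v 1).

Lemma clamp01_itv v : 0 <= clamp01 v <= 1.
Proof. by rewrite /clamp01 le_max lexx/= ge_max ler01/= ge_min lexx orbT. Qed.

Lemma clamp01_id v : 0 <= v <= 1 -> clamp01 v = v.
Proof. by case/andP => v0 v1; rewrite /clamp01 (min_idPl v1) (max_idPr v0). Qed.

Lemma clamp01K v : clamp01 (clamp01 v) = clamp01 v.
Proof. by apply: clamp01_id; exact: clamp01_itv. Qed.

Lemma clamp01_lipschitz u v : `|clamp01 u - clamp01 v| <= `|u - v|.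
Proof.
wlog uv : u v / u <= v => [H|].
  by have [/H//|/ltW/H] := leP u v; rewrite distrC [`|v - u|]distrC.
rewrite distrC [`|u - v|]distrC [leRHS]ger0_norm ?subr_ge0// /clamp01.
have mono : Num.min u 1 <= Num.min v 1.
  by rewrite le_min ge_min uv/= ge_min lexx orbT.
have d0 : 0 <= v - u by rewrite subr_ge0.
rewrite ger0_norm ?subr_ge0 ?le_max2//.
rewrite lerBlDr ge_max; apply/andP; split.
  by rewrite addr_ge0// le_max lexx.
apply: (@le_trans _ _ (v - u + Num.min u 1)); last by rewrite lerD2l le_max lexx orbT.
by rewrite addr_minr subrK le_min ge_min lexx/= ge_min lerDr d0 orbT.
Qed.

Lemma continuous_clamp01 : continuous clamp01.
Proof.
move=> v; apply/cvgrPdist_lt => e e0; near=> u.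
apply: le_lt_trans (clamp01_lipschitz _ _) _.
by near: u; apply: cvgr_dist_lt.
Unshelve. all: end_near. Qed.

Lemma clamp_bounded (f : R -> R) : continuous f -> (forall v, f (clamp01 v) = f v) ->
  exists C : R, forall v, `|f v| <= C.
Proof.
move=> cf clf.
have [C [_ HC]] := compact_bounded (continuous_compact
  (continuous_subspaceT cf) (@segment_compact R 0 1)).
exists (`|C| + 1) => v; rewrite -clf; apply: (HC (`|C| + 1)).
  by rewrite (le_lt_trans (ler_norm _))// ltrDl.
by exists (clamp01 v) => //=; rewrite in_itv/=; exact: clamp01_itv.
Qed.

(** Index of the last point of the grid of mesh [1 / (n+1)] not above [clamp01 v]. It ranges from 0
    to n + 1, the latter at [clamp01 v = 1]; hence the sums over [k < n.+2]. *)
Definition step_idx (n : nat) (v : R) : nat := Num.truncn (n.+1%:R * clamp01 v).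
Definition step_pt (n k : nat) : R := k%:R / n.+1%:R.

Lemma step_idx_lt n v : (step_idx n v < n.+2)%N.
Proof.
have /andP[c0 c1] := clamp01_itv v.
rewrite /step_idx ltnS -(ler_nat R) (le_trans (_ : _ <= n.+1%:R * clamp01 v))//.
  by rewrite truncn_le mulr_ge0.
by rewrite ler_piMr.
Qed.

Lemma step_pt_dist n v : `|step_pt n (step_idx n v) - clamp01 v| <= n.+1%:R^-1.
Proof.
have /andP[c0 c1] := clamp01_itv v.
have n0 : (0 : R) < n.+1%:R by [].
have /truncn_itv/andP[h1 h2] : 0 <= n.+1%:R * clamp01 v by rewrite mulr_ge0.
rewrite distrC ger0_norm; last first.
  by rewrite subr_ge0 /step_pt ler_pdivrMr// mulrC.
rewrite /step_pt lerBlDr (_ : _ + _ = (1 + (step_idx n v)%:R) / n.+1%:R).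
  by rewrite ler_pdivlMr// mulrC (le_trans (ltW h2))// -natr1 addrC.
by rewrite mulrDl mul1r.
Qed.

Lemma step_idx_sum n v (phi : nat -> R) :
  phi (step_idx n v) = \sum_(k < n.+2) (step_idx n v == k)%:R * phi k.
Proof.
rewrite (bigD1 (Ordinal (step_idx_lt n v)))//= eqxx mul1r big1 ?addr0// => k nk.
rewrite (_ : (_ == _) = false) ?mul0r//; apply/negbTE.
by apply: contra nk => /eqP e; apply/eqP/val_inj.
Qed.

Lemma measurable_step_idx n k : measurable_fun setT (fun v => (step_idx n v == k)%:R : R).
Proof.
(* Index k means [k <= (n+1) clamp01 v] but not [k + 1 <= (n+1) clamp01 v]; the signs are reversed
   to fit [measurable_leP]. *)
have E v : (step_idx n v == k)%:R =
    (- (n.+1%:R * clamp01 v) <= - k%:R)%R%:R - (- (n.+1%:R * clamp01 v) <= - k.+1%:R)%R%:R :> R.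
  have /andP[c0 c1] := clamp01_itv v.
  have x0 : 0 <= n.+1%:R * clamp01 v by rewrite mulr_ge0.
  rewrite !lerN2 /step_idx -!truncn_ge_nat//.
  by rewrite eqn_leq; case: ltngtP; rewrite ?subr0 ?subrr.
under eq_fun do rewrite E.
have mc : measurable_fun setT (fun v : R => - (n.+1%:R * clamp01 v)).
  apply: measurableT_comp => //; apply: measurable_funM => //.
  by apply: continuous_measurable_fun; exact: continuous_clamp01.
by apply: measurable_funB; exact: measurable_leP.
Qed.

End clamp.

(** * Averages of a process over time *)

Section barycenter.
Context {d : measure_display} {T : measurableType d} {R : realType}.
Variables (M : {finite_measure set T -> \bar R}) (Y : R -> T -> R) (B : R).
Hypothesis cY : forall w, continuous (Y ^~ w).
Hypothesis clY : forall v w, Y (clamp01 v) w = Y v w.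
Hypothesis lY : forall v, sq_int M (Y v).
Hypothesis bY : forall v, ip M (Y v) (Y v) <= B.
Implicit Types (mu nu : probability R R) (h : T -> R).

Let mY v : measurable_fun setT (Y v). Proof. by case: (lY v). Qed.

Lemma path_bounded w : exists C : R, forall v, `|Y v w| <= C.
Proof. by apply: (clamp_bounded (@cY w)) => v; rewrite clY. Qed.

Lemma step_cvg (phi : R -> R) v : continuous phi -> (forall v, phi (clamp01 v) = phi v) ->
  phi (step_pt n (step_idx n v)) @[n --> \oo] --> phi v.
Proof.
move=> cphi clphi; rewrite -(clphi v).
have c : (step_pt n (step_idx n v) : R) @[n --> \oo] --> clamp01 v.
  by apply: cvgn_dist_le (@cvg_harmonic R) => n; exact: step_pt_dist.
by apply: (cvg_comp _ _ c); exact: cphi.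
Qed.

Lemma measurable_path w : measurable_fun setT (Y ^~ w).
Proof. by apply: continuous_measurable_fun; exact: cY. Qed.

(** Continuity in time and measurability in w give joint measurability: freezing time on a grid
    yields finite sums of products, which converge pointwise. *)
Lemma measurable_joint : measurable_fun setT (fun z : R * T => Y z.1 z.2).
Proof.
apply: (@measurable_fun_cvg _ _ _ _
  (fun n (z : R * T) => \sum_(k < n.+2) (step_idx n z.1 == k)%:R * Y (step_pt n k) z.2)).
- move=> n; apply: measurable_sum => k; apply: measurable_funM.
    exact: (measurableT_comp (measurable_step_idx n k) measurable_fst).
  exact: (measurableT_comp (mY _) measurable_snd).
- move=> [v w] _ /=.
  under eq_fun do rewrite -(step_idx_sum _ _ (fun k => Y (step_pt _ k) w)).
  exact: (@step_cvg (Y ^~ w)).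
Qed.

(** The pathwise average. It serves twice: for the process under [P], and for cosines and sines
    under the spectral measure. *)
Definition bary mu (w : T) : R := \int[mu]_v Y v w.

Let sq_path mu w : sq_int mu (Y ^~ w).
Proof.
have [C HC] := path_bounded w.
by apply: sq_int_bounded HC; exact: measurable_path.
Qed.

Let measurable_prod h : measurable_fun setT h ->
  measurable_fun setT (fun z : R * T => h z.2 * Y z.1 z.2).
Proof.
move=> mh; apply: measurable_funM; last exact: measurable_joint.
exact: (measurableT_comp mh measurable_snd).
Qed.

(** [|h Y| <= h^2 + Y^2] together with the uniform second moment bound B makes Fubini's theorem
    available for every square integrable h. *)
Let fub_bound mu h : sq_int M h ->
  (\int[mu]_v \int[M]_w `|(h w * Y v w)%:E| < +oo)%E.
Proof.
move=> lh; have [mh hi] := lh.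
have mf := measurable_prod mh.
apply: (@le_lt_trans _ _ (\int[mu]_v (ip M h h + B)%:E)%E).
  apply: ge0_le_integral => //.
  - by move=> v _; exact: integral_ge0.
  - apply: (measurable_fun_fubini_tonelli_F (fun z : R * T => `|(h z.2 * Y z.1 z.2)%:E|%E)) => //.
    by apply: measurableT_comp => //; exact/measurable_EFinP.
  - move=> v _.
    have hi2 := sq_int_mul lh (lY v).
    have -> : (\int[M]_w `|(h w * Y v w)%:E| = (\int[M]_w `|h w * Y v w|)%:E)%E.
      by rewrite Rintegral_EFin//; exact: integrable_norm.
    rewrite lee_fin.
    apply: (@le_trans _ _ (\int[M]_w (h w * h w + Y v w * Y v w))).
      apply: le_Rintegral => //; first exact: integrable_norm.
        by apply: integrable_add; apply: sq_int_mul.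
      by move=> w _; rewrite ler_norml; apply/andP; split; nra.
    rewrite RintegralD//; try exact: sq_int_mul.
    by rewrite lerD2l; exact: bY.
by rewrite integral_cst// [X in (_ * X)%E](@probability_setT _ _ _ mu) mule1 ltry.
Qed.

Let fub_integrable mu h : sq_int M h ->
  (mu \x M)%E.-integrable setT (EFin \o (fun z : R * T => h z.2 * Y z.1 z.2)).
Proof.
move=> lh; apply/integrable12ltyP; last exact: (@fub_bound mu h lh).
by have [mh _] := lh; apply/measurable_EFinP; exact: measurable_prod.
Qed.

Let fub_integrable_swap mu h : sq_int M h ->
  (M \x mu)%E.-integrable setT (EFin \o (fun z : T * R => h z.1 * Y z.2 z.1)).
Proof.
move=> lh; apply/integrable21ltyP; last exact: (@fub_bound mu h lh).
have [/measurable_prod mh _] := lh; apply/measurable_EFinP.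
exact: (measurableT_comp mh (measurable_fun_pair measurable_snd measurable_fst)).
Qed.

Lemma ip_path_integrable mu h : sq_int M h ->
  mu.-integrable setT (EFin \o (fun v => ip M h (Y v))).
Proof.
move=> lh; have := integrable_fubini_F (fub_integrable mu lh).
apply: eq_integrable => // v _ /=; rewrite /ip Rintegral_EFin//; exact: sq_int_mul.
Qed.

Let mul_bary_integrable mu h : sq_int M h ->
  M.-integrable setT (EFin \o (fun w => h w * bary mu w)).
Proof.
move=> lh; have := integrable_fubini_F (fub_integrable_swap mu lh).
apply: eq_integrable => // w _ /=; rewrite /fubini_F /= /bary.
have iY : mu.-integrable setT (EFin \o (Y ^~ w)).
  by apply: sq_int_integrable; exact: sq_path.
rewrite -RintegralZl// Rintegral_EFin//; exact: integrable_scale.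
Qed.

Lemma measurable_bary mu : measurable_fun setT (bary mu).
Proof.
have := measurable_int _ (mul_bary_integrable mu (sq_int_cst M 1)).
by move/measurable_EFinP; under [X in measurable_fun _ X -> _]eq_fun do rewrite mul1r.
Qed.

Lemma bary_sqr_le mu w : bary mu w ^+ 2 <= \int[mu]_v (Y v w ^+ 2).
Proof.
have := ip_cauchy_schwarz (sq_path mu w) (sq_int_cst mu 1).
rewrite /ip; under eq_Rintegral do rewrite mulr1.
by rewrite mulr1 Rintegral_prob_cst mulr1.
Qed.

(** Jensen's inequality in time ([bary_sqr_le]), then Tonelli: the second moment is at most the
    mu-average of those of the [Y v], hence at most B. *)
Lemma sq_int_bary mu : sq_int M (bary mu).
Proof.
split; first exact: measurable_bary.
have m2 : measurable_fun setT (fun w => bary mu w ^+ 2).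
  by apply: measurable_funX; exact: measurable_bary.
apply/integrableP; split; first exact/measurable_EFinP.
have mJ2 : measurable_fun setT (fun z : R * T => (Y z.1 z.2 ^+ 2)%:E).
  by apply/measurable_EFinP/measurable_funX; exact: measurable_joint.
apply: (@le_lt_trans _ _ (\int[M]_w \int[mu]_v (Y v w ^+ 2)%:E)%E).
  apply: ge0_le_integral => //.
  - by apply: measurableT_comp => //; exact/measurable_EFinP.
  - apply: (measurable_fun_fubini_tonelli_G (fun z : R * T => (Y z.1 z.2 ^+ 2)%:E)) => //.
    by move=> z; rewrite lee_fin sqr_ge0.
  - move=> w _ /=; rewrite ger0_norm ?sqr_ge0//.
    have [_ i2] := sq_path mu w.
    by rewrite -Rintegral_EFin// lee_fin; exact: bary_sqr_le.
rewrite -(fubini_tonelli (m1 := mu) (m2 := M) (fun z : R * T => (Y z.1 z.2 ^+ 2)%:E))//; last first.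
  by move=> z; rewrite lee_fin sqr_ge0.
apply: (@le_lt_trans _ _ (\int[mu]_v B%:E)%E).
  apply: ge0_le_integral => //.
  - by move=> v _; apply: integral_ge0 => w _; rewrite lee_fin sqr_ge0.
  - apply: (measurable_fun_fubini_tonelli_F (fun z : R * T => (Y z.1 z.2 ^+ 2)%:E)) => //.
    by move=> z; rewrite lee_fin sqr_ge0.
  - move=> v _ /=; rewrite expectation_sqr; last exact: lY.
    by rewrite lee_fin; exact: bY.
by rewrite integral_cst// [X in (_ * X)%E](@probability_setT _ _ _ mu) mule1 ltry.
Qed.

Lemma ip_bary mu h : sq_int M h -> ip M h (bary mu) = \int[mu]_v ip M h (Y v).
Proof.
move=> lh; apply/EFin_inj.
rewrite (Rintegral_EFin (ip_path_integrable mu lh)) /ip.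
rewrite Rintegral_EFin; last exact: mul_bary_integrable.
have -> : (\int[M]_w (h w * bary mu w)%:E = \int[M]_w \int[mu]_v (h w * Y v w)%:E)%E.
  apply: eq_integral => w _; rewrite /bary.
  have iY : mu.-integrable setT (EFin \o (Y ^~ w)).
    by apply: sq_int_integrable; exact: sq_path.
  by rewrite -RintegralZl// Rintegral_EFin//; exact: integrable_scale.
rewrite -(Fubini (fub_integrable mu lh))/=.
by apply: eq_integral => v _; rewrite Rintegral_EFin//; exact: sq_int_mul.
Qed.

End barycenter.

(** * Weak compactness on the unit interval *)

Section prob_real.
Context {R : realType}.
Implicit Types (mu nu : probability R R) (f : R -> R).

Lemma eq_prob_cdf mu nu : (forall s : R, mu `]-oo, s]%classic = nu `]-oo, s]%classic) ->
  forall A, measurable A -> mu A = nu A.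
Proof.
move=> h.
apply: (@measure_unique _ R R (@RGenOInfty.G R) (fun n => `](- n%:R), +oo[%classic)).
- exact: (RGenOInfty.measurableE R).
- move=> _ _ [s ->] [t ->]; exists (Num.max s t).
  apply/seteqP; split => x /=; rewrite !in_itv/= !andbT gt_max.
    by move=> [-> ->].
  by move=> /andP[].
- by move=> n; exists (- n%:R).
- apply/seteqP; split => // x _; exists (Num.truncn (- x)).+1 => //=.
  by rewrite in_itv/= andbT ltrNl; exact: truncnS_gt.
- move=> _ [s ->]; rewrite -setCitvl.
  rewrite -[LHS]/(mu (~` `]-oo, s]%classic)) -[RHS]/(nu (~` `]-oo, s]%classic)).
  by rewrite (probability_setC mu)// (probability_setC nu)// h.
- by move=> n; rewrite (le_lt_trans (probability_le1 mu _))// ltry.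
Qed.

Lemma measure_prob (m : measure R R) : m setT = 1%E ->
  exists rho : probability R R, forall A, rho A = m A.
Proof.
move=> m1.
exists (mnormalize m (\d_(0 : R) : probability R R) : probability R R) => A.
by rewrite /= /mnormalize m1 orbF eqe oner_eq0/= invr1 mule1.
Qed.

Lemma mixture_exists mu nu (l : R) : 0 <= l <= 1 -> exists rho : probability R R,
  forall A, measurable A -> rho A = (l%:E * mu A + (1 - l)%:E * nu A)%E.
Proof.
move=> /andP[l0 l1].
have l1' : 0 <= 1 - l by rewrite subr_ge0.
pose m : measure R R := measure_add (mscale (NngNum l0) mu) (mscale (NngNum l1') nu).
have m1 : m setT = 1%E.
  transitivity (l%:E * mu setT + (1 - l)%:E * nu setT)%E; first exact: measure_addE.
  by rewrite [mu _]probability_setT [nu _]probability_setT !mule1 -EFinD addrC subrK.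
have [rho rhoE] := measure_prob m1.
by exists rho => A mA; rewrite rhoE [LHS]measure_addE.
Qed.

(** Additivity of the integral in the measure is immediate for nonnegative integrands, so f is
    shifted by its bound B; the shift cancels because the weights sum to 1. *)
Lemma mixture_Rintegral mu nu (rho : probability R R) (l : R) f (B : R) : 0 <= l <= 1 ->
  (forall A, measurable A -> rho A = (l%:E * mu A + (1 - l)%:E * nu A)%E) ->
  measurable_fun setT f -> (forall v, `|f v| <= B) ->
  \int[rho]_v f v = l * \int[mu]_v f v + (1 - l) * \int[nu]_v f v.
Proof.
move=> /andP[l0 l1] rhoE mf fB.
have l1' : 0 <= 1 - l by rewrite subr_ge0.
have i (P : probability R R) : P.-integrable setT (EFin \o f) by exact: bounded_int fB.
have fB0 v : 0 <= f v + B.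
  by have := fB v; rewrite ler_norml -lerBlDr sub0r => /andP[].
have shift (P : probability R R) : \int[P]_v f v = \int[P]_v (f v + B) - B.
  rewrite RintegralD//; [|exact: i|exact: (integrable_cst P B)].
  by rewrite Rintegral_prob_cst addrK.
have iB (P : probability R R) : P.-integrable setT (EFin \o (fun v => f v + B)).
  apply: (@integrable_add _ _ _ P f (cst B)); first exact: i.
  exact: (integrable_cst P B).
have mfB : measurable_fun setT (fun v => (f v + B)%:E).
  by apply/measurable_EFinP; exact: measurable_funD.
suff : \int[rho]_v (f v + B) = l * \int[mu]_v (f v + B) + (1 - l) * \int[nu]_v (f v + B).
  by rewrite !shift => ->; ring.
apply: EFin_inj; rewrite EFinD !EFinM !(Rintegral_EFin (iB _)).
rewrite (eq_measure_integral
  (measure_add (mscale (NngNum l0) mu) (mscale (NngNum l1') nu))); last first.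
  by move=> A mA _; rewrite [RHS]measure_addE; exact: rhoE.
have pos v : [set: R] v -> (0 <= (f v + B)%:E)%E by rewrite lee_fin.
rewrite ge0_integral_measure_add//.
by congr (_ + _)%E; exact: ge0_integral_mscale.
Qed.

Let unif : probability (measurableTypeR R) R := uniform_prob ltr01.

Definition uniform01 : probability R R := real_law unif.

Lemma uniform01_null A : measurable A -> lebesgue_measure A = 0%E -> uniform01 A = 0%E.
Proof.
move=> mA A0; have /null_content_dominatesP := @dominates_uniform_prob R 0 1 ltr01.
exact.
Qed.

Lemma uniform01_itv (c : R) : 0 <= c <= 1 -> uniform01 `]0, c]%classic = c%:E.
Proof.
move=> /andP[c0 c1].
rewrite -[LHS]/(\int[lebesgue_measure]_(x in `]0%R, c]%classic) (uniform_pdf 0 1 x)%:E)%E.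
rewrite (eq_integral (cst 1%E)); last first.
  move=> x; rewrite inE/= in_itv/= => /andP[x0 xc].
  by rewrite /uniform_pdf (ltW x0) (le_trans xc c1)/= subr0 invr1.
rewrite [LHS]integral_cst// mul1e.
rewrite -[LHS]/(lebesgue_measure `]0, c]%classic) lebesgue_measure_itv/= lte_fin.
move: c0; rewrite le_eqVlt => /predU1P[<-|->]; first by rewrite ltxx.
by rewrite oppr0 adde0.
Qed.

Lemma uniform01_setC : uniform01 (~` `]0, 1]%classic) = 0%E.
Proof.
rewrite probability_setC// uniform01_itv ?lexx ?ler01//.
by rewrite subee.
Qed.

End prob_real.

Section rational_points.
Context {R : realType}.

(** An enumeration of the rationals by their codes; a number that codes no rational gives 0. *)
Definition rat_point (n : nat) : R := ratr (odflt 0 (unpickle n : option rat)).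

Lemma rat_pointE (q : rat) : ratr q = rat_point (pickle q).
Proof. by rewrite /rat_point pickleK. Qed.

Lemma dense_rat_le (g : R -> R) (K : R) : continuous g ->
  (forall n, g (rat_point n) <= K) -> forall v, g v <= K.
Proof.
move=> cg gK v; rewrite leNgt; apply/negP => Kg.
have : \forall u \near v, K < g u by apply: cvgr_gt (cg v) _ Kg.
move=> /nbhs_ballP[e /= e0 he].
have ve : v < v + e by rewrite ltrDl.
have [q] := rat_in_itvoo ve.
rewrite in_itv/= rat_pointE => /andP[vq qe].
have := gK (pickle q); rewrite leNgt => /negP; apply.
by apply: he; rewrite /ball/= distrC ger0_norm ?ltrBlDl// subr_ge0 ltW.
Qed.

End rational_points.

(** * Helly selection for monotone functions *)

Section monotone_selection.
Context {R : realType}.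
Variable q : nat -> R -> R.
Hypothesis q_mono : forall n, {homo q n : x y / x <= y}.
Hypothesis q_itv : forall n x, 0 <= q n x <= 1.

Lemma ultra_nat : exists U : set_system nat, UltraFilter U /\ (\oo `<=` U).
Proof. exact: ultraFilterLemma. Qed.

(* The limit is taken along an ultrafilter; a subsequence realizing it on the
   countably many rational points is extracted afterwards. *)
Lemma monotone_selection : exists (phi : nat -> nat) (l : R -> R),
  [/\ forall n, (phi n < phi n.+1)%N, {homo l : x y / x <= y}, forall x, 0 <= l x <= 1 &
      exists2 D : set R, countable D &
        forall x, 0 < x < 1 -> ~ D x -> q (phi n) x @[n --> \oo] --> l x].
Proof.
have [U [UU ooU]] := ultra_nat.
pose S x := [set c : R | U [set n | c <= q n x]].
pose l x := sup (S x).
have S0 x : S x 0.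
  by apply: filterS (@filterT _ U _) => n _ /=; case/andP: (q_itv n x).
have S1 x : ubound (S x) 1.
  move=> c; rewrite /S/= => /filter_ex[n]/= cq.
  by apply: le_trans cq _; case/andP: (q_itv n x).
have hS x : has_sup (S x) by split; [exists 0; exact: S0|exists 1; exact: S1].
have l_mono : {homo l : x y / x <= y}.
  move=> x y xy; apply: ge_sup; first by exists 0; exact: S0.
  move=> c Sc; apply: ub_le_sup; first by exists 1; exact: S1.
  by apply: filterS Sc => n /= h; exact: le_trans h (q_mono n xy).
have l_itv x : 0 <= l x <= 1.
  apply/andP; split; first by apply: ub_le_sup; [exists 1; exact: S1|exact: S0].
  by apply: ge_sup; [exists 0; exact: S0|exact: S1].
(* The lower estimate comes from the supremum. The upper one is the ultrafilter property: if
   [l x + e <= q n x] held on a set of [U], then [l x + e] would belong to [S x]. *)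
have Ul x (e : R) : 0 < e -> U [set n | `|q n x - l x| < e].
  move=> e0.
  have [c Sc lc] := sup_adherent e0 (hS x).
  have h2 : U [set n | q n x < l x + e].
    have [h|h] := in_ultra_setVsetC [set n | l x + e <= q n x] UU.
      have : l x + e <= l x by apply: ub_le_sup => //; exists 1; exact: S1.
      by rewrite gerDl leNgt e0.
    by apply: filterS h => n /= /negP; rewrite -ltNge.
  apply: filterS (filterI Sc h2) => n [/= h1 h3].
  rewrite ltr_norml; apply/andP; split; last by rewrite ltrBlDl.
  by rewrite ltrBrDl -/(_ - _); exact: lt_le_trans lc h1.
pose r (j : nat) : R := rat_point j.
(* Beyond any N some index is good for the first k rational points at once, because finitely many
   sets of [U] and a tail of the integers have a common element. *)
have pick k N : exists n, (N < n)%N /\ forall j : 'I_k, `|q n (r j) - l (r j)| < k.+1%:R^-1.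
  have h1 : \forall n \near U, forall j : 'I_k, `|q n (r j) - l (r j)| < k.+1%:R^-1.
    by apply: filter_forall => j; apply: Ul; rewrite invr_gt0.
  have h2 : U [set n | (N < n)%N] by apply: ooU; exists N.+1.
  by have [n [? ?]] := filter_ex (@filterI _ U _ _ _ h2 h1); exists n.
have {}pick k : exists g, forall N, (N < g N)%N /\
    forall j : 'I_k, `|q (g N) (r j) - l (r j)| < k.+1%:R^-1.
  by have [g hg] := choice (pick k); exists g.
have [g hg] := choice pick.
pose phi := fix phi k := if k is k'.+1 then g k (phi k') else g 0%N 0%N.
have phi_r j : q (phi n) (r j) @[n --> \oo] --> l (r j).
  apply/cvgrPdist_lt => e e0; near=> n.
  have nj : (j < n)%N by near: n; exists j.+1.
  have -> : phi n = g n (if n is n'.+1 then phi n' else 0%N) by case: (n).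
  have [_ /(_ (Ordinal nj)) h] := hg n (if n is n'.+1 then phi n' else 0%N).
  rewrite distrC; apply: lt_trans h _.
  by near: n; exact: near_infty_natSinv_lt (PosNum e0).
have rat_r (z : rat) : exists j, ratr z = r j.
  by exists (pickle z); exact: rat_pointE.
exists phi, l; split => //.
  by move=> n; case: (hg n.+1 (phi n)).
(* A monotone function has only countably many discontinuities; at the other points of (0, 1) the
   squeeze below works. *)
exists [set x | x \in (`]0, 1[%R : interval R) /\ discontinuity l x].
  by apply: discontinuity_countable => x y _ _; exact: l_mono.
move=> x x01 nD.
have cl : cvg (l y @[y --> x^'-]).
  apply: nondecreasing_at_left_is_cvgr.
    by apply: nearW => y u v _ _; exact: l_mono.
  by apply: nearW => y; exists 1 => _ [z _ <-]; case/andP: (l_itv z).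
have cr : cvg (l y @[y --> x^'+]).
  apply: nondecreasing_at_right_is_cvgr.
    by apply: nearW => y u v _ _; exact: l_mono.
  by apply: nearW => y; exists 0 => _ [z _ <-]; case/andP: (l_itv z).
have lr : lim (l y @[y --> x^'-]) = lim (l y @[y --> x^'+]).
  apply/eqP/negPn/negP => ne; apply: nD; split; last by split.
  by rewrite in_itv.
set L := lim (l y @[y --> x^'-]) in lr *; rewrite -lr in cr.
(* Rational points on either side of x at which l is close to the common one-sided limit [L].
   Monotonicity traps [q (phi n) x] between its values there, and these converge. *)
have approx (e : R) : 0 < e -> exists i j, [/\ r i < x, x < r j, L - e < l (r i) & l (r j) < L + e].
  move=> e0.
  have hl : \forall y \near x^'-, L - e < l y.
    by apply: cvgr_gt; [exact: cl|rewrite gtrBl].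
  have hr : \forall y \near x^'+, l y < L + e.
    by apply: cvgr_lt; [exact: cr|rewrite ltrDl].
  have [z1 h1 z1x] : exists2 z : R, L - e < l z & z < x.
    by near x^'- => z; exists z; near: z => //; exact: nbhs_left_lt.
  have [z2 h2 xz2] : exists2 z : R, l z < L + e & x < z.
    by near x^'+ => z; exists z; near: z => //; exact: nbhs_right_gt.
  have [i' hi] := rat_in_itvoo z1x; have [j' hj] := rat_in_itvoo xz2.
  have [i ri] := rat_r i'; have [j rj] := rat_r j'.
  move: hi hj; rewrite ri rj !in_itv/= => /andP[zi ix] /andP[xj jz].
  exists i, j; split => //.
    by apply: lt_le_trans h1 _; apply: l_mono; exact: ltW.
  by apply: le_lt_trans h2; apply: l_mono; exact: ltW.
apply/cvgrPdist_lt => e e0.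
have e2 : 0 < e / 3 by rewrite divr_gt0.
have [i [j [ix xj hi hj]]] := approx _ e2.
near=> n.
have h1 : `|l (r i) - q (phi n) (r i)| < e / 3.
  by near: n; have /cvgrPdist_lt := phi_r i; exact.
have h2 : `|l (r j) - q (phi n) (r j)| < e / 3.
  by near: n; have /cvgrPdist_lt := phi_r j; exact.
have q1 : q (phi n) (r i) <= q (phi n) x by apply: q_mono; exact: ltW.
have q2 : q (phi n) x <= q (phi n) (r j) by apply: q_mono; exact: ltW.
have l1 : l (r i) <= l x by apply: l_mono; exact: ltW.
have l2 : l x <= l (r j) by apply: l_mono; exact: ltW.
move: h1 h2 q1 q2 l1 l2 hi hj; rewrite !ltr_norml; clear; lra.
Unshelve. all: end_near.
Qed.

End monotone_selection.

(** * Quantile functions and weak sequential compactness *)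

Section quantiles.
Context {R : realType}.
Implicit Types mu : probability R R.

Let idR : {mfun R >-> R} := mfun_Sub (mem_set (@measurable_id _ R setT)).

(** Right continuity of the distribution function: the infimum that defines a quantile satisfies its
    own inequality. *)
Lemma cdf_closed mu (s x : R) :
  (forall y : R, x < y -> (s%:E <= mu `]-oo, y]%classic)%E) ->
  (s%:E <= mu `]-oo, x]%classic)%E.
Proof.
move=> h; have c := @cdf_right_continuous _ _ _ mu idR x.
have -> : mu `]-oo, x]%classic = lim (cdf (P := mu) idR y @[y --> x^'+]).
  by apply/esym/cvg_lim.
apply: lime_ge; first by apply/cvg_ex; eexists; exact: c.
by near=> y; apply: h; near: y; exact: nbhs_right_gt.
Unshelve. all: end_near. Qed.

Lemma prob01_le0 mu (x : R) : prob01 mu -> x < 0 -> mu `]-oo, x]%classic = 0%E.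
Proof.
move=> mu01 x0; apply: (@subset_measure0 _ _ _ mu _ (~` `[0, 1]%classic)) => //.
  exact: measurableC.
move=> y /=; rewrite !in_itv/= => yx /andP[y0 _].
by move: (le_lt_trans yx x0); rewrite ltNge y0.
Qed.

Lemma prob01_ge1 mu (x : R) : prob01 mu -> 1 <= x -> mu `]-oo, x]%classic = 1%E.
Proof.
move=> mu01 x1; apply/eqP; rewrite eq_le; apply/andP; split.
  exact: (probability_le1 mu).
have -> : 1%E = mu `[0, 1]%classic.
  by have := probability_setC mu (measurable_itv `[0, 1]); rewrite mu01 => /eqP; rewrite eq_sym sube_eq// add0e => /eqP.
apply: le_measure; rewrite ?inE//.
by move=> y /=; rewrite !in_itv/= => /andP[_ /le_trans]; exact.
Qed.

(** The generalized inverse of the distribution function, with the uniform law as a common source.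
    Weak convergence can then be obtained from almost everywhere convergence of monotone
    functions. *)
Lemma quantile_exists mu : prob01 mu -> exists q : R -> R,
  [/\ {homo q : x y / x <= y}, forall s, 0 <= q s <= 1 &
      forall A, measurable A -> uniform01 (q @^-1` A) = mu A].
Proof.
move=> mu01.
(* The alternative [x = 1] keeps the set nonempty for every real s, so that q is defined and
   monotone on the whole line with values in [0, 1]. *)
pose S s := [set x : R | 0 <= x <= 1 /\ ((s%:E <= mu `]-oo, x]%classic)%E \/ x = 1)].
pose q s := inf (S s).
have S1 s : S s 1 by split; [rewrite ler01 lexx|right].
have Sl s : lbound (S s) 0 by move=> x [/andP[]].
have qle s x : S s x -> q s <= x by move=> Sx; apply: ge_inf => //; exists 0; exact: Sl.
have leq_q s c : lbound (S s) c -> c <= q s.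
  by move=> h; apply: lb_le_inf => //; exists 1.
have q_mono : {homo q : x y / x <= y}.
  move=> s t st; apply: leq_q => x [x01 h]; apply: qle; split=> //.
  by case: h => [h|]; [left; apply: le_trans h; rewrite lee_fin|right].
have q_itv s : 0 <= q s <= 1 by rewrite leq_q//= qle.
have mq : measurable_fun setT q by exact: nondecreasing_measurable.
exists q; split => //.
pose Q : {mfun R >-> R} := mfun_Sub (mem_set mq).
pose nu : probability R R := distribution uniform01 Q.
apply: (@eq_prob_cdf _ nu mu) => x.
have Fx1 := probability_le1 mu (measurable_itv `]-oo, x]).
have Fx0 : (0 <= mu `]-oo, x]%classic)%E by exact: measure_ge0.
have Ffin : mu `]-oo, x]%classic \is a fin_num.
  by rewrite ge0_fin_numE// (le_lt_trans Fx1)// ltry.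
set F := mu `]-oo, x]%classic in Fx1 Fx0 Ffin *.
(* The equivalence breaks down at s <= 0 when x < 0, and at s > 1 when x >= 1; the uniform law does
   not charge such s. *)
have galois s : 0 < s <= 1 -> (q s <= x) = (s%:E <= F)%E.
  move=> /andP[s0 s1]; have [x0|x0] := ltP x 0.
    rewrite /F prob01_le0// lee_fin [RHS]leNgt s0/=; apply/negbTE; rewrite -ltNge.
    by apply: lt_le_trans x0 _; case/andP: (q_itv s).
  have [x1|x1] := leP 1 x.
    rewrite /F prob01_ge1// lee_fin s1; apply: le_trans x1.
    by case/andP: (q_itv s).
  apply/idP/idP => [qx|h]; last by apply: qle; split; [rewrite x0 ltW|left].
  apply: cdf_closed => y xy.
  have [z [_ Sz] zy] : exists2 z, S s z & z < y.
    have [|//|z Sz] := @inf_adherent R (S s) (y - q s).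
    - by rewrite subr_gt0 (le_lt_trans qx).
    - by split; [exists 1|exists 0; exact: Sl].
    - by rewrite -/(q s) subrKC => zy; exists z.
  case: Sz => [h|z1].
    apply: le_trans h _; apply: le_measure; rewrite ?inE// => t /=.
    by rewrite !in_itv/= => /le_trans; apply; exact: ltW.
  by rewrite prob01_ge1 ?lee_fin// -z1 ltW.
rewrite -[LHS]/(uniform01 (q @^-1` `]-oo, x]%classic)).
have mqx : measurable (q @^-1` `]-oo, x]%classic).
  by rewrite -[X in measurable X]setTI; apply: (mq).
have -> : uniform01 (q @^-1` `]-oo, x]%classic) = uniform01 (q @^-1` `]-oo, x]%classic `&` `]0, 1]%classic).
  rewrite -[in LHS](setIT (q @^-1` _)) -(setUv `]0, 1]%classic) setIUr measureU//; last 3 first.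
  - exact: measurableI.
  - by apply: measurableI => //; exact: measurableC.
  - by rewrite setIACA setICr setI0.
  rewrite [X in (_ + X)%E](subset_measure0 _ _ _ uniform01_setC) ?adde0//.
  - by apply: measurableI => //; exact: measurableC.
  - exact: measurableC.
have -> : q @^-1` `]-oo, x]%classic `&` `]0, 1]%classic = `]0, fine F]%classic.
  apply/seteqP; split => s /=; rewrite !in_itv/=.
    by move=> [qx /[dup] s01 /andP[-> s1]]; rewrite -lee_fin fineK// -galois.
  move=> /andP[s0 sF]; have s1 : s <= 1.
    by rewrite -lee_fin; apply: le_trans Fx1; rewrite -(fineK Ffin) lee_fin.
  by rewrite galois s0 s1// -(fineK Ffin) lee_fin sF.
by rewrite uniform01_itv ?fineK// -!lee_fin fineK// Fx0.
Qed.

(** A subsequence of the quantile functions converges off a countable set, which is null for the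
    uniform law; bounded convergence transfers this to the integrals. *)
Lemma prob01_weak_compactness (mus : nat -> probability R R) : (forall n, prob01 (mus n)) ->
  exists (phi : nat -> nat) (mu : probability R R),
    [/\ forall n, (phi n < phi n.+1)%N, prob01 mu &
        forall f : R -> R, continuous f -> (forall v, f (clamp01 v) = f v) ->
          \int[mus (phi n)]_v f v @[n --> \oo] --> \int[mu]_v f v].
Proof.
move=> mus01.
have [q hq] := choice (fun n => quantile_exists (mus01 n)).
have [phi [l [phi_incr l_mono l_itv [D cD cl]]]] :=
  monotone_selection (fun n => let: And3 h _ _ := hq n in h) (fun n => let: And3 _ h _ := hq n in h).
have ml : measurable_fun setT l by exact: nondecreasing_measurable.
pose L : {mfun R >-> R} := mfun_Sub (mem_set ml).
pose mu : probability R R := distribution uniform01 L.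
exists phi, mu; split => //.
  rewrite /prob01 -[LHS]/(uniform01 (l @^-1` _)).
  rewrite (_ : l @^-1` _ = set0) ?measure0// -subset0 => x /=.
  by rewrite in_itv/=; apply; exact: l_itv.
move=> f cf clf.
have [C HC] : exists C : R, forall v, `|f v| <= C by exact: clamp_bounded.
have mf : measurable_fun setT f by exact: continuous_measurable_fun.
have fi (rho : probability R R) : rho.-integrable setT (EFin \o f) by exact: bounded_int HC.
have mq n : measurable_fun setT (q n) by apply: nondecreasing_measurable => //; case: (hq n).
have law n : \int[uniform01]_s f (q n s) = \int[mus n]_v f v.
  by apply: (law_Rintegral (mq n) _ (fi _)); case: (hq n).
have lawl : \int[uniform01]_s f (l s) = \int[mu]_v f v.
  by apply: (law_Rintegral ml _ (fi mu)).
rewrite -lawl (_ : (fun n => _) = fun n => \int[uniform01]_s f (q (phi n) s)); last first.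
  by apply/funext.
apply: (@Rintegral_bdct_ae _ _ _ _ _ _ C) => //.
- by move=> n; exact: measurableT_comp.
- exact: measurableT_comp.
have mN (A : set R) : countable A -> measurable A.
  by move=> cA; apply: countable_measurable => // t; exact: measurable_set1.
have c1 : countable [set (1 : R)] by exact: finite_set_countable.
have N0 (A : set R) : countable A -> uniform01 A = 0%E.
  by move=> cA; rewrite uniform01_null ?countable_lebesgue_measure0//; exact: mN.
(* [monotone_selection] speaks of the open interval, so 1 and the complement of []0, 1]] join the
   exceptional set. *)
exists ((D `|` [set 1]) `|` ~` `]0, 1]%classic); split.
- apply: measurableU; last exact: measurableC.
  by apply: measurableU; exact: mN.
- apply: null_set_setU; [|exact: measurableC| |exact: uniform01_setC].
    by apply: measurableU; exact: mN.
  apply: null_set_setU; by [exact: mN|exact: N0].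
- move=> x /= nc; apply: contrapT => /not_orP[/not_orP[nD n1]].
  move=> /contrapT; rewrite /= in_itv/= => /andP[x0 x1]; apply: nc.
  apply: (continuous_cvg _ (cf _)); apply: cl => //.
  by rewrite x0 lt_neqAle x1 andbT; exact/eqP.
Qed.

End quantiles.
(** * The closed span of a Gaussian process *)

Section gaussian_space.
Context {d : measure_display} {T : measurableType d} {R : realType}.
Variables (P : probability T R) (I : set R) (X : R -> T -> R).
Hypothesis gX : centered_gaussian_process P I X.
Implicit Types H : T -> R.

Lemma lin_comb1 t : X t = lin_comb X (fun _ : 'I_1 => t) (fun _ => 1).
Proof. by apply/funext => w; rewrite /lin_comb big_ord1 mul1r. Qed.

Lemma lin_comb_gaussian n (t c : 'I_n -> R) : (forall j, I (t j)) ->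
  gaussian_cf P (lin_comb X t c).
Proof. by move=> It; case: (centered_gaussian_cf (@gX n t c It)). Qed.

Lemma process_sq_int t : I t -> sq_int P (X t).
Proof. by move=> It; rewrite lin_comb1; case: (@lin_comb_gaussian 1 (fun=> t) (fun=> 1)). Qed.

Lemma process_mean t : I t -> \int[P]_w X t w = 0.
Proof.
by move=> It; rewrite lin_comb1; case: (centered_gaussian_cf (@gX 1 (fun=> t) (fun=> 1) _)).
Qed.

Lemma covXE s t : I s -> I t -> covX P X s t = ip P (X s) (X t).
Proof.
move=> Is It; rewrite /covX unlock.
have E0 r : I r -> fine ('E_P[X r])%E = 0.
  by move=> Ir; rewrite expectationE -/(Rintegral P setT (X r)); exact: process_mean.
rewrite (E0 s Is) (E0 t It) expectationE; congr fine.
by apply: eq_integral => w _; rewrite /= -[(_ * _) w]/(_ * _)/= !subr0.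
Qed.

Lemma in_LP H : in_L P I X H <-> sq_int P H /\
  forall e : R, 0 < e -> exists n (t c : 'I_n -> R), (forall j, I (t j)) /\
    ip P (fun w => H w - lin_comb X t c w) (fun w => H w - lin_comb X t c w) < e.
Proof.
have key n (t c : 'I_n -> R) : sq_int P H -> (forall j, I (t j)) ->
    ('E_P[fun w => ((H w - lin_comb X t c w) ^+ 2)%R])%E =
    (ip P (fun w => H w - lin_comb X t c w) (fun w => H w - lin_comb X t c w))%:E.
  move=> lH It; rewrite expectationE expectation_sqr//.
  by apply: sq_intB => //; case: (lin_comb_gaussian c It).
split=> [[mH [H2 HL]]|[lH HL]].
  have lH : sq_int P H.
    split => //; apply/integrableP; split.
      by apply/measurable_EFinP; exact: measurable_funX.
    move: H2; rewrite expectationE.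
    by under [X in _ -> (X < _)%E]eq_integral do rewrite /= ger0_norm ?sqr_ge0//.
  split => // e e0; have [n [t [c [It h]]]] := HL e e0.
  by exists n, t, c; split => //; rewrite -lte_fin -key.
split; first by case: lH.
split; first by rewrite expectationE expectation_sqr// ltry.
move=> e e0; have [n [t [c [It h]]]] := HL e e0.
by exists n, t, c; split => //; rewrite key// lte_fin.
Qed.

Lemma in_L_sq_int H : in_L P I X H -> sq_int P H.
Proof. by case/in_LP. Qed.

Lemma in_L_process t : I t -> in_L P I X (X t).
Proof.
move=> It; apply/in_LP; split; first exact: process_sq_int.
move=> e e0; exists 1%N, (fun=> t), (fun=> 1); split => //.
rewrite -lin_comb1 /ip; under eq_Rintegral do rewrite subrr mul0r.
by rewrite Rintegral_prob_cst.
Qed.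

Lemma in_LZ k H : in_L P I X H -> in_L P I X (fun w => k * H w).
Proof.
move=> /in_LP[lH HL]; apply/in_LP; split; first exact: sq_intZ.
move=> e e0; have e1 : 0 < e / (k ^+ 2 + 1) by rewrite divr_gt0// ltr_wpDl// sqr_ge0.
have [n [t [c [It h]]]] := HL _ e1.
exists n, t, (fun j => k * c j); split => //.
have lc : sq_int P (lin_comb X t c) by case: (lin_comb_gaussian c It).
have -> : (fun w => k * H w - lin_comb X t (fun j => k * c j) w) =
    (fun w => k * (H w - lin_comb X t c w)).
  apply/funext => w; rewrite mulrBr /lin_comb mulr_sumr; congr (_ - _).
  by apply: eq_bigr => j _; rewrite mulrA.
have lD := sq_intB lH lc.
rewrite ipZl ?ipZr//; last exact: sq_intZ.
move: h; rewrite ltr_pdivlMr ?ltr_wpDl ?sqr_ge0//.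
by have := ip_ge0 P (fun w => H w - lin_comb X t c w); set x := ip _ _ _; nra.
Qed.

Lemma in_LD H1 H2 : in_L P I X H1 -> in_L P I X H2 -> in_L P I X (fun w => H1 w + H2 w).
Proof.
move=> /in_LP[lH1 HL1] /in_LP[lH2 HL2]; apply/in_LP; split; first exact: sq_intD.
(* Two quarters suffice because [|f + g|^2 <= 2 |f|^2 + 2 |g|^2]. *)
move=> e e0; have e1 : 0 < e / 4 by rewrite divr_gt0.
have [n [t [c [It h]]]] := HL1 _ e1; have [m [t' [c' [It' h']]]] := HL2 _ e1.
exists (n + m)%N, (fun j => match fintype.split j with inl i => t i | inr i => t' i end),
  (fun j => match fintype.split j with inl i => c i | inr i => c' i end).
split; first by move=> j; case: (fintype.split j).
have lc : sq_int P (lin_comb X t c) by case: (lin_comb_gaussian c It).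
have lc' : sq_int P (lin_comb X t' c') by case: (lin_comb_gaussian c' It').
set L := lin_comb X _ _.
have -> : (fun w => H1 w + H2 w - L w) =
    (fun w => (H1 w - lin_comb X t c w) + (H2 w - lin_comb X t' c' w)).
  apply/funext => w; rewrite /L /lin_comb big_split_ord/= [RHS]addrACA -opprD.
  congr (_ - (_ + _)); apply: eq_bigr => j _.
    by rewrite (_ : fintype.split (lshift m j) = inl j) //; exact: (unsplitK (inl j)).
  by rewrite (_ : fintype.split (rshift n j) = inr j) //; exact: (unsplitK (inr j)).
have lD := sq_intB lH1 lc; have lD' := sq_intB lH2 lc'.
rewrite ip_sqrD//; have := ip_amgm lD lD'.
by lra.
Qed.

Lemma in_L_sum n (c : nat -> R) (F : nat -> T -> R) :
  (forall j, (j < n)%N -> in_L P I X (F j)) -> in_L P I X (fun w => \sum_(j < n) c j * F j w).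
Proof.
elim: n => [_|n IHn h].
  apply/in_LP; split; first exact: sq_int_sum.
  move=> e e0; exists 0%N, (fun=> 0), (fun=> 0); split; first by case.
  rewrite /ip (_ : Rintegral _ _ _ = 0)//.
  under eq_Rintegral do rewrite big_ord0 /lin_comb big_ord0 subrr mul0r.
  by rewrite Rintegral_prob_cst.
under eq_fun do rewrite big_ord_recr/=.
by apply: in_LD; [apply: IHn => j jn; apply: h; exact: ltnW|apply: in_LZ; exact: h].
Qed.

Lemma in_LB H1 H2 : in_L P I X H1 -> in_L P I X H2 -> in_L P I X (fun w => H1 w - H2 w).
Proof.
move=> h1 h2; have := in_LD h1 (in_LZ (-1) h2).
by under [X in in_L _ _ _ X -> _]eq_fun do rewrite mulN1r.
Qed.

Lemma in_L_cvg (F : nat -> T -> R) H : (forall n, in_L P I X (F n)) -> sq_int P H ->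
  ip P (fun w => F n w - H w) (fun w => F n w - H w) @[n --> \oo] --> 0 ->
  in_L P I X H.
Proof.
move=> hF lH h; apply/in_LP; split => // e e0.
have e1 : 0 < e / 4 by rewrite divr_gt0.
move/cvgrPdist_lt : h => /(_ _ e1)[n _ hn].
have /in_LP[lF FL] := hF n; have [m [t [c [It hc]]]] := FL _ e1.
exists m, t, c; split => //.
have lc : sq_int P (lin_comb X t c) by case: (lin_comb_gaussian c It).
have -> : (fun w => H w - lin_comb X t c w) =
    (fun w => (H w - F n w) + (F n w - lin_comb X t c w)).
  by apply/funext => w; ring.
have lD := sq_intB lH lF; have lD' := sq_intB lF lc.
rewrite ip_sqrD//; have := ip_amgm lD lD'.
have /= := hn n (leqnn n); rewrite sub0r normrN ger0_norm ?ip_ge0// ip_sub_sym.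
by lra.
Qed.

(** Elements of the closed span are mean square limits of finite linear combinations, and
    [gaussian_cf] passes to such limits. *)
Lemma in_L_gaussian H : in_L P I X H -> gaussian_cf P H.
Proof.
move=> /in_LP[lH HL].
have /choice[S HS] : forall n : nat, exists S : T -> R, gaussian_cf P S /\
    ip P (fun w => S w - H w) (fun w => S w - H w) <= n.+1%:R^-1.
  move=> n; have n0 : (0 : R) < n.+1%:R^-1 by [].
  have [m [t [c [It hc]]]] := HL _ n0.
  exists (lin_comb X t c); split; first exact: lin_comb_gaussian.
  by rewrite ip_sub_sym ltW.
apply: (@gaussian_cf_cvg _ _ _ _ S) => // [n|]; first by case: (HS n).
apply: cvgn_dist_le (@cvg_harmonic R) => n.
by rewrite subr0 ger0_norm ?ip_ge0//; case: (HS n).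
Qed.

Lemma in_L_cf H (k a : R) : in_L P I X H ->
  \int[P]_w cos (k * H w + a) = cos a * expR (- (2^-1 * (k ^+ 2 * ip P H H))).
Proof.
move=> hH; have lH := in_L_sq_int hH.
have [_ ->] := in_L_gaussian (in_LZ k hH).
by rewrite ipZl ?ipZr ?mulrA//; exact: sq_intZ.
Qed.

End gaussian_space.

(** Bernoulli's inequality shows that [c rho^k] exceeds u for some k; the bracket ends at the first
    such k. *)
Lemma geometric_bracket (R : realType) (c rho u : R) N : 0 < c -> 1 < rho -> c * rho ^+ N <= u ->
  exists2 n, (N <= n)%N & c * rho ^+ n <= u < c * rho ^+ n.+1.
Proof.
move=> c0 rho1 cu.
have bern k : 1 + k%:R * (rho - 1) <= rho ^+ k.
  elim: k => [|k IHk]; first by rewrite mul0r addr0 expr0.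
  rewrite exprS; apply: le_trans (ler_wpM2l _ IHk); last by rewrite (le_trans ler01)// ltW.
  rewrite -natr1 -subr_ge0.
  have -> : rho * (1 + k%:R * (rho - 1)) - (1 + (k%:R + 1) * (rho - 1)) = k%:R * (rho - 1) ^+ 2.
    by ring.
  by rewrite mulr_ge0// sqr_ge0.
have ex : exists k, u < c * rho ^+ k.
  pose k := (Num.truncn (u / c / (rho - 1))).+1; exists k.
  rewrite mulrC -ltr_pdivrMr//; apply: lt_le_trans (bern k).
  by rewrite ltr_pwDl// ltW// -ltr_pdivrMr ?subr_gt0//; exact: truncnS_gt.
case: (ex_minnP ex) => k uk kmin.
have Nk : (N < k)%N.
  rewrite ltnNge; apply/negP => kN; move: uk; rewrite ltNge => /negP; apply.
  by apply: le_trans cu; rewrite ler_pM2l// ler_weXn2l// ltW.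
case: k Nk uk kmin => // k Nk uk kmin; exists k => //; rewrite uk andbT leNgt.
by apply/negP => /kmin; rewrite ltnn.
Qed.

(** * Independence and tails of suprema *)

Section orthants.
Context {R : realType}.

(** Infinitely many coordinates at once: for the values of a continuous path at the rationals,
    constant levels express a bound on the supremum. *)
Definition orthant (T : Type) (Z : nat -> T -> R) (s : nat -> R) : set T :=
  [set w | forall j, Z j w <= s j].

Lemma measurable_orthant (d : measure_display) (T : measurableType d)
    (Z : nat -> T -> R) (s : nat -> R) :
  (forall j, measurable_fun setT (Z j)) -> measurable (orthant Z s).
Proof.
move=> mZ; rewrite (_ : orthant Z s = \bigcap_j (Z j @^-1` `]-oo, s j]%classic)).
  by apply: bigcapT_measurable => j; rewrite -[X in measurable X]setTI; apply: mZ.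
apply/seteqP; split => w /= h j.
  by move=> _; rewrite /= in_itv/=; exact: h.
by have := h j I; rewrite /= in_itv.
Qed.

Lemma prod_indicator_cvg (b : nat -> bool) (B : Prop) : (B <-> forall j, b j) ->
  (\prod_(j < n) (b j)%:R : R) @[n --> \oo] --> (`[< B >]%:R : R).
Proof.
move=> Bb; case: asboolP => [/Bb h|nB].
  rewrite (_ : (fun n => _) = fun=> 1); first exact: cvg_cst.
  by apply/funext => n; rewrite big1// => j _; rewrite h.
have /existsNP[j /negP bj] : ~ forall j, b j by move/Bb.
apply: (@cvg_near_cst _ _ _ _ _); near=> n.
have jn : (j < n)%N by near: n; exists j.+1.
by rewrite (bigD1 (Ordinal jn))//= (negbTE bj) mul0r.
Unshelve. all: end_near. Qed.

Section same_law.
Context {d1 d2 : measure_display} {T1 : measurableType d1} {T2 : measurableType d2}.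
Variables (P1 : probability T1 R) (P2 : probability T2 R).
Variables (Z1 : nat -> T1 -> R) (Z2 : nat -> T2 -> R).
Hypothesis mZ1 : forall j, measurable_fun setT (Z1 j).
Hypothesis mZ2 : forall j, measurable_fun setT (Z2 j).

Let prod_cvg (d : measure_display) (T : measurableType d) (P : probability T R)
    (Z : nat -> T -> R) (W : T -> R) (B : R) (s : nat -> R) :
  measurable_fun setT W -> (forall j, measurable_fun setT (Z j)) ->
  (forall w, `|W w| <= B) ->
  \int[P]_w (W w * \prod_(j < n) (Z j w <= s j)%R%:R) @[n --> \oo] -->
  \int[P]_w (W w * \1_(orthant Z s) w).
Proof.
move=> mW mZ bW; apply: (@Rintegral_bdct _ _ _ _ _ _ B).
- move=> n; apply: measurable_funM => //.
  have : forall n, measurable_fun setT (fun w => \prod_(j < n) (Z j w <= s j)%R%:R : R).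
    elim=> [|k IHk]; first by under eq_fun do rewrite big_ord0; exact: measurable_cst.
    under eq_fun do rewrite big_ord_recr/=.
    by apply: measurable_funM => //; exact: measurable_leP.
  exact.
- move=> n w; rewrite normrM; apply: le_trans (bW w); apply: ler_piMr => //.
  elim/big_ind: _ => [|x y x1 y1|j _]; first by rewrite normr1.
    by rewrite normrM mulr_ile1.
  by rewrite ger0_norm// lern1 leq_b1.
- move=> w; apply: cvgM; first exact: cvg_cst.
  rewrite indicE (_ : (w \in orthant Z s) = `[< orthant Z s w >]).
    by apply: (@prod_indicator_cvg (fun j => (Z j w <= s j)%R)).
  by apply/idP/asboolP; rewrite inE.
Qed.

(** The finite products of indicators converge to the indicator of the orthant, so [cramer_wold]
    extends to sequences by bounded convergence. *)
Lemma cramer_wold_orthant (W1 : T1 -> R) (W2 : T2 -> R) (B : R) (s : nat -> R) :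
  measurable_fun setT W1 -> measurable_fun setT W2 ->
  (forall w, `|W1 w| <= B) -> (forall w, `|W2 w| <= B) ->
  (forall n (c : nat -> R) a,
     \int[P1]_w (W1 w * cos (\sum_(j < n) c j * Z1 j w + a)) =
     \int[P2]_w (W2 w * cos (\sum_(j < n) c j * Z2 j w + a))) ->
  \int[P1]_w (W1 w * \1_(orthant Z1 s) w) = \int[P2]_w (W2 w * \1_(orthant Z2 s) w).
Proof.
move=> mW1 mW2 bW1 bW2 H.
have c1 := @prod_cvg _ _ P1 _ _ _ s mW1 mZ1 bW1; have c2 := @prod_cvg _ _ P2 _ _ _ s mW2 mZ2 bW2.
apply: (cvgn_unique c1).
rewrite (_ : (fun n => _) = (fun n => \int[P2]_w (W2 w * \prod_(j < n) (Z2 j w <= s j)%R%:R)))//.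
by apply/funext => n; apply: (cramer_wold (B := B)) => // c a; exact: H.
Qed.

Lemma Rintegral_indic (d : measure_display) (T : measurableType d) (P : probability T R)
  (A : set T) : measurable A -> \int[P]_w (\1_A w) = fine (P A).
Proof. by move=> mA; rewrite /Rintegral integral_indic// setIT. Qed.

Lemma eq_orthant (s : nat -> R) :
  (forall n (c : nat -> R) a,
     \int[P1]_w cos (\sum_(j < n) c j * Z1 j w + a) =
     \int[P2]_w cos (\sum_(j < n) c j * Z2 j w + a)) ->
  fine (P1 (orthant Z1 s)) = fine (P2 (orthant Z2 s)).
Proof.
move=> H; rewrite -!Rintegral_indic; try exact: measurable_orthant.
have e (d : measure_display) (T : measurableType d) (P : probability T R) (f : T -> R) :
    \int[P]_w (1 * f w) = \int[P]_w f w.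
  by apply: eq_Rintegral => w _; rewrite mul1r.
rewrite -(e _ _ P1) -(e _ _ P2).
apply: (@cramer_wold_orthant (cst 1) (cst 1) 1) => // [w|w|n c a]; rewrite ?normr1//.
by rewrite !e.
Qed.

End same_law.
End orthants.

Section gaussian_pairs.
Context {d : measure_display} {T : measurableType d} {R : realType}.
Variable P : probability T R.

(** While the second copy is integrated, the first one is part of the phase; the arbitrary phase in
    [gaussian_cf] makes this possible. *)
Lemma gaussian_cf_pair (f g : T -> R) a : gaussian_cf P f -> gaussian_cf P g ->
  \int[(P \x P : probability (T * T)%type R)%E]_z cos (f z.1 + g z.2 + a) =
  cos a * expR (- (2^-1 * (ip P f f + ip P g g))).
Proof.
move=> [[mf _] cf] [[mg _] cg].
have mJ : measurable_fun setT (fun z : T * T => cos (f z.1 + g z.2 + a)).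
  apply: measurableT_comp; first exact: measurable_cos.
  apply: measurable_funD => //; apply: measurable_funD; exact: measurableT_comp.
have c1 x : `|cos x| <= 1 :> R by rewrite ler_norml cos_geN1 cos_le1.
have iJ : (P \x P : probability (T * T)%type R)%E.-integrable setT (EFin \o (fun z : T * T => cos (f z.1 + g z.2 + a))).
  by apply: (@bounded_int _ _ _ _ _ 1 mJ) => z; exact: c1.
apply: EFin_inj; rewrite Rintegral_EFin// -(integral12_prod_meas1 iJ) /=.
rewrite (eq_integral (fun w1 => (expR (- (2^-1 * ip P g g)) * cos (f w1 + a))%:E)); last first.
  move=> w1 _; rewrite /fubini_F /= mulrC -cg -Rintegral_EFin.
    by congr EFin; apply: eq_Rintegral => w2 _; congr cos; ring.
  apply: bounded_int (fun z => c1 _).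
  apply: measurableT_comp; first exact: measurable_cos.
  by apply: measurable_funD => //; apply: measurable_funD.
have ifa : P.-integrable setT (EFin \o (fun w => cos (f w + a))).
  apply: bounded_int (fun z => c1 _).
  apply: measurableT_comp; first exact: measurable_cos.
  exact: measurable_funD.
rewrite -Rintegral_EFin; last exact: integrable_scale.
congr EFin; rewrite RintegralZl// cf mulrCA; congr (_ * _).
by rewrite -expRD; congr expR; ring.
Qed.

End gaussian_pairs.

Section gaussian_sequences.
Context {d : measure_display} {T : measurableType d} {R : realType}.
Variables (P : probability T R) (I : set R) (X : R -> T -> R).
Hypothesis gX : centered_gaussian_process P I X.

Let mL H : in_L P I X H -> measurable_fun setT H.
Proof. by case. Qed.

Section independence.
Variables (Z : T -> R) (V : nat -> T -> R).
Hypothesis LZ : in_L P I X Z.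
Hypothesis LV : forall j, in_L P I X (V j).
Hypothesis ZV : forall j, ip P Z (V j) = 0.

Let lZ := in_L_sq_int gX LZ.
Let lV j := in_L_sq_int gX (LV j).

Let c1 (x : R) : `|cos x| <= 1. Proof. by rewrite ler_norml cos_geN1 cos_le1. Qed.

Let mcos (Y : T -> R) (a : R) : measurable_fun setT Y -> measurable_fun setT (fun w => cos (Y w + a)).
Proof.
move=> mY; apply: measurableT_comp; first exact: measurable_cos.
exact: measurable_funD.
Qed.

(** The product splits into cosines of [x Z + H] and [x Z - H]. Orthogonality gives these the same
    variance, so a common exponential factors out and the phases recombine into [cos a * cos b]. *)
Let cosM_cf (x a b : R) (H : T -> R) : in_L P I X H -> ip P Z H = 0 ->
  \int[P]_w (cos (x * Z w + a) * cos (H w + b)) =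
  \int[P]_w cos (x * Z w + a) * \int[P]_w cos (H w + b).
Proof.
move=> LH ZH; have lH := in_L_sq_int gX LH.
have cf (e : R) : e ^+ 2 = 1 -> forall a, \int[P]_w cos (x * Z w + e * H w + a) =
    cos a * expR (- (2^-1 * (x ^+ 2 * ip P Z Z + ip P H H))).
  move=> e1 c.
  have [_ ->] := in_L_gaussian gX (in_LD gX (in_LZ gX x LZ) (in_LZ gX e LH)).
  congr (_ * expR (- (_ * _))).
  rewrite ip_sqrD ?ipZl ?ipZr//; try exact: sq_intZ.
  by rewrite ZH !mulr0 addr0 !mulrA -!expr2 e1 mul1r.
rewrite (in_L_cf gX)//; have [_ ->] := in_L_gaussian gX LH.
have ic (e c : R) : P.-integrable setT (EFin \o (fun w => 2^-1 * cos (x * Z w + e * H w + c))).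
  apply: integrable_scale; apply: bounded_int (fun w => c1 _).
  by apply: (mcos (Y := fun w => x * Z w + e * H w)); apply: measurable_funD;
    apply: measurable_funM => //; exact: mL.
have -> : \int[P]_w (cos (x * Z w + a) * cos (H w + b)) =
  \int[P]_w (2^-1 * cos (x * Z w + 1 * H w + (a + b)) + 2^-1 * cos (x * Z w + -1 * H w + (a - b))).
  by apply: eq_Rintegral => w _; rewrite cosM; congr (_ * cos _ + _ * cos _); ring.
rewrite RintegralD// !RintegralZl//; last 2 first.
- by apply: bounded_int (fun w => c1 _); apply: (mcos (Y := fun w => x * Z w + -1 * H w));
    apply: measurable_funD; apply: measurable_funM => //; exact: mL.
- by apply: bounded_int (fun w => c1 _); apply: (mcos (Y := fun w => x * Z w + 1 * H w));
    apply: measurable_funD; apply: measurable_funM => //; exact: mL.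
rewrite !cf ?expr1n ?sqrrN ?expr1n// cosD cosB mulrACA -expRD.
have -> : - (2^-1 * (x ^+ 2 * ip P Z Z)) + - (2^-1 * ip P H H) =
  - (2^-1 * (x ^+ 2 * ip P Z Z + ip P H H)) by ring.
by field.
Qed.

(** Two passes: with [cos (x Z + a)] as weight, the family V is replaced by the indicator of its
    orthant; with that indicator as weight, Z is treated in the same way. *)
Lemma independent_orthant (s : nat -> R) (u : R) :
  fine (P (orthant V s `&` [set w | Z w <= u])) =
  fine (P (orthant V s)) * fine (P [set w | Z w <= u]).
Proof.
have mA : measurable (orthant V s) by apply: measurable_orthant => j; exact: mL.
have mZ : measurable_fun setT Z by exact: mL.
have mZu : measurable [set w | Z w <= u].
  rewrite (_ : mkset _ = Z @^-1` `]-oo, u]%classic).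
    by rewrite -[X in measurable X]setTI; exact: mZ.
  by apply/seteqP; split => w /=; rewrite in_itv.
have step1 x a : \int[P]_w (cos (x * Z w + a) * \1_(orthant V s) w) =
    \int[P]_w (\int[P]_w cos (x * Z w + a) * \1_(orthant V s) w).
  apply: (@cramer_wold_orthant _ _ _ _ _ P P V V _ _ (fun w => cos (x * Z w + a)) _ 1) => //.
  - by move=> j; exact: mL.
  - by move=> j; exact: mL.
  - by apply: mcos; exact: measurable_funM.
  - move=> _; apply: le_trans (le_normr_Rintegral _ _) _ => //.
      by apply: bounded_int (fun w => c1 _); apply: mcos; exact: measurable_funM.
    rewrite -[leRHS](Rintegral_prob_cst P); apply: le_Rintegral => //.
    + apply: (@bounded_int _ _ _ _ _ 1) => [|w]; last by rewrite normr_id.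
      by apply: measurableT_comp => //; apply: mcos; exact: measurable_funM.
    + exact: integrable_cst.
  - move=> n c b; set H := fun w => \sum_(j < n) c j * V j w.
    have LH : in_L P I X H by apply: (in_L_sum gX) => j _; exact: LV.
    have ZH : ip P Z H = 0.
      by rewrite ipC ip_suml// big1// => j _; rewrite ipC ZV mulr0.
    rewrite (cosM_cf x a b LH ZH) RintegralZl//.
    by apply: bounded_int (fun w => c1 _); apply: mcos; exact: mL.
have b1 A (w : T) : `|(\1_A w : R)| <= 1.
  by rewrite indicE; case: (_ \in _); rewrite ?normr1 ?normr0.
pose p := fine (P (orthant V s)).
have iZu : P.-integrable setT (EFin \o (fun w => (Z w <= u)%R%:R)).
  apply: (@bounded_int _ _ _ _ _ 1); first exact: measurable_leP.
  by move=> w; rewrite ger0_norm// lern1 leq_b1.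
have e : \int[P]_w (\1_(orthant V s) w * (Z w <= u)%R%:R) = \int[P]_w (p * (Z w <= u)%R%:R).
  apply: (@weighted_char_le _ _ _ _ _ P P _ _ _ _ 1) => //.
  - by move=> _; rewrite ger0_norm ?fine_ge0// -lee_fin fineK ?fin_num_measure// probability_le1.
  - move=> x a; rewrite RintegralZl//; last first.
      by apply: bounded_int (fun w => c1 _); apply: mcos; exact: measurable_funM.
    under eq_Rintegral do rewrite mulrC.
    rewrite step1 RintegralZl//; last exact: bounded_int (b1 _).
    by rewrite Rintegral_indic// mulrC.
have Zind w : (Z w <= u)%R%:R = \1_[set w | Z w <= u] w :> R.
  by rewrite indicE; congr ((nat_of_bool _)%:R); apply/idP/idP; rewrite inE.
move: e; rewrite RintegralZl//.
under eq_Rintegral do rewrite Zind.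
under [in RHS]eq_Rintegral do rewrite Zind.
rewrite [\int[P]_w \1_[set w | Z w <= u] w]Rintegral_indic// => <-.
rewrite -Rintegral_indic; last exact: measurableI.
by apply: eq_Rintegral => w _; rewrite indicI.
Qed.

End independence.
Section rotation.
Variables V1 V2 : nat -> T -> R.
Hypothesis LV1 : forall j, in_L P I X (V1 j).
Hypothesis LV2 : forall j, in_L P I X (V2 j).
Variables s t : R.

(** Two families are interleaved into one sequence: even indices carry the first with level s, odd
    ones the second with level t. *)
Let level j := if odd j then t else s.

Let PP : probability (T * T)%type R := (P \x P)%E.

Let orthant_pairs (F1 F2 : nat -> T * T -> R) :
  orthant (fun j z => if odd j then F2 j./2 z else F1 j./2 z) level =
  [set z | (forall j, F1 j z <= s) /\ forall j, F2 j z <= t].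
Proof.
apply/seteqP; split => z /=.
  move=> h; split => j.
    by have := h j.*2; rewrite /level odd_double doubleK.
  by have := h j.*2.+1; rewrite /level /= odd_double/= uphalf_double.
by move=> [h1 h2] j; rewrite /level; case: ifP.
Qed.

Lemma rotation_orthant :
  fine (PP [set z | (forall j, (3 * V1 j z.1 + 4 * V1 j z.2) / 5 <= s) /\
                    forall j, (4 * V2 j z.1 - 3 * V2 j z.2) / 5 <= t]) =
  fine (P (orthant V1 (cst s))) * fine (P (orthant V2 (cst t))).
Proof.
have mV1 j := mL (LV1 j); have mV2 j := mL (LV2 j).
have m1 (H : T -> R) : measurable_fun setT H -> measurable_fun setT (fun z : T * T => H z.1).
  by move=> mH; exact: measurableT_comp.
have m2 (H : T -> R) : measurable_fun setT H -> measurable_fun setT (fun z : T * T => H z.2).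
  by move=> mH; exact: measurableT_comp.
transitivity (fine (PP (orthant V1 (cst s) `*` orthant V2 (cst t)))); last first.
  rewrite [PP _]product_measure1E ?fineM ?fin_num_measure//;
    by apply: measurable_orthant => j.
have -> : orthant V1 (cst s) `*` orthant V2 (cst t) =
    [set z : T * T | (forall j, V1 j z.1 <= s) /\ forall j, V2 j z.2 <= t].
  by [].
rewrite -(orthant_pairs (fun j z => (3 * V1 j z.1 + 4 * V1 j z.2) / 5)
  (fun j z => (4 * V2 j z.1 - 3 * V2 j z.2) / 5)).
rewrite -(orthant_pairs (fun j z => V1 j z.1) (fun j z => V2 j z.2)).
apply: eq_orthant => [j|j|n c a].
- case: (odd j); apply: measurable_funM => //.
    by apply: measurable_funB; apply: measurable_funM => //; [exact: m1|exact: m2].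
  by apply: measurable_funD; apply: measurable_funM => //; [exact: m1|exact: m2].
- by case: (odd j); [exact: m2|exact: m1].
set f := fun w => \sum_(j < n) (if odd j then 0 else c j) * V1 j./2 w.
set g := fun w => \sum_(j < n) (if odd j then c j else 0) * V2 j./2 w.
have Lf : in_L P I X f by apply: (in_L_sum gX (fun j => if odd j then 0 else c j) (F := fun j => V1 j./2)).
have Lg : in_L P I X g by apply: (in_L_sum gX (fun j => if odd j then c j else 0) (F := fun j => V2 j./2)).
have lf := in_L_sq_int gX Lf; have lg := in_L_sq_int gX Lg.
(* The rotated linear form is [f'] on the first copy plus [g'] on the second. The matrix with rows
   (3, 4)/5 and (4, -3)/5 is orthogonal, so the variances of [f'] and [g'] add up to those of f and
   g. *)
pose f' w := 3 / 5 * f w + 4 / 5 * g w.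
pose g' w := 4 / 5 * f w + (- (3 / 5)) * g w.
have Lf' : in_L P I X f' by apply: (in_LD gX); exact: (in_LZ gX).
have Lg' : in_L P I X g' by apply: (in_LD gX); exact: (in_LZ gX).
transitivity (\int[PP]_z cos (f' z.1 + g' z.2 + a)).
  apply: eq_Rintegral => z _; congr (cos (_ + _)).
  rewrite /f' /g' /f /g !mulr_sumr -!big_split/=; apply: eq_bigr => j _.
  by case: (odd j); field.
transitivity (\int[PP]_z cos (f z.1 + g z.2 + a)); last first.
  apply: eq_Rintegral => z _; congr (cos (_ + _)).
  rewrite /f /g -big_split/=; apply: eq_bigr => j _.
  by case: (odd j); rewrite mul0r ?add0r ?addr0.
rewrite !gaussian_cf_pair; try exact: (in_L_gaussian gX).
by rewrite !ip_sqrD ?ipZl ?ipZr//; try exact: sq_intZ; congr (_ * expR (- (_ * _))); field.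
Qed.

End rotation.

(** * A Fernique-type tail estimate *)

Section fernique.
Variable V : nat -> T -> R.
Hypothesis LV : forall j, in_L P I X (V j).
Hypothesis symV : forall j, exists k, forall w, V k w = - V j w.
Hypothesis bV : forall w, exists B : R, forall j, V j w <= B.

(** By [symV] this is the tail of the supremum of the absolute values. *)
Definition tail (r : R) := 1 - fine (P (orthant V (cst r))).

Let mO r : measurable (orthant V (cst r)).
Proof. by apply: measurable_orthant => j; exact: mL. Qed.

Let fin_prob (d' : measure_display) (T' : measurableType d') (Q : probability T' R) (A : set T') :
  measurable A -> Q A \is a fin_num.
Proof. by move=> mA; rewrite fin_num_measure. Qed.

Lemma tailE r : P (~` orthant V (cst r)) = (tail r)%:E.
Proof. by rewrite probability_setC// /tail EFinB fineK// fin_prob. Qed.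

Lemma tail_ge0 r : 0 <= tail r.
Proof. by rewrite -lee_fin -tailE. Qed.

Lemma tail_le r r' : r <= r' -> tail r' <= tail r.
Proof.
move=> rr'; rewrite -lee_fin -!tailE; apply: le_measure; rewrite ?inE.
- exact/measurableC.
- exact/measurableC.
- by apply: subsetC => w h j; exact: le_trans (h j) rr'.
Qed.

(* Rotating two independent copies by the angle of the 3-4-5 triangle: if the first
   coordinate is at most s and the second exceeds t, both copies exceed (3t - 4s)/5. *)
Lemma tail_rotation s t : 0 <= s -> 0 <= t ->
  (1 - tail s) * tail t <= tail ((3 * t - 4 * s) / 5) ^+ 2.
Proof.
move=> s0 t0; set r := _ / 5.
pose PP : probability (T * T)%type R := (P \x P)%E.
have mV j := mL (LV j).
have e1 := rotation_orthant LV LV s t.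
(* A second use, with the zero family: [A2] says that the first rotated coordinate stays below s and
   has probability [1 - tail s]. The left side of the claim is then the probability of [A2] minus
   that of [A1]. *)
have L0 (j : nat) : in_L P I X (cst 0).
  have := in_LB gX (LV 0) (LV 0).
  by under [X in in_L _ _ _ X -> _]eq_fun do rewrite subrr.
have e2 := rotation_orthant LV L0 s 0.
set A1 := (X in PP X) in e1; set A2 := (X in PP X) in e2.
have -> : 1 - tail s = fine (P (orthant V (cst s))) by rewrite /tail subKr.
have O0 : orthant (fun=> cst 0 : T -> R) (cst 0) = setT.
  by apply/seteqP; split => // w _ j.
rewrite O0 [P setT]probability_setT mulr1 in e2.
rewrite {2}/tail mulrBr mulr1 -e1 -e2 lerBlDl.
have m1 (H : T -> R) : measurable_fun setT H -> measurable_fun setT (fun z : T * T => H z.1).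
  by move=> mH; exact: measurableT_comp.
have m2 (H : T -> R) : measurable_fun setT H -> measurable_fun setT (fun z : T * T => H z.2).
  by move=> mH; exact: measurableT_comp.
have mU : measurable (orthant (fun j (z : T * T) => (3 * V j z.1 + 4 * V j z.2) / 5) (cst s)).
  apply: measurable_orthant => j; apply: measurable_funM => //.
  by apply: measurable_funD; apply: measurable_funM => //; [exact: m1|exact: m2].
have mW : measurable (orthant (fun j (z : T * T) => (4 * V j z.1 - 3 * V j z.2) / 5) (cst t)).
  apply: measurable_orthant => j; apply: measurable_funM => //.
  by apply: measurable_funB; apply: measurable_funM => //; [exact: m1|exact: m2].
have mA1 : measurable A1 by exact: measurableI mU mW.
have A2U : A2 = orthant (fun j (z : T * T) => (3 * V j z.1 + 4 * V j z.2) / 5) (cst s).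
  apply/seteqP; split => z /=; first by case.
  by move=> h; split => // j; rewrite !mulr0 subrr mul0r.
have mA2 : measurable A2 by rewrite A2U.
have mQ : measurable (~` orthant V (cst r) `*` ~` orthant V (cst r)).
  by apply: measurableX; exact: measurableC.
have -> : tail r ^+ 2 = fine (PP (~` orthant V (cst r) `*` ~` orthant V (cst r))).
  have mC := measurableC (mO r).
  have -> : PP (~` orthant V (cst r) `*` ~` orthant V (cst r)) =
      (P (~` orthant V (cst r)) * P (~` orthant V (cst r)))%E by exact: product_measure1E.
  by rewrite !tailE.
have fPP A : measurable A -> PP A \is a fin_num by exact: fin_prob.
rewrite -fineD; [|exact: fPP|exact: fPP].
apply: fine_le; [exact: fPP|by rewrite fin_numD; apply/andP; split; exact: fPP|].
apply: (le_trans _ (measureU2 PP mA1 mQ)); apply: le_measure; rewrite ?inE//.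
  exact: measurableU.
move=> z A2z; have [Wz|] := pselect (A1 z); [by left|right].
move: A2z; rewrite A2U => Uz.
have /existsNP[j /negP] : ~ forall j, (4 * V j z.1 - 3 * V j z.2) / 5 <= t.
  by move=> h; apply: b; split.
rewrite -ltNge => tj.
have [k Vk] := symV j; have sj := Uz j; have := Uz k.
rewrite !Vk /= => sk.
(* Let A in [-s, s] and B > t be the rotated values at j. Inverting the rotation, the two copies
   have the values (3A + 4B)/5 and (4A - 3B)/5, so j serves for the first copy and the index k of
   the opposite variable for the second. *)
split => /=; apply/existsNP.
  by exists j; apply/negP; rewrite -ltNge /r; move: sk tj; rewrite /=; lra.
by exists k; apply/negP; rewrite -ltNge /= Vk /r; move: sj tj; rewrite /=; lra.
Qed.

Lemma tail_small : exists2 s : R, 0 < s & tail s <= 4^-1.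
Proof.
have c : P (orthant V (cst n.+1%:R)) @[n --> \oo] --> 1%E.
  rewrite -(probability_setT P) (_ : setT = \bigcup_n orthant V (cst n.+1%:R)).
    apply: nondecreasing_cvg_mu => //; first exact: bigcupT_measurable.
    move=> m n mn; apply/subsetPset => w h j.
    by apply: le_trans (h j) _; rewrite ler_nat ltnS.
  apply/seteqP; split => // w _; have [B HB] := bV w.
  exists (Num.truncn B) => // j; apply: le_trans (HB j) _.
  by rewrite ltW//; exact: truncnS_gt.
have c' : fine (P (orthant V (cst n.+1%:R))) @[n --> \oo] --> (1 : R) by exact: fine_cvg.
have /cvgrPdist_lt/(_ 4^-1) := c'.
rewrite invr_gt0 => /(_ (ltr0n _ _)) h; near \oo => n.
exists n.+1%:R => //; rewrite ltW// (le_lt_trans (ler_norm _))//.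
by near: n; exact: h.
Unshelve. all: end_near. Qed.

(** At [t = 10 s rho^(n+1)] with [rho = 9/5], the point [(3t - 4s)/5] is [10.8 s rho^n - 0.8 s],
    which is at least the preceding level. Each step therefore squares the tail up to the factor
    4/3, which the prefactor 3/4 absorbs; the induction starts from [3/4 * 1/3 = 1/4]. *)
Lemma tail_exp_decay (lam : R) : exists U : R, forall u, U <= u -> tail u <= expR (- (lam * u)).
Proof.
wlog lam0 : lam / 0 < lam => [H|].
  have [/H//|lam0] := ltP 0 lam.
  have [U HU] := H 1 ltr01; exists (Num.max U 0) => u.
  rewrite ge_max => /andP[Uu u0]; apply: le_trans (HU _ Uu) _.
  by rewrite ler_expR lerN2; nra.
have [s s0 ts] := tail_small.
pose rho : R := 9 / 5.
have claim n : tail (10 * s * rho ^+ n) <= 3 / 4 * 3^-1 ^+ (2 ^ n).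
  elim: n => [|n IHn].
    rewrite expr0 mulr1 expn0 expr1; apply: (@le_trans _ _ (tail s)).
      by apply: tail_le; lra.
    by apply: le_trans ts _; lra.
  have rn : 1 <= rho ^+ n by rewrite exprn_ege1// /rho; lra.
  set t := 10 * s * rho ^+ n.+1.
  have t0 : 0 <= t by rewrite !mulr_ge0// ?exprn_ge0 /rho//; lra.
  have h1 := tail_rotation (ltW s0) t0.
  have h2 : tail ((3 * t - 4 * s) / 5) <= tail (10 * s * rho ^+ n).
    apply: tail_le; rewrite /t exprS /rho in rn *; nra.
  have h3 : tail ((3 * t - 4 * s) / 5) ^+ 2 <= (3 / 4 * 3^-1 ^+ (2 ^ n)) ^+ 2.
    by rewrite lerXn2r ?nnegrE ?tail_ge0 ?mulr_ge0 ?exprn_ge0// (le_trans h2).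
  have h4 : 3 / 4 * tail t <= (1 - tail s) * tail t.
    by rewrite ler_wpM2r ?tail_ge0//; lra.
  have := le_trans h4 (le_trans h1 h3).
  rewrite exprMn -exprM -expnSr; set p := 3^-1 ^+ _ => h.
  by lra.
have k0 : 0 < ln 3 :> R by apply: ln_gt0; lra.
have [N hN] : exists N, lam * (18 * s) / ln 3 <= (10 / 9) ^+ N.
  have [N _ /andP[_ h]] := @geometric_bracket R 1 (10 / 9) (Num.max 1 (lam * (18 * s) / ln 3)) 0 ltr01 ltac:(lra)
    ltac:(by rewrite expr0 mulr1 le_max lexx).
  exists N.+1; rewrite -[leRHS]mul1r; apply: le_trans (ltW h).
  by rewrite le_max lexx orbT.
exists (10 * s * rho ^+ N) => u Uu.
have [n Nn /andP[nu un]] := geometric_bracket (c := 10 * s) ltac:(lra) (ltac:(rewrite /rho; lra) : 1 < rho) Uu.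
apply: le_trans (tail_le nu) _; apply: le_trans (claim n) _.
apply: (@le_trans _ _ (3^-1 ^+ (2 ^ n))).
  by rewrite ler_piMl ?exprn_ge0//; lra.
have -> : 3^-1 ^+ (2 ^ n) = expR (- (ln 3 * 2 ^+ n)) :> R.
  rewrite -[X in X^-1](@lnK R 3) ?posrE// -expRN -expRM_natl.
  by rewrite natrX; congr expR; ring.
rewrite ler_expR lerN2.
apply: (@le_trans _ _ (lam * (18 * s * rho ^+ n))).
  rewrite ler_pM2l//; apply: le_trans (ltW un) _.
  by rewrite exprS /rho; lra.
(* The exponent [2^n] outgrows the level by [(10/9)^n], which from N on exceeds the required
   constant; 18 is 10 times rho, from the upper end of the bracket. *)
have -> : 2 ^+ n = (10 / 9) ^+ n * rho ^+ n :> R.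
  by rewrite -exprMn; congr (_ ^+ _); rewrite /rho; field.
rewrite mulrA [leRHS]mulrA ler_pM2r ?exprn_gt0//; last by rewrite /rho; lra.
rewrite [leRHS]mulrC -ler_pdivrMr// (le_trans hN)// ler_weXn2l//; lra.
Qed.

End fernique.

End gaussian_sequences.

(** * Integrals of functions close to a constant off a small set *)

Section integral_near_constant.
Context {d : measure_display} {T : measurableType d} {R : realType}.
Variable P : probability T R.

(* No measurability is assumed: the Lebesgue integral of a nonnegative function is
   defined as a supremum over simple functions below it. *)
Lemma ge0_le_integral_nonmeasurable (f g : T -> \bar R) :
  (forall x, 0 <= f x)%E -> (forall x, f x <= g x)%E -> (\int[P]_x f x <= \int[P]_x g x)%E.
Proof.
move=> f0 fg; rewrite !ge0_integralTE//; last by move=> x; exact: le_trans (fg x).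
by apply: ereal_sup_le => _ [h /= hf <-]; exists h => // x; exact: le_trans (fg x).
Qed.

Lemma cvg_pinftyP (g : R -> R) (l : R) :
  (forall e, 0 < e -> exists U : R, forall u, U <= u -> `|g u - l| <= e) -> g @ +oo --> l.
Proof.
move=> h; apply/cvgrPdist_le => e e0; have [U HU] := h e e0.
near=> u; rewrite distrC; apply: HU.
by near: u; apply: nbhs_pinfty_ge; exact: num_real.
Unshelve. all: end_near. Qed.

Variables (A B : set T) (M e : R).
Hypotheses (mA : measurable A) (mB : measurable B) (BA : B `<=` A).
Hypotheses (e0 : 0 <= e).

Let pr := fine \o P.

Let PE C : measurable C -> P C = (pr C)%:E.
Proof. by move=> mC; rewrite /pr /= fineK// fin_num_measure. Qed.

Let prD : pr (A `\` B) = pr A - pr B.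
Proof.
apply: EFin_inj; rewrite EFinB -!PE//; last exact: measurableD.
rewrite measureD//; last by rewrite ltey_eq fin_num_measure.
by rewrite (setIidr BA).
Qed.

Let pr_ge0 C : 0 <= pr C. Proof. exact: fine_ge0. Qed.

Let i C : measurable C -> P.-integrable setT (EFin \o (\1_C : T -> R)).
Proof.
move=> mC; apply: (@bounded_int _ _ _ _ _ 1); first exact: measurable_indic.
by move=> w; rewrite indicE ger0_norm// lern1 leq_b1.
Qed.

Let combE (k l : R) : 0 <= k -> 0 <= l ->
  (\int[P]_x (k * \1_A x + l * \1_B x)%:E = (k * pr A + l * pr B)%:E)%E.
Proof.
move=> k0 l0.
rewrite -Rintegral_EFin; last by apply: integrable_add; apply: integrable_scale; exact: i.
rewrite RintegralD//; try by apply: integrable_scale; exact: i.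
by rewrite !RintegralZl// ?Rintegral_indic//; exact: i.
Qed.

(** Here B is the part of A on which only the bound M is known. From above, f is compared with c + e
    on A plus M on B; from below, with c - e on A without B. *)
Lemma integral_near_cst_ge0 (c : R) (f : T -> R) : (forall x, 0 <= f x <= M) -> 0 <= c <= M ->
  (forall x, A x -> ~ B x -> `|f x - c| <= e) ->
  exists2 r : R, (\int[P]_(x in A) (f x)%:E)%E = r%:E & `|r - c * pr A| <= e * pr A + M * pr B.
Proof.
move=> fM /andP[c0 cM] fc.
have M0 := le_trans c0 cM.
pose J := (\int[P]_(x in A) (f x)%:E)%E; rewrite -/J; have J0 : (0 <= J)%E.
  by apply: integral_ge0 => x _; rewrite lee_fin; case/andP: (fM x).
have JE : (J = \int[P]_x ((fun x => (f x)%:E) \_ A) x)%E by rewrite /J integral_mkcond.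
have gA x : (0 <= ((fun x => (f x)%:E) \_ A) x)%E.
  by rewrite patchE; case: ifP => // _; rewrite lee_fin; case/andP: (fM x).
have ub : (J <= ((c + e) * pr A + M * pr B)%:E)%E.
  rewrite -combE ?addr_ge0// JE; apply: ge0_le_integral_nonmeasurable => // x.
  rewrite patchE !indicE; case: ifPn => xA; last by rewrite lee_fin addr_ge0// mulr_ge0// addr_ge0.
  have /andP[f0 f1] := fM x.
  rewrite lee_fin mulr1; have [xB|xB] := boolP (x \in B).
    by rewrite mulr1; apply: le_trans f1 _; rewrite lerDr addr_ge0.
  rewrite mulr0 addr0; have Bx : ~ B x by move=> /mem_set; exact/negP.
  by have := fc x (set_mem xA) Bx; rewrite ler_norml; lra.
have fJ : J \is a fin_num by rewrite ge0_fin_numE// (le_lt_trans ub)// ltry.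
have lb : (((c - e) * (pr A - pr B))%:E <= J)%E.
  (* For c - e < 0 the comparison function is not nonnegative, but the bound is then trivial. *)
  have [ce|ce] := leP 0 (c - e); last first.
    apply: le_trans J0; rewrite lee_fin; apply: mulr_le0_ge0; first exact: ltW.
    by rewrite -prD.
  have mAB : measurable (A `\` B) by exact: measurableD.
  have -> : ((c - e) * (pr A - pr B))%:E = (\int[P]_x ((c - e) * \1_(A `\` B) x)%:E)%E.
    rewrite -prD -Rintegral_EFin; last exact/integrable_scale/i.
    by rewrite RintegralZl// ?Rintegral_indic//; exact: i.
  rewrite JE; apply: ge0_le_integral_nonmeasurable => x.
    by rewrite lee_fin mulr_ge0.
  rewrite patchE indicE in_setD; case: ifPn => xA /=; last by rewrite mulr0.
  have /andP[f0 f1] := fM x.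
  have [xB|xB] /= := boolP (x \in B); first by rewrite mulr0 lee_fin.
  rewrite mulr1 lee_fin; have Bx : ~ B x by move=> /mem_set; exact/negP.
  by have := fc x (set_mem xA) Bx; rewrite ler_norml; lra.
exists (fine J); first by rewrite fineK.
move: lb ub; rewrite -(fineK fJ) !lee_fin => lb ub.
have pB := pr_ge0 B; have pA := pr_ge0 A.
have h1 : c * pr B <= M * pr B by rewrite ler_wpM2r.
have h2 : 0 <= e * pr B by rewrite mulr_ge0.
have h3 : 0 <= M * pr B by rewrite mulr_ge0.
move: lb ub h1 h2 h3; move: (pr A) (pr B) (fine J) => x y z.
by rewrite /= ler_norml; lra.
Qed.

(** Positive and negative parts are treated separately, the maximum with 0 being 1-Lipschitz; this
    doubles the error. *)
Lemma integral_near_cst (c : R) (f : T -> R) : (forall x, `|f x| <= M) -> `|c| <= M ->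
  (forall x, A x -> ~ B x -> `|f x - c| <= e) ->
  `|fine (\int[P]_(x in A) (f x)%:E)%E - c * pr A| <= 2 * (e * pr A + M * pr B).
Proof.
move=> fM cM fc.
have M0 : 0 <= M by exact: le_trans cM.
have maxM (x : R) : `|x| <= M -> 0 <= Num.max x 0 <= M.
  by move=> /(le_trans (ler_norm _)) xM; rewrite le_max lexx orbT ge_max xM.
have max_lip (x y : R) : `|Num.max x 0 - Num.max y 0| <= `|x - y|.
  wlog yx : x y / y <= x => [H|].
    by have [/H|/ltW/H] := leP y x; rewrite // distrC [leRHS]distrC.
  rewrite !ger0_norm ?subr_ge0 ?le_max2//.
  by case: (leP x 0) => x0; case: (leP y 0) => y0; rewrite ?subrr ?subr0 ?lerBrDr ?add0r ?lerDl//; lra.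
have [r1 I1 h1] := @integral_near_cst_ge0 (Num.max c 0) (fun x => Num.max (f x) 0)
  (fun x => maxM _ (fM x)) (maxM _ cM) (fun x Ax Bx => le_trans (max_lip _ _) (fc x Ax Bx)).
have fM' x : `|- f x| <= M by rewrite normrN.
have cM' : `|- c| <= M by rewrite normrN.
have fc' x : A x -> ~ B x -> `|- f x - - c| <= e by rewrite -opprD normrN; exact: fc.
have [r2 I2 h2] := @integral_near_cst_ge0 (Num.max (- c) 0) (fun x => Num.max (- f x) 0)
  (fun x => maxM _ (fM' x)) (maxM _ cM') (fun x Ax Bx => le_trans (max_lip _ _) (fc' x Ax Bx)).
have -> : (\int[P]_(x in A) (f x)%:E = (r1 - r2)%:E)%E.
  rewrite integralE EFinB -I1 -I2; congr (_ - _)%E; apply: eq_integral => x _.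
    by rewrite funeposE EFin_max.
  by rewrite funenegE -EFinN EFin_max.
have -> : c = Num.max c 0 - Num.max (- c) 0.
  by case: (leP c 0) => c0; case: (leP (- c) 0) => c0'; lra.
move: h1 h2; rewrite /= !ler_norml mulrBl; set x := _ * pr A; set y := _ * pr A.
set z := _ + _; lra.
Qed.

End integral_near_constant.

Section pairs.
Context {d : measure_display} {T : measurableType d} {R : realType}.
Variable M : {finite_measure set T -> \bar R}.
Implicit Types f g : (T -> R) * (T -> R).

(** Pairs stand for real and imaginary parts, and this is the real part of the Hermitian product. *)
Definition ip2 f g := ip M f.1 g.1 + ip M f.2 g.2.

Lemma ip2_dist f g : sq_int M f.1 -> sq_int M f.2 -> sq_int M g.1 -> sq_int M g.2 ->
  ip M (fun w => f.1 w - g.1 w) (fun w => f.1 w - g.1 w) +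
  ip M (fun w => f.2 w - g.2 w) (fun w => f.2 w - g.2 w) =
  ip2 f f - 2 * ip2 f g + ip2 g g.
Proof. by move=> *; rewrite /ip2 !ip_sqrB//; ring. Qed.

Lemma ip2_quadratic (l : R) f g : sq_int M f.1 -> sq_int M f.2 -> sq_int M g.1 -> sq_int M g.2 ->
  0 <= ip2 f f - 2 * l * ip2 f g + l ^+ 2 * ip2 g g.
Proof.
move=> lf1 lf2 lg1 lg2.
have := @ip2_dist f (fun w => l * g.1 w, fun w => l * g.2 w) lf1 lf2 (sq_intZ l lg1) (sq_intZ l lg2).
rewrite /ip2/= !ipZr ?ipZl//; try exact: sq_intZ.
set q := _ + _ => e.
rewrite [X in 0 <= X](_ : _ = q); last by rewrite e; ring.
by rewrite addr_ge0 ?ip_ge0.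
Qed.

End pairs.
(** * The energy minimization problem *)

Section reparametrized_process.
Context {d : measure_display} {T : measurableType d} {R : realType}.
Variables (P : probability T R) (X : R -> T -> R) (I : set R) (a b : R).
Hypothesis ab : a < b.
Hypothesis subI : `[a, b]%classic `<=` I.
Hypothesis gX : centered_gaussian_process P I X.
Hypothesis cX : continuous_paths I X.
Implicit Types (mu nu : probability R R) (h : T -> R).

(** Time runs over [0, 1] and is frozen outside, so that the paths are continuous on the whole
    line. *)
Definition unit_process (v : R) (w : T) : R := X (aff a b (clamp01 v)) w.
Notation G := unit_process.

Lemma aff_itv v : 0 <= v <= 1 -> a <= aff a b v <= b.
Proof.
move=> /andP[v0 v1]; rewrite /aff.
have ba : 0 < b - a by rewrite subr_gt0.
by apply/andP; split; nra.
Qed.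

Lemma aff_in v : 0 <= v <= 1 -> I (aff a b v).
Proof. by move=> v01; apply: subI; rewrite /= in_itv/=; exact: aff_itv. Qed.

Let Iaff v : I (aff a b (clamp01 v)). Proof. exact/aff_in/clamp01_itv. Qed.

Lemma continuous_aff : continuous (aff a b).
Proof.
by move=> v; apply: cvgD; [exact: cvg_cst|apply: cvgM; [exact: cvg_cst|exact: cvg_id]].
Qed.

Lemma within_comp (f : R -> R) (g : R -> R) : {within I, continuous f} ->
  continuous g -> (forall v, I (g v)) -> continuous (f \o g).
Proof.
move=> /subspace_continuousP cf cg Ig v.
apply: cvg_comp (cf (g v) (Ig v)) => A /= hA.
have h : \forall u \near v, I (g u) -> A (g u) by exact: (cg v _ hA).
by apply: filterS h => u; apply.
Qed.

Lemma unit_process_continuous w : continuous (G ^~ w).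
Proof.
apply: (@within_comp (fun t => X t w) (fun v => aff a b (clamp01 v))) => //.
by move=> v; apply: (@continuous_comp R R R clamp01 (aff a b)); [exact: continuous_clamp01|exact: continuous_aff].
Qed.

Lemma unit_process_clamp v w : G (clamp01 v) w = G v w.
Proof. by rewrite /G clamp01K. Qed.

Lemma unit_processE v : 0 <= v <= 1 -> G v = X (aff a b v).
Proof. by move=> v01; rewrite /G clamp01_id. Qed.

Lemma unit_process_in_L v : in_L P I X (G v).
Proof. exact: in_L_process. Qed.

Let lG v : sq_int P (G v). Proof. exact/in_L_sq_int/unit_process_in_L. Qed.

(** The increments are Gaussian: path continuity gives [E cos D -> 1] by bounded convergence, while
    [E cos D = exp (- Var D / 2)]. Taking logarithms sends the variances to 0 without any uniform
    integrability. *)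
Lemma unit_process_cvg (u : nat -> R) v : u @ \oo --> v ->
  ip P (fun w => G (u n) w - G v w) (fun w => G (u n) w - G v w) @[n --> \oo] --> 0.
Proof.
move=> uv.
pose D n w := G (u n) w - G v w.
have LD n : in_L P I X (D n) by apply: in_LB => //; exact: unit_process_in_L.
have c1 : \int[P]_w cos (D n w + 0) @[n --> \oo] --> \int[P]_w (1 : R).
  apply: (@Rintegral_bdct _ _ _ _ _ _ 1).
  - move=> n; apply: measurableT_comp; first exact: measurable_cos.
    by apply: measurable_funD => //; case: (in_L_sq_int gX (LD n)).
  - by move=> n w; rewrite ler_norml cos_geN1 cos_le1.
  - move=> w; rewrite -[X in _ --> X]cos0 -[X in cos X]addr0.
    apply: (@cvg_comp _ _ _ (fun n => D n w + 0) (@cos R)); last exact: continuous_cos.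
    apply: cvgD; last exact: cvg_cst.
    apply/subr_cvg0; exact: (continuous_cvg _ (@unit_process_continuous w v) uv).
have e n : \int[P]_w cos (D n w + 0) = expR (- (2^-1 * ip P (D n) (D n))).
  by have [_ ->] := in_L_gaussian gX (LD n); rewrite cos0 mul1r.
rewrite (_ : (fun n => \int[P]_w cos (D n w + 0)) =
    (fun n => expR (- (2^-1 * ip P (D n) (D n))))) in c1; last exact/funext.
rewrite Rintegral_prob_cst in c1.
have -> : (fun n => ip P (D n) (D n)) =
    (fun n => - 2 * ln (expR (- (2^-1 * ip P (D n) (D n))))).
  by apply/funext => n; rewrite expRK; field.
rewrite -[X in _ --> X](mulr0 (-2)) -(@ln1 R).
apply: cvgM; first exact: cvg_cst.
by apply: (cvg_comp _ _ c1); exact: continuous_ln.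
Qed.

Lemma ip_process_continuous h : sq_int P h -> continuous (fun v => ip P h (G v)).
Proof.
move=> lh; apply: sequentially_continuous => v u uv.
under eq_fun do rewrite ipC; rewrite ipC.
by apply: ip_cvg => //; exact: unit_process_cvg.
Qed.

Lemma variance_continuous : continuous (fun v => ip P (G v) (G v)).
Proof.
apply: sequentially_continuous => v u uv.
by apply: ip_cvg_sqr => //; exact: unit_process_cvg.
Qed.

Lemma unit_process_clampE v : G (clamp01 v) = G v.
Proof. by apply/funext => w; exact: unit_process_clamp. Qed.

Lemma variance_bounded : exists B : R, forall v, ip P (G v) (G v) <= B.
Proof.
have [|C HC] := clamp_bounded variance_continuous.
  by move=> v; rewrite unit_process_clampE.
by exists C => v; exact: le_trans (ler_norm _) (HC v).
Qed.

Definition mix mu : T -> R := bary G mu.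

Lemma sq_int_mix mu : sq_int P (mix mu).
Proof.
have [B HB] := variance_bounded.
exact: (sq_int_bary unit_process_continuous unit_process_clamp lG HB).
Qed.

Lemma ip_mix mu h : sq_int P h -> ip P h (mix mu) = \int[mu]_v ip P h (G v).
Proof.
have [B HB] := variance_bounded.
exact: (ip_bary unit_process_continuous unit_process_clamp lG HB).
Qed.

Lemma clamped_integrable mu (f : R -> R) : continuous f ->
  (forall v, f (clamp01 v) = f v) -> mu.-integrable setT (EFin \o f).
Proof.
move=> cf clf; have [C HC] := clamp_bounded cf clf.
by apply: bounded_int HC; exact: continuous_measurable_fun.
Qed.

Lemma ip_process_integrable mu h : sq_int P h ->
  mu.-integrable setT (EFin \o (fun v => ip P h (G v))).
Proof.
move=> lh; apply: clamped_integrable; first exact: ip_process_continuous.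
by move=> v; rewrite unit_process_clampE.
Qed.

Section riemann_sums.

Let m mu n k : R := \int[mu]_v (step_idx n v == k)%:R.

Let S mu n w : R := \sum_(k < n.+2) m mu n k * G (step_pt n k) w.

Let LS mu n : in_L P I X (S mu n).
Proof.
by apply: (@in_L_sum _ _ _ _ _ _ gX n.+2 (m mu n) (fun k => G (step_pt n k))) => k _;
  exact: unit_process_in_L.
Qed.

Let step_integrable mu n k (c : R) :
  mu.-integrable setT (EFin \o (fun v => (step_idx n v == k)%:R * c)).
Proof.
apply: (@bounded_int _ _ _ _ _ `|c|).
  by apply: measurable_funM => //; exact: measurable_step_idx.
by move=> v; case: (_ == _); rewrite ?mul1r// mul0r normr0.
Qed.

Let Rintegral_step mu n (phi : R -> R) :
  \int[mu]_v phi (step_pt n (step_idx n v)) = \sum_(k < n.+2) m mu n k * phi (step_pt n k).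
Proof.
under eq_Rintegral do rewrite (step_idx_sum n _ (fun k => phi (step_pt n k))).
rewrite (Rintegral_bigsum _ (fun k => step_integrable mu n k (phi (step_pt n k)))).
apply: eq_bigr => k _; rewrite RintegralZr//.
have := step_integrable mu n k 1; apply: eq_integrable => // v _ /=.
by rewrite mulr1.
Qed.

Let ip_S mu n h : sq_int P h ->
  ip P h (S mu n) = \int[mu]_v ip P h (G (step_pt n (step_idx n v))).
Proof.
move=> lh; rewrite (Rintegral_step mu n (fun v => ip P h (G v))) ipC.
rewrite (@ip_suml _ _ _ _ _ (m mu n) (fun k => G (step_pt n k)))//.
by apply: eq_bigr => k _; rewrite ipC.
Qed.

(* Riemann sums of the process converge to [mix mu] in mean square. *)
Lemma mix_in_L mu : in_L P I X (mix mu).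
Proof.
have lZ := sq_int_mix mu; have lS n := in_L_sq_int gX (LS mu n).
apply: (in_L_cvg gX (LS mu)) => //.
pose phi s v := ip P (fun w => G s w - G v w) (fun w => G s w - G v w).
pose E n v := phi (step_pt n (step_idx n v)) v.
have [B HB] := variance_bounded.
have phiE s v : phi s v = ip P (G s) (G s) - 2 * ip P (G s) (G v) + ip P (G v) (G v).
  by rewrite /phi ip_sqrB.
have cphi s : continuous (phi s).
  have -> : phi s = fun v => ip P (G s) (G s) - 2 * ip P (G s) (G v) + ip P (G v) (G v).
    by apply/funext => v; exact: phiE.
  move=> v; apply: cvgD; last exact: variance_continuous.
  apply: cvgB; first exact: cvg_cst.
  by apply: cvgM; [exact: cvg_cst|exact: ip_process_continuous].
have phi_le s v : phi s v <= 4 * B.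
  apply: (le_trans (ip_sqrB_le (lG s) (lG v))).
  rewrite (_ : 4 * B = 2 * B + 2 * B); last by rewrite -mulrDl -natrD.
  by rewrite lerD// ler_pM2l.
have phi0 s v : 0 <= phi s v by exact: ip_ge0.
have mE n : measurable_fun setT (E n).
  rewrite /E; under eq_fun do rewrite (step_idx_sum n _ (fun k => phi (step_pt n k) _)).
  apply: measurable_sum => k; apply: measurable_funM; first exact: measurable_step_idx.
  exact: continuous_measurable_fun.
have bE n v : `|E n v| <= 4 * B by rewrite ger0_norm ?phi_le ?phi0.
have iE n : mu.-integrable setT (EFin \o E n) by exact: bounded_int (bE n).
have cE : \int[mu]_v E n v @[n --> \oo] --> 0.
  rewrite -(Rintegral_prob_cst mu 0); apply: (@Rintegral_bdct _ _ _ _ _ _ (4 * B)) => // v.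
  rewrite /E /phi -unit_process_clampE.
  apply: unit_process_cvg.
  by apply: cvgn_dist_le (@cvg_harmonic R) => n; exact: step_pt_dist.
apply: (cvgn_dist_le _ cE) => n; rewrite subr0 ger0_norm ?ip_ge0//.
set D := fun w => S mu n w - mix mu w.
have lD : sq_int P D by exact: sq_intB.
have iDs : mu.-integrable setT (EFin \o (fun v => ip P D (G (step_pt n (step_idx n v))))).
  have := integrable_bigsum n.+2 (fun k => step_integrable mu n k (ip P D (G (step_pt n k)))).
  apply: eq_integrable => // v _ /=.
  by rewrite -(step_idx_sum n v (fun k => ip P D (G (step_pt n k)))).
have e : ip P D D = \int[mu]_v ip P D (fun w => G (step_pt n (step_idx n v)) w - G v w).
  rewrite {2}/D ipBr// ip_S// ip_mix// -RintegralB//.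
    by apply: eq_Rintegral => v _; rewrite ipBr.
  exact: ip_process_integrable.
have iDE : mu.-integrable setT (EFin \o
    (fun v => ip P D (fun w => G (step_pt n (step_idx n v)) w - G v w))).
  have := integrable_sub iDs (ip_process_integrable mu lD).
  by apply: eq_integrable => // v _ /=; rewrite ipBr.
(* The inequality [2 <D, U> <= <D, D> + <U, U>], with U the increment from time v to its grid point,
   is averaged over v. By [e] the left side becomes [2 <D, D>], and one [<D, D>] cancels. *)
have : 2 * ip P D D <= ip P D D + \int[mu]_v E n v.
  rewrite {1}e -RintegralZl// -[X in X + _](Rintegral_prob_cst mu) -RintegralD//; last first.
    exact: integrable_cst.
  apply: le_Rintegral => //.
  - exact: integrable_scale.
  - by apply: integrable_add => //; exact: integrable_cst.
  - by move=> v _; apply: ip_amgm => //; exact: sq_intB.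
by rewrite mulr_natl mulr2n lerD2l.
Qed.

End riemann_sums.

Lemma prob01_fin mu (f : R -> R) : prob01 mu -> continuous f ->
  (forall v, f (clamp01 v) = f v) ->
  (\int[mu]_(v in `[0%R, 1%R]%classic) (f v)%:E)%E = (\int[mu]_v f v)%:E.
Proof.
move=> mu01 cf clf; have i := clamped_integrable mu cf clf.
rewrite Rintegral_EFin// (negligible_integral _ measurableT i mu01) ?setTD ?setCK//.
exact: measurableC.
Qed.

Lemma prob01_eq mu (f g : R -> R) : (forall v, 0 <= v <= 1 -> f v = g v) ->
  prob01 mu -> continuous g -> (forall v, g (clamp01 v) = g v) ->
  (\int[mu]_(v in `[0%R, 1%R]%classic) (f v)%:E)%E = (\int[mu]_v g v)%:E.
Proof.
move=> fg mu01 cg clg; rewrite -prob01_fin//.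
by apply: eq_integral => v; rewrite inE/= in_itv/= => /fg ->.
Qed.

Lemma covX_unit s v : I s -> 0 <= v <= 1 ->
  covX P X s (aff a b v) = ip P (X s) (G v).
Proof.
by move=> Is v01; rewrite (covXE gX)//; [rewrite unit_processE|exact: aff_in].
Qed.

Lemma covint_mix mu s : prob01 mu -> I s -> covint P X a b mu s = (ip P (X s) (mix mu))%:E.
Proof.
move=> mu01 Is; rewrite ip_mix; last exact: (process_sq_int gX).
apply: prob01_eq => //.
- by move=> v v01; rewrite covX_unit.
- by apply: ip_process_continuous; exact: (process_sq_int gX).
- by move=> v; rewrite unit_process_clampE.
Qed.

(** The potential of mu for the covariance kernel; its mu-average is the energy of mu. *)
Definition potential mu v : R := ip P (G v) (mix mu).

Lemma inner_integral mu v : prob01 mu -> 0 <= v <= 1 ->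
  (\int[mu]_(u in `[0%R, 1%R]%classic) (covX P X (aff a b u) (aff a b v))%:E)%E =
  (potential mu v)%:E.
Proof.
move=> mu01 v01; rewrite /potential unit_processE// -covint_mix//; last exact: aff_in.
apply: eq_integral => u; rewrite inE/= in_itv/= => u01.
by rewrite (covXE gX) 1?ipC ?(covXE gX)//; exact: aff_in.
Qed.

Lemma DI_mix mu : prob01 mu -> DI P X a b mu = (ip P (mix mu) (mix mu))%:E.
Proof.
move=> mu01; rewrite ip_mix; last exact: sq_int_mix.
rewrite /DI -prob01_fin//.
- apply: eq_integral => u; rewrite inE/= in_itv/= => u01.
  rewrite ipC unit_processE// -covint_mix//; exact: aff_in.
- by apply: ip_process_continuous; exact: sq_int_mix.
- by move=> v; rewrite unit_process_clampE.
Qed.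

Lemma Xint_mix mu w : prob01 mu -> Xint X a b mu w = mix mu w.
Proof.
move=> mu01; rewrite /Xint.
rewrite (@prob01_eq mu _ (G ^~ w))//.
- by move=> v v01; rewrite unit_processE.
- exact: unit_process_continuous.
- by move=> v; rewrite unit_process_clampE.
Qed.

Lemma potential_continuous mu : continuous (potential mu).
Proof.
have -> : potential mu = fun v => ip P (mix mu) (G v).
  by apply/funext => v; rewrite /potential ipC.
by apply: ip_process_continuous; exact: sq_int_mix.
Qed.

Lemma potential_clamp mu v : potential mu (clamp01 v) = potential mu v.
Proof. by rewrite /potential unit_process_clampE. Qed.

Lemma ip_mix_potential mu nu : ip P (mix mu) (mix nu) = \int[mu]_v potential nu v.
Proof.
rewrite ipC ip_mix; last exact: sq_int_mix.
by apply: eq_Rintegral => v _; rewrite ipC.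
Qed.

Lemma potential_integrable mu nu : mu.-integrable setT (EFin \o potential nu).
Proof.
by apply: clamped_integrable; [exact: potential_continuous|exact: potential_clamp].
Qed.

(** * Minimizers of the energy *)

Notation D mu := (ip P (mix mu) (mix mu)).
Let W := Wab P X a b.

Let lM mu : sq_int P (mix mu). Proof. exact: sq_int_mix. Qed.

Lemma WabE mu : prob01 mu ->
  W mu <-> (forall nu, prob01 nu -> D mu <= D nu).
Proof.
move=> mu01; split=> [[_ h] nu nu01|h].
  by have := h nu nu01; rewrite !DI_mix// lee_fin.
by split=> // nu nu01; rewrite !DI_mix// lee_fin h.
Qed.

Lemma measurable_potential mu : measurable_fun setT (potential mu).
Proof. by apply: continuous_measurable_fun; exact: potential_continuous. Qed.

Lemma le_ip_mix mu nu c : (forall v, c <= potential nu v) -> c <= ip P (mix mu) (mix nu).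
Proof.
move=> h; rewrite ip_mix_potential -(Rintegral_prob_cst mu c).
apply: le_Rintegral => //; last exact: potential_integrable.
exact: integrable_cst.
Qed.

Lemma process_path_bounded w : exists B : R, forall v, `|G v w| <= B.
Proof.
apply: (clamp_bounded (@unit_process_continuous w)).
by move=> v; rewrite unit_process_clamp.
Qed.

Lemma mix_mixture mu nu (rho : probability R R) (l : R) : 0 <= l <= 1 ->
  (forall A, measurable A -> rho A = (l%:E * mu A + (1 - l)%:E * nu A)%E) ->
  forall w, mix rho w = l * mix mu w + (1 - l) * mix nu w.
Proof.
move=> l01 rhoE w; have [B HB] := process_path_bounded w.
apply: (mixture_Rintegral (B := B) l01 rhoE _ HB).
by apply: continuous_measurable_fun; exact: unit_process_continuous.
Qed.

Lemma mix_dirac v w : mix (\d_v : probability R R) w = G v w.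
Proof.
rewrite /mix /bary Rintegral_dirac//; apply: continuous_measurable_fun; exact: unit_process_continuous.
Qed.

Lemma mixture_prob01 mu nu (rho : probability R R) (l : R) :
  (forall A, measurable A -> rho A = (l%:E * mu A + (1 - l)%:E * nu A)%E) ->
  prob01 mu -> prob01 nu -> prob01 rho.
Proof.
move=> rhoE mu01 nu01; rewrite /prob01 rhoE; last exact: measurableC.
by rewrite mu01 nu01 !mule0 adde0.
Qed.

Lemma ip_comb f g (l m : R) : sq_int P f -> sq_int P g ->
  ip P (fun w => l * f w + m * g w) (fun w => l * f w + m * g w) =
  l ^+ 2 * ip P f f + 2 * (l * m) * ip P f g + m ^+ 2 * ip P g g.
Proof.
move=> lf lg; rewrite ip_sqrD ?ipZl ?ipZr//; try exact: sq_intZ.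
by ring.
Qed.

(** First order optimality. Moving a mass e to the Dirac mass at u changes the energy by
    [e (- 2 dl + e q)], where [dl] is the deficit [D mu - potential mu u] and q the squared distance
    from [mix mu] to [G u]. *)
Lemma Wab_potential_ge mu v : W mu -> D mu <= potential mu v.
Proof.
move=> Wmu; have mu01 : prob01 mu by case: Wmu.
rewrite -potential_clamp; set u := clamp01 v.
have u01 : 0 <= u <= 1 by exact: clamp01_itv.
set q := ip P (fun w => mix mu w - G u w) (fun w => mix mu w - G u w).
have q0 : 0 <= q by exact: ip_ge0.
have qE : q = D mu - 2 * potential mu u + ip P (G u) (G u).
  by rewrite /q ip_sqrB// /potential (ipC P (G u)).
rewrite leNgt; apply/negP; rewrite -subr_gt0; set dl := _ - _ => dl0.
have var e : 0 <= e <= 1 -> 0 <= e * (- (2 * dl) + e * q).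
  move=> e01.
  have e01' : 0 <= 1 - e <= 1 by case/andP: e01 => e0 e1; rewrite subr_ge0 e1 lerBlDr lerDl.
  have [rho rhoE] := mixture_exists mu (\d_u : probability R R) e01'.
  have d01 : prob01 (\d_u : probability R R).
    by rewrite /prob01 /= diracE memNset//= in_itv/= u01.
  have rho01 := mixture_prob01 rhoE mu01 d01.
  have := (WabE mu01).1 Wmu rho rho01.
  have -> : mix rho = fun w => (1 - e) * mix mu w + e * G u w.
    by apply/funext => w; rewrite (mix_mixture e01' rhoE) mix_dirac subKr.
  rewrite ip_comb// (ipC P _ (G u)) -/(potential mu u) -subr_ge0.
  by congr (0 <= _); rewrite qE /dl; ring.
have dq : 0 < dl + q by rewrite ltr_pwDl.
(* This e lies in [0, 1] and satisfies [e q <= dl], so [- 2 dl + e q] is at most [- dl < 0], a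
   contradiction. *)
have := var (dl / (dl + q)); rewrite divr_ge0 ?(ltW dl0) ?(ltW dq)// ler_pdivrMr// mul1r lerDl q0.
move=> /(_ isT); rewrite pmulr_rge0 ?divr_gt0//.
have : dl / (dl + q) * q <= dl.
  by rewrite mulrAC ler_pdivrMr// ler_pM2l// lerDr ltW.
move=> h1; rewrite addrC subr_ge0 => /le_trans/(_ h1).
by rewrite mulr_natl mulr2n gerDl leNgt dl0.
Qed.

(** Averaging the hypothesis over nu bounds the cross product of the two mixtures below by [D mu],
    and twice this product is at most [D nu + D mu]. *)
Lemma potential_ge_Wab mu : prob01 mu -> (forall v, D mu <= potential mu v) -> W mu.
Proof.
move=> mu01 h; apply/WabE => // nu nu01.
have := le_ip_mix nu h; have := ip_amgm (lM nu) (lM mu).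
by lra.
Qed.

(** The minimum of the potential is at most its mu-average, which is the energy. *)
Lemma Wab_potential_eq mu : W mu -> exists2 v, 0 <= v <= 1 & potential mu v = D mu.
Proof.
move=> Wmu.
have [v v01 hv] : exists2 v, v \in `[0, 1] & forall u, u \in `[0, 1] -> potential mu v <= potential mu u.
  by apply: EVT_min => //; exact/continuous_subspaceT/potential_continuous.
have v01' : 0 <= v <= 1 by move: v01; rewrite in_itv.
exists v => //; apply/eqP; rewrite eq_le Wab_potential_ge// andbT.
apply: le_ip_mix => u; rewrite -(potential_clamp _ u); apply: hv.
by rewrite in_itv/=; exact: clamp01_itv.
Qed.

Lemma Wab_charact mu : prob01 mu ->
  (W mu <-> ((forall v, 0 <= v <= 1 ->
            (DI P X a b mu <= \int[mu]_(u in `[0%R, 1%R]%classic)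
                                 (covX P X (aff a b u) (aff a b v))%:E)%E) /\
         exists2 v, 0 <= v <= 1 &
            (\int[mu]_(u in `[0%R, 1%R]%classic)
                (covX P X (aff a b u) (aff a b v))%:E)%E = DI P X a b mu)).
Proof.
move=> mu01; rewrite DI_mix//; split => [Wmu|[h _]].
  split=> [v v01|]; first by rewrite inner_integral// lee_fin Wab_potential_ge.
  by have [v v01 e] := Wab_potential_eq Wmu; exists v => //; rewrite inner_integral// e.
apply: potential_ge_Wab => // v; rewrite -potential_clamp.
by have := h _ (clamp01_itv v); rewrite inner_integral ?lee_fin//; exact: clamp01_itv.
Qed.

(** The cross product of the mixtures is at least the common energy, so their squared distance,
    twice the energy minus twice that product, cannot be positive. *)
Lemma Wab_ip_eq mu nu : W mu -> W nu ->
  D mu = D nu /\ ip P (fun w => mix mu w - mix nu w) (fun w => mix mu w - mix nu w) = 0.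
Proof.
move=> Wmu Wnu; have [mu01 _] := Wmu; have [nu01 _] := Wnu.
have e : D mu = D nu.
  apply/eqP; rewrite eq_le; apply/andP; split.
    exact: (WabE mu01).1.
  exact: (WabE nu01).1.
split => //; apply/eqP; rewrite eq_le ip_ge0 andbT ip_sqrB//.
have := le_ip_mix nu (fun v => Wab_potential_ge v Wmu).
by rewrite ipC -e; lra.
Qed.

Lemma Wab_mix_ae mu nu : W mu -> W nu -> {ae P, forall w, mix mu w = mix nu w}.
Proof.
move=> Wmu Wnu; have [_ /(ip_eq0 (sq_intB (lM mu) (lM nu)))] := Wab_ip_eq Wmu Wnu.
by apply: filterS => w /eqP; rewrite subr_eq0 => /eqP.
Qed.

(** The potential is affine in the measure and the energy is convex, so the inequality
    [D mu <= potential mu v] survives mixing two minimizers, whose energies agree. *)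
Lemma Wab_convex : convex_meas W.
Proof.
move=> mu1 mu2 mu l W1 W2 l01 muE.
have [mu1p _] := W1; have [mu2p _] := W2.
have mu01 := mixture_prob01 muE mu1p mu2p.
have [e _] := Wab_ip_eq W1 W2.
have mixE : mix mu = fun w => l * mix mu1 w + (1 - l) * mix mu2 w.
  by apply/funext => w; exact: mix_mixture.
have /andP[l0 l1] := l01.
apply: potential_ge_Wab => // v.
have := Wab_potential_ge v W1; have := Wab_potential_ge v W2; rewrite -e.
rewrite mixE ip_comb// -e => h2 h1.
have -> : potential mu v = l * potential mu1 v + (1 - l) * potential mu2 v.
  by rewrite /potential mixE ipDr ?ipZr//; exact: sq_intZ.
have := ip_amgm (lM mu1) (lM mu2); rewrite -e => h3.
have l1' : 0 <= 1 - l by rewrite subr_ge0.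
have := ler_wpM2l l0 h1; have := ler_wpM2l l1' h2.
have := ler_wpM2l (mulr_ge0 l0 l1') h3.
by nra.
Qed.

Lemma weak_cvg01_of_clamped (mus : nat -> probability R R) mu :
  (forall n, prob01 (mus n)) -> prob01 mu ->
  (forall f : R -> R, continuous f -> (forall v, f (clamp01 v) = f v) ->
    \int[mus n]_v f v @[n --> \oo] --> \int[mu]_v f v) -> weak_cvg01 mus mu.
Proof.
move=> mus01 mu01 h f cf.
pose g := f \o clamp01.
have cg : continuous g.
  have /subspace_continuousP cf' := cf.
  move=> v; apply: cvg_comp (cf' (clamp01 v) _) => [A /= hA|]; last first.
    by rewrite /= in_itv/=; exact: clamp01_itv.
  have hn : \forall u \near v, `[0, 1]%classic (clamp01 u) -> A (clamp01 u).
    exact: (continuous_clamp01 hA).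
  by apply: filterS hn => u; apply; rewrite /= in_itv/=; exact: clamp01_itv.
have gc v : g (clamp01 v) = g v by rewrite /g/= clamp01K.
have e (nu : probability R R) : prob01 nu ->
    (\int[nu]_(x in `[0%R, 1%R]%classic) (f x)%:E)%E = (\int[nu]_v g v)%:E.
  by move=> nu01; apply: prob01_eq => // v v01; rewrite /g/= clamp01_id.
rewrite e// (_ : (fun n => _) = fun n => (\int[mus n]_v g v)%:E).
  by apply: cvg_EFin; [exact: nearW|exact: h].
by apply/funext => n; exact: e.
Qed.

(** The energy lies above its tangent: [D mu_n] is at least twice the cross product of [mu_n] and
    mu, minus [D mu]. That product is the integral of a fixed continuous function against [mu_n], so
    no convergence of product measures is involved. *)
Lemma DI_lsc (mus : nat -> probability R R) mu (c : R) :
  (forall f : R -> R, continuous f -> (forall v, f (clamp01 v) = f v) ->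
    \int[mus n]_v f v @[n --> \oo] --> \int[mu]_v f v) ->
  (D (mus n) : R) @[n --> \oo] --> c -> D mu <= c.
Proof.
move=> h hc.
have h1 : 2 * ip P (mix (mus n)) (mix mu) - D mu @[n --> \oo] --> 2 * D mu - D mu.
  apply: cvgB; last exact: cvg_cst.
  apply: cvgM; first exact: cvg_cst.
  rewrite ip_mix_potential; under eq_fun do rewrite ip_mix_potential.
  by apply: h; [exact: potential_continuous|exact: potential_clamp].
have -> : D mu = 2 * D mu - D mu by ring.
apply: (ler_cvg_to h1 hc); apply: nearW => n.
by have := ip_amgm (lM (mus n)) (lM mu); lra.
Qed.

Lemma minimizer_exists : exists mu0 : probability R R, W mu0.
Proof.
pose S := [set D mu | mu in [set mu : probability R R | prob01 mu]].
have Snonempty : S !=set0.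
  exists (D (\d_(0 : R) : probability R R)); exists (\d_(0 : R) : probability R R) => //.
  by rewrite /= /prob01/= diracE memNset//= in_itv/= lexx ler01.
have Slb : has_lbound S by exists 0 => _ [mu _ <-]; exact: ip_ge0.
pose m := inf S.
have ex n : exists mu : probability R R, prob01 mu /\ D mu < m + n.+1%:R^-1.
  have [||_ [mu mu01 <-] h] := @inf_adherent R S n.+1%:R^-1.
  - by rewrite invr_gt0.
  - by split.
  - by exists mu.
have [mus hmus] := choice ex.
have [phi [mu [phi_incr mu01 h]]] := prob01_weak_compactness (fun n => (hmus n).1).
exists mu; apply/WabE => // nu nu01.
have Dm : D mu <= m.
  apply: (@DI_lsc (mus \o phi)); first exact: h.
  apply: (cvgn_dist_le _ (@cvg_harmonic R)) => n /=.
  have ml : m <= D (mus (phi n)).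
    by apply: ge_inf => //; exists (mus (phi n)) => //; exact: (hmus (phi n)).1.
  rewrite ger0_norm ?subr_ge0// lerBlDl; apply: le_trans (ltW (hmus (phi n)).2) _.
  rewrite lerD2l /harmonic lef_pV2 ?posrE// ler_nat ltnS.
  (* A strictly increasing [phi] satisfies [n <= phi n], so the error along the subsequence is still
     at most [1 / (n+1)]. *)
  by elim: n {ml} => // n IHn; exact: leq_ltn_trans IHn (phi_incr n).
by apply: le_trans Dm _; apply: ge_inf => //; exists nu.
Qed.

(** The energy is constant along a sequence of minimizers, and lower semicontinuity hands this bound
    to the limit. *)
Lemma Wab_weakly_compact : weakly_compact01 W.
Proof.
move=> mus Wmus; have mus01 n : prob01 (mus n) by case: (Wmus n).
have [phi [mu [phi_incr mu01 h]]] := prob01_weak_compactness mus01.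
exists phi, mu; split => //; split.
  apply/WabE => // nu nu01.
  apply: le_trans ((WabE (mus01 0%N)).1 (Wmus 0%N) nu nu01).
  apply: (DI_lsc h); rewrite (_ : (fun n => _) = fun=> D (mus 0%N)); first exact: cvg_cst.
  by apply/funext => n; have [-> _] := Wab_ip_eq (Wmus (phi n)) (Wmus 0%N).
by apply: weak_cvg01_of_clamped => // n; exact: mus01.
Qed.

(** * The infimum problem over the closed span *)

Lemma feasibleHE H : feasibleH P I X a b H <->
  in_L P I X H /\ forall v, 1 <= ip P (G v) H.
Proof.
have e v : in_L P I X H -> 0 <= v <= 1 ->
    ('E_P[fun w => (X (aff a b v) w * H w)%R] = (ip P (G v) H)%:E)%E.
  move=> LH v01; rewrite expectationE -Rintegral_EFin ?unit_processE//; apply: sq_int_mul.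
    by apply: (process_sq_int gX); exact: aff_in.
  exact: (in_L_sq_int gX LH).
split=> [[LH h]|[LH h]]; split=> // v.
  have v01 := clamp01_itv v; have := h _ v01.
  by rewrite e// lee_fin unit_process_clampE.
by move=> v01; rewrite e// lee_fin.
Qed.

Lemma feasible_ip_mix mu H : feasibleH P I X a b H -> 1 <= ip P (mix mu) H.
Proof.
case/feasibleHE => LH h; have lH := in_L_sq_int gX LH.
rewrite ipC ip_mix// -(Rintegral_prob_cst mu 1).
apply: le_Rintegral => //.
- exact: integrable_cst.
- exact: ip_process_integrable.
- by move=> v _; rewrite ipC.
Qed.

(** Cauchy-Schwarz: the cross product of [mix mu] with H is at least 1, so neither factor
    vanishes. *)
Lemma feasible_energy_gt0 mu H : feasibleH P I X a b H -> 0 < D mu.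
Proof.
move=> fH; have h := feasible_ip_mix mu fH.
have lH : sq_int P H by case/feasibleHE: fH => /(in_L_sq_int gX).
rewrite lt_neqAle ip_ge0 andbT; apply/negP => /eqP D0.
have := ip_cauchy_schwarz (lM mu) lH; rewrite -D0 mul0r leNgt => /negP; apply.
by rewrite exprn_gt0// (lt_le_trans ltr01).
Qed.

Section positive_energy.
Variable mu0 : probability R R.
Hypothesis W0 : W mu0.
Let m := D mu0.
Hypothesis m0 : 0 < m.

Definition optimal_H w : R := m^-1 * mix mu0 w.

Let lH0 : sq_int P optimal_H. Proof. exact: sq_intZ. Qed.

Lemma optimal_H_feasible : feasibleH P I X a b optimal_H.
Proof.
apply/feasibleHE; split; first exact/(in_LZ gX)/mix_in_L.
by move=> v; rewrite ipZr// -/(potential mu0 v) mulrC ler_pdivlMr// mul1r Wab_potential_ge.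
Qed.

Lemma optimal_H_sqr : ip P optimal_H optimal_H = m^-1.
Proof.
by rewrite ipZr// ipZl// -/m mulVf ?mulr1// gt_eqF.
Qed.

(** The product of a feasible H with [optimal_H] is at least 1/m, the squared norm of [optimal_H].
    This single estimate yields both the value of the infimum and the uniqueness. *)
Lemma feasible_dist H : feasibleH P I X a b H ->
  ip P (fun w => H w - optimal_H w) (fun w => H w - optimal_H w) <= ip P H H - m^-1.
Proof.
move=> fH; have lH : sq_int P H by case/feasibleHE: fH => /(in_L_sq_int gX).
rewrite ip_sqrB// optimal_H_sqr.
have : m^-1 <= ip P H optimal_H.
  by rewrite ipZr// ler_peMr ?invr_ge0 ?(ltW m0)// ipC feasible_ip_mix.
by lra.
Qed.

Lemma CX_positive : CX P I X a b = (m^-1)%:E.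
Proof.
apply/eqP; rewrite eq_le; apply/andP; split.
  apply: ereal_inf_lbound; exists optimal_H; first exact: optimal_H_feasible.
  by rewrite expectationE expectation_sqr// optimal_H_sqr.
apply: le_ereal_inf_tmp => _ [H fH <-].
have lH : sq_int P H by case/feasibleHE: fH => /(in_L_sq_int gX).
rewrite expectationE expectation_sqr// lee_fin.
have := feasible_dist fH.
have := ip_ge0 P (fun w => H w - optimal_H w).
by lra.
Qed.

Lemma optimal_H_unique H : feasibleH P I X a b H ->
  ('E_P[fun w => (H w ^+ 2)%R] = CX P I X a b)%E -> {ae P, forall w, H w = optimal_H w}.
Proof.
move=> fH; have lH : sq_int P H by case/feasibleHE: fH => /(in_L_sq_int gX).
rewrite expectationE expectation_sqr// CX_positive => -[e].
have := feasible_dist fH; rewrite e subrr => h.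
have /(ip_eq0 (sq_intB lH lH0)) : ip P (fun w => H w - optimal_H w) (fun w => H w - optimal_H w) = 0.
  by apply/eqP; rewrite eq_le h ip_ge0.
by apply: filterS => w /eqP; rewrite subr_eq0 => /eqP.
Qed.

Lemma optimal_H_mix mu : W mu -> {ae P, forall w, optimal_H w = fine (CX P I X a b) * Xint X a b mu w}.
Proof.
move=> Wmu; have := Wab_mix_ae W0 Wmu; apply: filterS => w h.
by rewrite CX_positive/= Xint_mix; [rewrite /optimal_H h|case: Wmu].
Qed.

End positive_energy.

(** At zero energy nothing is feasible, and the infimum of the empty set agrees with
    [einv 0 = +oo]. *)
Lemma CX_einv mu0 : W mu0 -> CX P I X a b = einv (DI P X a b mu0).
Proof.
move=> W0; have mu01 : prob01 mu0 by case: W0.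
rewrite DI_mix// /einv; case: eqVneq => [D0|D0]; last first.
  by apply: CX_positive => //; rewrite lt_neqAle eq_sym D0 ip_ge0.
rewrite /CX (_ : [set _ | _ in _] = set0) ?ereal_inf0//.
apply/seteqP; split => // y [H fH _].
by have := feasible_energy_gt0 mu0 fH; rewrite D0 ltxx.
Qed.

Lemma feasible_solution : (exists H, feasibleH P I X a b H) ->
  (forall mu, W mu -> (0 < DI P X a b mu)%E) /\
  exists H : T -> R,
     [/\ feasibleH P I X a b H,
         ('E_P[fun w => (H w ^+ 2)%R])%E = CX P I X a b,
         (forall H', feasibleH P I X a b H' ->
            ('E_P[fun w => (H' w ^+ 2)%R])%E = CX P I X a b ->
            {ae P, forall w, H' w = H w}) &
         (forall mu, W mu ->
            {ae P, forall w, H w = fine (CX P I X a b) * Xint X a b mu w})].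
Proof.
move=> [H fH]; split=> [mu Wmu|].
  by rewrite DI_mix ?lte_fin ?(feasible_energy_gt0 mu fH)//; case: Wmu.
have [mu0 W0] := minimizer_exists.
have m0 := feasible_energy_gt0 mu0 fH.
exists (optimal_H mu0); split.
- exact: optimal_H_feasible.
- by rewrite expectationE expectation_sqr ?optimal_H_sqr ?(CX_positive W0)//; exact: sq_intZ.
- by move=> H' fH'; exact: optimal_H_unique.
- by move=> mu; exact: optimal_H_mix.
Qed.

(** * The exceedance event *)

Lemma measurable_gt (Z : T -> R) u : measurable_fun setT Z -> measurable [set w | u < Z w].
Proof.
move=> mZ; rewrite (_ : mkset _ = Z @^-1` `]u, +oo[%classic).
  by rewrite -[X in measurable X]setTI; exact: mZ.
by apply/seteqP; split => w /=; rewrite in_itv/= andbT.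
Qed.

Lemma measurable_ge (Z : T -> R) u : measurable_fun setT Z -> measurable [set w | u <= Z w].
Proof.
move=> mZ; rewrite (_ : mkset _ = Z @^-1` `[u, +oo[%classic).
  by rewrite -[X in measurable X]setTI; exact: mZ.
by apply/seteqP; split => w /=; rewrite in_itv/= andbT.
Qed.

Lemma aff_surj t : a <= t <= b -> exists2 v, 0 <= v <= 1 & t = aff a b v.
Proof.
move=> /andP[at_ tb]; have ba : 0 < b - a by rewrite subr_gt0.
exists ((t - a) / (b - a)).
  by rewrite divr_ge0 ?subr_ge0 ?(ltW ab)//= ler_pdivrMr// mul1r lerB.
by rewrite /aff mulrC divfK ?gt_eqF// addrC subrK.
Qed.

Lemma exceedE u w : exceed X a b u w <-> forall v, u < G v w.
Proof.
split=> [h v|h t /aff_surj[v v01 ->]]; last by rewrite -unit_processE.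
by apply: h; exact/aff_itv/clamp01_itv.
Qed.

Lemma path_min w : exists2 v, 0 <= v <= 1 & forall u, G v w <= G u w.
Proof.
have [v v01 hv] : exists2 v, v \in `[0, 1] & forall u, u \in `[0, 1] -> G v w <= G u w.
  by apply: EVT_min => //; exact/continuous_subspaceT/unit_process_continuous.
exists v; first by move: v01; rewrite in_itv.
move=> u; rewrite -(unit_process_clamp u); apply: hv.
by rewrite in_itv/=; exact: clamp01_itv.
Qed.

(** A continuous path attains its minimum, so exceeding u strictly means exceeding it by some
    [1 / (n+1)], which can be tested at rational points. *)
Lemma measurable_exceed u : measurable (exceed X a b u).
Proof.
rewrite (_ : exceed X a b u =
  \bigcup_n \bigcap_q [set w | u + n.+1%:R^-1 <= G (rat_point q) w]).
  apply: bigcupT_measurable => n; apply: bigcapT_measurable => q.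
  by apply: measurable_ge; case: (lG (rat_point q)).
apply/seteqP; split => w.
  move=> /exceedE h; have [v _ hv] := path_min w.
  have d0 : 0 < G v w - u by rewrite subr_gt0.
  have [n _ hn] := near_infty_natSinv_lt (PosNum d0).
  exists n => // q _ /=; apply: le_trans (hv (rat_point q)).
  by have := hn _ (leqnn n); rewrite /= -lerBrDl => /ltW.
move=> [n _ h]; apply/exceedE => v.
have n0 : 0 < n.+1%:R^-1 :> R by rewrite invr_gt0.
apply: (@lt_le_trans _ _ (u + n.+1%:R^-1)); first by rewrite ltrDl.
rewrite -lerN2; apply: (dense_rat_le (g := fun v => - G v w)) => [x|q].
  by apply: cvgN; exact: unit_process_continuous.
by rewrite lerN2; exact: h.
Qed.

(** Going through the minimum of the path keeps the inequality strict. *)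
Lemma exceed_mix mu u w : exceed X a b u w -> u < mix mu w.
Proof.
move=> /exceedE h; have [v _ hv] := path_min w; apply: lt_le_trans (h v) _.
rewrite /mix /bary -[leLHS](Rintegral_prob_cst mu); apply: le_Rintegral => //.
  exact: integrable_cst.
by apply: clamped_integrable; [exact: unit_process_continuous|move=> x; exact: unit_process_clamp].
Qed.

(** * Large deviations *)

Section large_deviations.
Variable mu0 : probability R R.
Hypothesis W0 : W mu0.
Let m := D mu0.
Hypothesis m0 : 0 < m.
Let Z := mix mu0.

Let LZ : in_L P I X Z. Proof. exact: mix_in_L. Qed.
Let lZ : sq_int P Z. Proof. exact: lM. Qed.
Let mZ : measurable_fun setT Z. Proof. by case: lZ. Qed.

Definition limit_path v := m^-1 * potential mu0 v.
Notation x := limit_path.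

Let x_ge1 v : 1 <= x v.
Proof. by rewrite /x mulrC ler_pdivlMr// mul1r Wab_potential_ge. Qed.

Lemma limit_path_continuous : continuous x.
Proof. by move=> v; apply: cvgM; [exact: cvg_cst|exact: potential_continuous]. Qed.

Let x_clamp v : x (clamp01 v) = x v.
Proof. by rewrite /x potential_clamp. Qed.

(** [limit_path v] is the regression coefficient of [G v] on [Z], which makes the residual
    orthogonal to [Z]. *)
Definition residual v w := G v w - x v * Z w.
Notation Y := residual.

Let LY v : in_L P I X (Y v).
Proof. by apply: (in_LB gX); [exact: unit_process_in_L|exact: (in_LZ gX)]. Qed.

Let ZY v : ip P Z (Y v) = 0.
Proof.
rewrite ipBr//; last exact: sq_intZ.
by rewrite ipZr// ipC -/(potential mu0 v) /x -mulrA (mulrC (potential _ _)) mulKf ?subrr// gt_eqF.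
Qed.

Let Y_continuous w : continuous (Y ^~ w).
Proof.
move=> v; apply: cvgB; first exact: unit_process_continuous.
by apply: cvgM; [exact: limit_path_continuous|exact: cvg_cst].
Qed.

(** Even indices list Y and odd ones [- Y] at the same rational: the family is closed under
    negation, as the tail estimate requires, and its constant orthants are the events that [|Y|]
    stays below K. *)
Definition residual_seq (j : nat) w :=
  (-1) ^+ odd j * Y (rat_point j./2) w.
Notation V := residual_seq.

Let LV j : in_L P I X (V j). Proof. exact: (in_LZ gX). Qed.

Let symV j : exists k, forall w, V k w = - V j w.
Proof.
exists (if odd j then j.-1 else j.+1) => w; rewrite /V; case: ifPn => jo.
  case: j jo => // j /= jo; rewrite (negbTE jo) expr1 mulN1r opprK mul1r.
  by rewrite uphalf_half (negbTE jo).
by rewrite /= jo expr1 mulN1r uphalf_half (negbTE jo) mul1r.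
Qed.

Lemma residual_seqE K w : orthant V (cst K) w <-> forall v, `|Y v w| <= K.
Proof.
split=> [h v|h j]; last first.
  rewrite /V; apply: le_trans (h (rat_point j./2)).
  apply: le_trans (ler_norm _) _; rewrite normrM.
  by case: odd; rewrite ?expr1 ?normrN1 ?expr0 ?normr1 mul1r.
have key (e : bool) : (-1) ^+ e * Y v w <= K.
  apply: (dense_rat_le (g := fun v => (-1) ^+ e * Y v w)) => [y|q].
    by apply: cvgM; [exact: cvg_cst|exact: Y_continuous].
  have := h (e + q.*2)%N.
  rewrite /V halfD odd_double andbF add0n doubleK (_ : e./2 = 0%N) ?add0n; last by case: e.
  by rewrite oddD odd_double addbF oddb.
rewrite ler_norml; have := key true; have := key false.
by rewrite expr0 expr1 mul1r mulN1r lerNl => -> ->.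
Qed.

Let bV w : exists B : R, forall j, V j w <= B.
Proof.
have [B HB] : exists B : R, forall v, `|Y v w| <= B.
  apply: (clamp_bounded (@Y_continuous w)) => v.
  by rewrite /Y unit_process_clamp x_clamp.
by exists B; exact/residual_seqE.
Qed.

Notation A K := (orthant V (cst K)).

Let mA K : measurable (A K).
Proof. by apply: measurable_orthant => j; case: (LV j). Qed.

Let prob_fin C : measurable C -> P C = (fine (P C))%:E.
Proof. by move=> mC; rewrite fineK// fin_num_measure. Qed.

Let prob_split C u : measurable C ->
  fine (P (C `&` [set w | u < Z w])) = fine (P C) - fine (P (C `&` [set w | Z w <= u])).
Proof.
move=> mC; have mZu := measurable_gt u mZ.
have mZu' : measurable [set w | Z w <= u].
  rewrite (_ : mkset _ = ~` [set w | u < Z w]); first exact: measurableC.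
  by apply/seteqP; split => w /=; rewrite leNgt => /negP.
apply: EFin_inj; rewrite EFinB -!prob_fin//; try exact: measurableI.
have -> : P C = (P (C `&` [set w | (u < Z w)%R]) + P (C `&` [set w | (Z w <= u)%R]))%E.
  rewrite -measureU//; try exact: measurableI.
    rewrite -setIUr (_ : _ `|` _ = setT) ?setIT//.
    by apply/seteqP; split => // w _ /=; case: (ltP u (Z w)); [left|right].
  apply/seteqP; split => // w [[_ /= h1] [_ /= h2]].
  by move: (lt_le_trans h1 h2); rewrite ltxx.
by rewrite addeK// fin_num_measure//; exact: measurableI.
Qed.

Definition mix_tail u := fine (P [set w | u < Z w]).

Lemma residual_independent K u :
  fine (P (A K `&` [set w | u < Z w])) = fine (P (A K)) * mix_tail u.
Proof.
rewrite prob_split// (independent_orthant gX LZ LV)//; last first.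
  by move=> j; rewrite /V ipZr ?ZY ?mulr0//; exact: (in_L_sq_int gX).
have := prob_split u (@measurableT _ T); rewrite !setTI => e.
by rewrite /mix_tail e [P setT]probability_setT mulrBr mulr1.
Qed.

Lemma residual_independentC K u :
  fine (P (~` A K `&` [set w | u < Z w])) = tail P V K * mix_tail u.
Proof.
have mZu := measurable_gt u mZ.
have e : mix_tail u = fine (P (A K `&` [set w | u < Z w])) + fine (P (~` A K `&` [set w | u < Z w])).
  apply: EFin_inj; rewrite EFinD -!prob_fin//; try by apply: measurableI => //; exact: measurableC.
  rewrite -measureU//; try by apply: measurableI => //; exact: measurableC.
    by rewrite -setIUl setUv setTI.
  by rewrite setIACA setICr set0I.
by rewrite /tail mulrBl mul1r -residual_independent {1}e addrAC subrr add0r.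
Qed.

Let s := Num.sqrt m.
Let s0 : s != 0. Proof. by rewrite gt_eqF// sqrtr_gt0. Qed.
Let s2 : s ^+ 2 = m. Proof. by rewrite sqr_sqrtr// ltW. Qed.

(** [in_L_cf] and [normal_cos] give equal characteristic functions, and [weighted_char_le] with
    weight 1 identifies the distribution functions. *)
Let mix_tailE u : mix_tail u = fine (normal_law s `]u, +oo[%classic).
Proof.
have mZu' : measurable [set w | Z w <= u].
  rewrite (_ : mkset _ = ~` [set w | u < Z w]); first exact/measurableC/measurable_gt.
  by apply/seteqP; split => w /=; rewrite leNgt => /negP.
have e1 := prob_split u (@measurableT _ T); rewrite !setTI [P setT]probability_setT/= in e1.
rewrite /mix_tail e1 -setCitvl probability_setC// fineB//; last by rewrite fin_num_measure.
congr (_ - _); rewrite -!Rintegral_indic//.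
have := @weighted_char_le _ _ _ _ _ P (normal_law s) (cst 1) Z (cst 1) id 1.
move=> /(_ (measurable_cst _) mZ (measurable_cst _) (@measurable_id _ _ _)) h.
have {h} : \int[P]_w (1 * (Z w <= u)%R%:R) = \int[normal_law s]_w (1 * (w <= u)%R%:R).
  apply: h; [by move=> w; rewrite normr1|by move=> w; rewrite normr1|move=> k c].
  under eq_Rintegral do rewrite mul1r; under [RHS]eq_Rintegral do rewrite mul1r.
  by rewrite (in_L_cf gX)// normal_cos// s2; congr (_ * expR (- _)); rewrite /m -/Z; ring.
under eq_Rintegral do rewrite mul1r; under [in RHS]eq_Rintegral do rewrite mul1r.
move=> h; transitivity (\int[P]_w (Z w <= u)%R%:R).
  by apply: eq_Rintegral => w _; rewrite indicE; congr ((nat_of_bool _)%:R); apply/idP/idP; rewrite inE.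
by rewrite h; apply: eq_Rintegral => w _; rewrite indicE mem_setE in_itv.
Qed.

Let k := (2 * m)^-1.

Lemma mix_tail_le u : 0 <= u -> mix_tail u <= expR (- (k * u ^+ 2)).
Proof. by move=> u0; rewrite mix_tailE /k -s2; exact: normal_tail_le. Qed.

Lemma mix_tail_ge u : 0 <= u -> normal_peak s * expR (- (k * (u + 1) ^+ 2)) <= mix_tail u.
Proof. by move=> u0; rewrite mix_tailE /k -s2; exact: normal_tail_ge. Qed.

Let kgt0 : 0 < k. Proof. by rewrite invr_gt0 mulr_gt0. Qed.

Lemma Psi_le u : 0 <= u -> Psi P X a b u <= expR (- (k * u ^+ 2)).
Proof.
move=> u0; apply: le_trans (mix_tail_le u0); rewrite fine_le ?fin_num_measure//.
- exact: measurable_exceed.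
- exact: measurable_gt.
- apply: le_measure; rewrite ?inE; [exact: measurable_exceed|exact: measurable_gt|].
  by move=> w; exact: exceed_mix.
Qed.

(** If [|Y| <= K] and [Z > u + K], then [x >= 1] and [Z >= 0] give [G v >= Z - K > u]; independence
    turns the probability of this event into a product. *)
Lemma Psi_ge : exists c L : R, [/\ 0 < c, 0 <= L &
  forall u, 0 <= u -> c * expR (- (k * (u + L) ^+ 2)) <= Psi P X a b u].
Proof.
have [K K0 tK] := tail_small LV bV.
have pA : 2^-1 <= fine (P (A K)) by move: tK; rewrite /tail; lra.
have peak0 : 0 < normal_peak s :> R by exact: normal_peak_gt0.
(* In L, K is the raise of the level and 1 comes from [normal_tail_ge]; the factor 1/2 is a lower
   bound for the probability of [A K]. *)
exists (2^-1 * normal_peak s), (K + 1); split; first by rewrite mulr_gt0.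
  by rewrite addr_ge0// ltW.
move=> u u0; have uK : 0 <= u + K by rewrite addr_ge0// ltW.
apply: (@le_trans _ _ (fine (P (A K `&` [set w | u + K < Z w])))).
  rewrite residual_independent -mulrA ler_pM//.
    by rewrite mulr_ge0 ?expR_ge0// ltW.
  by rewrite addrA; exact: mix_tail_ge.
have mI : measurable (A K `&` [set w | u + K < Z w]) by apply: measurableI => //; exact: measurable_gt.
rewrite fine_le ?fin_num_measure//; first exact: measurable_exceed.
apply: le_measure; rewrite ?inE//; first exact: measurable_exceed.
move=> w [/residual_seqE AK /= uZ]; apply/exceedE => v.
have := AK v; rewrite /Y ler_norml => /andP[h _].
have Z0 : 0 <= Z w by rewrite (le_trans uK)// ltW.
have := x_ge1 v => x1; have : Z w <= x v * Z w by rewrite ler_peMl.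
by lra.
Qed.

Let Psi_gt0 u : 0 <= u -> 0 < Psi P X a b u.
Proof.
move=> u0; have [c [L [c0 _ h]]] := Psi_ge.
by apply: lt_le_trans (h u u0); rewrite mulr_gt0// expR_gt0.
Qed.

Lemma logPsi_cvg_positive :
  ((fun u => logPsi P X a b u * (u ^- 2)%:E) @ +oo%R --> - (CX P I X a b * (2^-1)%:E))%E.
Proof.
have -> : (- (CX P I X a b * (2^-1)%:E) = (- k)%:E)%E.
  by rewrite (CX_positive W0 m0) -EFinM -EFinN /k invfM mulrC.
pose g u : R := ln (Psi P X a b u) * u ^- 2.
have cg : g @ +oo --> - k.
  have [c [L [c0 L0 h]]] := Psi_ge.
  (* [ln Psi + k u^2] lies between [ln c - k (2 u L + L^2)] and 0, so for u >= 1 it is at most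
     [Mc u] in size, and division by [u^2] leaves [Mc / u]. *)
  pose Mc := `|ln c| + k * (2 * L + L ^+ 2).
  have Mc0 : 0 <= Mc by rewrite addr_ge0// mulr_ge0// ?(ltW kgt0)// addr_ge0 ?mulr_ge0// sqr_ge0.
  apply: cvg_pinftyP => e e0; exists (Num.max 1 (Mc / e)) => u.
  rewrite ge_max => /andP[u1]; rewrite ler_pdivrMr// => Mu.
  have u0 : 0 < u by exact: lt_le_trans ltr01 u1.
  have u20 : 0 < u ^+ 2 by rewrite exprn_gt0.
  have Pu := Psi_gt0 (ltW u0).
  have up : ln (Psi P X a b u) <= - (k * u ^+ 2).
    by rewrite -[leRHS]expRK ler_ln ?posrE ?expR_gt0//; exact/Psi_le/ltW.
  have lo : ln c - k * (u + L) ^+ 2 <= ln (Psi P X a b u).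
    rewrite -[X in _ - X](opprK) opprK -[X in _ + X]expRK -lnM ?posrE ?expR_gt0//.
    by rewrite ler_ln ?posrE ?mulr_gt0 ?expR_gt0//; exact/h/ltW.
  have -> : g u - - k = (ln (Psi P X a b u) + k * u ^+ 2) / u ^+ 2.
    by rewrite /g; field; rewrite gt_eqF.
  rewrite normrM normfV (gtr0_norm u20) ler_pdivrMr//.
  set y := ln (Psi _ _ _ _ _) in up lo *.
  rewrite ler0_norm; last by rewrite -lerBrDr sub0r.
  have h1 : - ln c <= `|ln c| * u.
    by apply: (@le_trans _ _ `|ln c|); [rewrite ler_normr lexx orbT|rewrite ler_peMr].
  have h2 : k * (2 * u * L + L ^+ 2) <= k * (2 * L + L ^+ 2) * u.
    rewrite -[leRHS]mulrA ler_pM2l//; have : L ^+ 2 <= L ^+ 2 * u by rewrite ler_peMr// sqr_ge0.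
    by lra.
  have h3 : Mc * u <= e * u ^+ 2 by rewrite expr2 mulrA (mulrC e) ler_pM2r.
  apply: le_trans h3; rewrite /Mc mulrDl; apply: le_trans (lerD h1 h2).
  by move: lo; rewrite sqrrD; lra.
apply: cvg_trans; last first.
  apply: (cvg_comp g EFin cg); exact: cvg_id.
apply: near_eq_cvg; near=> u.
have u0 : 0 <= u by near: u; apply: nbhs_pinfty_ge; exact: num_real.
by rewrite /logPsi gt_eqF ?Psi_gt0// -EFinM.
Unshelve. all: end_near. Qed.

(** Both terms are compared with the lower bound [c exp (- k (u + L)^2)]. The excess of Z gains a
    quadratic amount in the exponent; the residual term factors by independence and needs a tail
    below [exp (- q u)]. *)
Lemma deviation_negligible (dl eta : R) : 0 < dl -> 0 < eta ->
  exists C0 U : R, 0 <= C0 /\ forall u, U <= u ->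
    mix_tail (u * (1 + dl)) + fine (P (~` A (eta * u) `&` [set w | u < Z w])) <=
    C0 * expR (- u) * Psi P X a b u.
Proof.
move=> dl0 eta0; have [c [L [c0 L0 h]]] := Psi_ge.
(* The part [2 k L] pays for the shift L in the lower bound, and the 1 leaves the factor
   [exp (- u)]. *)
pose q := 1 + 2 * k * L.
have q0 : 0 < q by rewrite ltr_pwDl// !mulr_ge0// ltW.
have [U1 HU1] := tail_exp_decay gX LV symV bV (q / eta).
exists (2 * c^-1 * expR (k * L ^+ 2)).
exists (Num.max 0 (Num.max (q / (2 * k * dl)) (U1 / eta))); split.
  by rewrite !mulr_ge0 ?expR_ge0// invr_ge0 ltW.
move=> u; rewrite !ge_max => /and3P[u0 uq uU].
have target : expR (- u - k * u ^+ 2 - 2 * k * L * u) <=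
    c^-1 * expR (k * L ^+ 2) * expR (- u) * Psi P X a b u.
  apply: (@le_trans _ _ (c^-1 * expR (k * L ^+ 2) * expR (- u) * (c * expR (- (k * (u + L) ^+ 2))))).
    rewrite (_ : _ * (c * _) = expR (k * L ^+ 2) * expR (- u) * expR (- (k * (u + L) ^+ 2))).
      by rewrite -!expRD ler_expR sqrrD; lra.
    by field; rewrite gt_eqF.
  by rewrite ler_wpM2l ?h// !mulr_ge0 ?expR_ge0// invr_ge0 ltW.
have -> : 2 * c^-1 * expR (k * L ^+ 2) * expR (- u) * Psi P X a b u =
  c^-1 * expR (k * L ^+ 2) * expR (- u) * Psi P X a b u +
  c^-1 * expR (k * L ^+ 2) * expR (- u) * Psi P X a b u by ring.
apply: lerD; apply: le_trans target.
  apply: le_trans (mix_tail_le _) _.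
    by rewrite mulr_ge0// addr_ge0// ltW.
  rewrite ler_expR exprMn.
  have : q * u <= k * (2 * dl) * u ^+ 2.
    rewrite ler_pdivrMr ?mulr_gt0// in uq.
    by rewrite expr2 mulrA ler_wpM2r//; lra.
  have : 0 <= k * (dl ^+ 2 * u ^+ 2) by rewrite !mulr_ge0 ?sqr_ge0// ltW.
  by rewrite /q; lra.
rewrite residual_independentC; apply: (@le_trans _ _ (expR (- (q * u)) * expR (- (k * u ^+ 2)))).
  apply: ler_pM.
  - exact: tail_ge0 LV _.
  - exact: fine_ge0.
  - have := HU1 (eta * u); rewrite -ler_pdivrMl// mulrC => /(_ uU).
    by rewrite mulrA divfK// gt_eqF.
  - exact: mix_tail_le.
by rewrite -expRD ler_expR /q; lra.
Qed.

Definition limit_function t := fine (CX P I X a b) * fine (covint P X a b mu0 t).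

Let mu01 : prob01 mu0. Proof. by case: W0. Qed.

Lemma limit_functionE v : 0 <= v <= 1 -> limit_function (aff a b v) = x v.
Proof.
move=> v01; rewrite /limit_function (CX_positive W0 m0) covint_mix//; last exact: aff_in.
by rewrite -unit_processE.
Qed.

Let unaff t := (t - a) / (b - a).

Let unaff_continuous : continuous unaff.
Proof.
by move=> t; apply: cvgM; [apply: cvgB; [exact: cvg_id|exact: cvg_cst]|exact: cvg_cst].
Qed.

Let unaff_itv t : a <= t <= b -> 0 <= unaff t <= 1 /\ aff a b (unaff t) = t.
Proof.
move=> /andP[at_ tb]; have ba : 0 < b - a by rewrite subr_gt0.
rewrite /unaff divr_ge0 ?subr_ge0 ?(ltW ab)//= ler_pdivrMr// mul1r lerB//; split => //.
by rewrite /aff mulrC divfK ?gt_eqF// addrC subrK.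
Qed.

(** On the event and outside the small set [B], [1 < Z/u <= 1 + dl] and [|Y|/u <= eta], so [X/u] is
    uniformly close to the limit path, and the continuity of f at that path applies. *)
Lemma cond_exp_cvg f : test_functional a b f ->
  cond_exp_f P X a b f @ +oo%R --> f limit_function.
Proof.
move=> [[M fM] [f_ext f_cont]].
have fx : f limit_function = f (x \o unaff).
  by apply: f_ext => t /unaff_itv[t01 {1}<-]; rewrite limit_functionE.
have fX u w : f (fun t => X t w / u) = f (fun t => G (unaff t) w / u).
  by apply: f_ext => t /unaff_itv[t01 et]; rewrite unit_processE// et.
have M0 : 0 <= M by exact: le_trans (fM (cst 0)).
have [Bx HBx] := clamp_bounded limit_path_continuous x_clamp.
have Bx0 : 0 <= Bx by exact: le_trans (HBx 0).
apply: cvg_pinftyP => e e0.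
have cx : {within `[a, b]%classic, continuous (x \o unaff)}.
  apply: continuous_subspaceT => t; apply: continuous_comp; first exact: unaff_continuous.
  exact: limit_path_continuous.
have e4 : 0 < e / 4 by rewrite divr_gt0.
have [del del0 Hdel] := f_cont _ cx _ e4.
(* The residual contributes at most [eta] and [x (Z/u - 1)] at most [Bx dl], each no more than
   [del / 4]; the [+ 1] covers Bx = 0. *)
pose eta := del / 4; pose dl := del / (4 * (Bx + 1)).
have Bx1 : 0 < Bx + 1 by rewrite ltr_wpDl.
have eta0 : 0 < eta by rewrite divr_gt0.
have dl0 : 0 < dl by rewrite divr_gt0// mulr_gt0.
have [C0 [U [C00 HU]]] := deviation_negligible dl0 eta0.
(* The last bound gives [M C0 / u <= e / 4], so [B] contributes at most [e / 4] relative to [Psi];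
   [integral_near_cst] doubles the sum of two such quarters. *)
exists (Num.max 1 (Num.max U (4 * M * C0 / e))) => u.
rewrite !ge_max => /and3P[u1 uU ue].
have u0 : 0 < u by exact: lt_le_trans ltr01 u1.
pose B1 := [set w | u * (1 + dl) < Z w].
pose B2 := ~` A (eta * u) `&` [set w | u < Z w].
pose E := exceed X a b u; pose B := E `&` (B1 `|` B2).
have mE : measurable E by exact: measurable_exceed.
have mB1 : measurable B1 by exact: measurable_gt.
have mB2 : measurable B2 by apply: measurableI; [exact: measurableC|exact: measurable_gt].
have mB : measurable B by apply: measurableI => //; exact: measurableU.
have Pu := Psi_gt0 (ltW u0).
have pB : fine (P B) <= C0 * expR (- u) * Psi P X a b u.
  apply: le_trans (HU u uU); rewrite /mix_tail -fineD ?fin_num_measure//.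
  rewrite fine_le ?fin_num_measure// ?fin_numD ?fin_num_measure//.
  apply: le_trans (measureU2 P mB1 mB2); apply: le_measure; rewrite ?inE//.
    exact: measurableU.
  by move=> w [].
have good w : E w -> ~ B w -> `|f (fun t => X t w / u) - f limit_function| <= e / 4.
  move=> Ew nBw; rewrite fx fX distrC ltW//; apply: Hdel.
    apply: continuous_subspaceT => t; apply: cvgM; last exact: cvg_cst.
    apply: (@continuous_comp _ _ _ unaff (G ^~ w)); first exact: unaff_continuous.
    exact: unit_process_continuous.
  move=> t _ /=; set v := unaff t.
  have uZ : u < Z w by exact: exceed_mix.
  have Zu : Z w <= u * (1 + dl).
    by rewrite leNgt; apply/negP => h; apply: nBw; split => //; left.
  have /residual_seqE/(_ v) : A (eta * u) w.
    by apply: contrapT => h; apply: nBw; split => //; right.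
  move=> Yv; have -> : x v - G v w / u = - (Y v w / u + x v * ((Z w - u) / u)).
    by rewrite /Y; field; rewrite gt_eqF.
  rewrite normrN; apply: le_lt_trans (ler_normD _ _) _.
  have h1 : `|Y v w / u| <= eta by rewrite normrM normfV (gtr0_norm u0) ler_pdivrMr.
  have h2 : `|x v * ((Z w - u) / u)| <= Bx * dl.
    rewrite normrM ler_pM//.
    rewrite ger0_norm ?divr_ge0 ?subr_ge0 ?(ltW uZ) ?(ltW u0)// ler_pdivrMr// lerBlDr.
    by move: Zu; lra.
  have h3 : Bx * dl <= del / 4.
    rewrite /dl mulrA ler_pdivrMr ?mulr_gt0//.
    rewrite (_ : del / 4 * (4 * (Bx + 1)) = Bx * del + del); last by field.
    by rewrite lerDl ltW.
  by move: h1 h2 h3; rewrite /eta; lra.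
have h := integral_near_cst P mE mB (@subIsetl _ _ _) (ltW e4)
  (fun w => fM (fun t => X t w / u)) (fM limit_function) good.
rewrite /cond_exp_f -/E.
set J := fine _ in h *; set c := f limit_function in h *.
have -> : J / Psi P X a b u - c = (J - c * Psi P X a b u) / Psi P X a b u.
  by field; rewrite gt_eqF.
rewrite normrM normfV (gtr0_norm Pu) ler_pdivrMr//; apply: le_trans h _.
rewrite -/(Psi P X a b u).
have eu : expR (- u) <= u^-1.
  rewrite expRN lef_pV2 ?posrE ?expR_gt0//; apply: le_trans (expR_ge1Dx u).
  by rewrite lerDr.
have : M * fine (P B) <= e / 4 * Psi P X a b u.
  apply: le_trans (ler_wpM2l M0 pB) _; rewrite !mulrA ler_pM2r//.
  apply: (@le_trans _ _ (M * C0 * u^-1)); first by rewrite ler_wpM2l// mulr_ge0.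
  rewrite ler_pdivrMr// in ue; rewrite ler_pdivrMr//; lra.
rewrite /= -/(Psi P X a b u); move: (fine (P B)) (Psi P X a b u) => y z h; lra.
Qed.

(** The function [potential mu0 - m] is nonnegative with mu0-integral 0, hence zero mu0-almost
    everywhere. *)
Lemma limit_function_gt1_null : mu0 [set v | 0 <= v <= 1 /\ 1 < limit_function (aff a b v)] = 0%E.
Proof.
pose g v := potential mu0 v - m.
have -> : [set v | 0 <= v <= 1 /\ 1 < limit_function (aff a b v)] =
    `[0, 1]%classic `&` g @^-1` `]0, +oo[%classic.
  apply/seteqP; split => v; rewrite /= !in_itv/= andbT /g subr_gt0.
    move=> [v01]; rewrite limit_functionE// /x mulrC ltr_pdivlMr// mul1r.
    by split.
  by move=> [v01 h]; split => //; rewrite limit_functionE// /x mulrC ltr_pdivlMr// mul1r.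
have mg : measurable_fun setT g by apply: measurable_funB => //; exact: measurable_potential.
apply/negligibleP.
  by apply: measurableI => //; rewrite -[X in measurable X]setTI; exact: mg.
have g0 v : 0 <= g v by rewrite subr_ge0 Wab_potential_ge.
have ig : mu0.-integrable setT (EFin \o g).
  apply: integrable_sub; first exact: potential_integrable.
  exact: integrable_cst.
have [/(_ _) h _] := ae_eq_integral_abs mu0 measurableT (measurable_int _ ig).
have : (\int[mu0]_x `|(EFin \o g) x| = 0)%E.
  under eq_integral do rewrite /= ger0_norm//.
  rewrite -Rintegral_EFin// RintegralB//; last first.
  - exact: integrable_cst.
  - exact: potential_integrable.
  by rewrite -ip_mix_potential Rintegral_prob_cst subrr.
move=> /h; apply: negligibleS => v /= [_].
by rewrite in_itv/= andbT => gv /(_ Logic.I)[] e; rewrite e ltxx in gv.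
Qed.

End large_deviations.

(** At zero energy [mix mu] vanishes almost surely, whereas the event forces it above u. *)
Lemma Psi_degenerate mu u : D mu = 0 -> 0 <= u -> Psi P X a b u = 0.
Proof.
move=> D0 u0; have /(ip_eq0 (lM mu)) [N [mN N0 hN]] := D0.
rewrite /Psi (_ : P _ = 0%E)//.
apply: (subset_measure0 _ mN _ N0); first exact: measurable_exceed.
move=> w /(exceed_mix mu) h; apply: hN => /= e.
by move: (le_lt_trans u0 h); rewrite e ltxx.
Qed.

Lemma logPsi_cvg :
  ((fun u => logPsi P X a b u * (u ^- 2)%:E) @ +oo%R --> - (CX P I X a b * (2^-1)%:E))%E.
Proof.
have [mu0 W0] := minimizer_exists; have mu01 : prob01 mu0 by case: W0.
have := ip_ge0 P (mix mu0); rewrite le_eqVlt => /predU1P[D0|D0]; last exact: logPsi_cvg_positive D0.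
(* Zero energy: the limit is [-oo], and so is [logPsi] for every u > 0. *)
rewrite (CX_einv W0) DI_mix// -D0 /einv eqxx gt0_mulye ?lte_fin ?invr_gt0//.
apply: cvg_near_cst; near=> u.
have u0 : 0 < u by near: u; apply: nbhs_pinfty_gt; exact: num_real.
rewrite /logPsi (Psi_degenerate (esym D0) (ltW u0)) eqxx gt0_mulNye//.
by rewrite lte_fin invr_gt0 exprn_gt0.
Unshelve. all: end_near. Qed.

(** * The spectral problem *)

Section spectral_problem.
Variable F : {finite_measure set R -> \bar R}.
Hypothesis specF : spectral_measure P I X F.
Hypothesis a0 : a = 0.

(** With [spec_sin], the real and imaginary parts of [e^(i v b y)], v being clamped to [0, 1]. *)
Definition spec_cos v y := cos (clamp01 v * b * y).
Definition spec_sin v y := sin (clamp01 v * b * y).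
Notation cs := spec_cos.
Notation sn := spec_sin.

Let measurable_lin (v : R) : measurable_fun setT (fun y : R => v * y).
Proof. exact: measurable_funM. Qed.

Let lc v : sq_int F (cs v).
Proof.
apply: (@sq_int_bounded _ _ _ _ _ 1).
  by apply: measurableT_comp; [exact: measurable_cos|exact: measurable_lin].
by move=> y; rewrite ler_norml cos_geN1 cos_le1.
Qed.

Let ls v : sq_int F (sn v).
Proof.
apply: (@sq_int_bounded _ _ _ _ _ 1).
  by apply: measurableT_comp; [exact: measurable_sin|exact: measurable_lin].
by move=> y; rewrite ler_norml sin_geN1 sin_le1.
Qed.

Let lin_continuous y : continuous (fun v : R => clamp01 v * b * y).
Proof.
move=> v; apply: cvgM; last exact: cvg_cst.
by apply: cvgM; [exact: continuous_clamp01|exact: cvg_cst].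
Qed.

Let cs_continuous y : continuous (cs ^~ y).
Proof. by move=> v; apply: (continuous_comp (@lin_continuous y v)); exact: continuous_cos. Qed.

Let sn_continuous y : continuous (sn ^~ y).
Proof. by move=> v; apply: (continuous_comp (@lin_continuous y v)); exact: continuous_sin. Qed.

Let cs_clamp v y : cs (clamp01 v) y = cs v y. Proof. by rewrite /cs clamp01K. Qed.
Let sn_clamp v y : sn (clamp01 v) y = sn v y. Proof. by rewrite /sn clamp01K. Qed.

Let mass := fine (F setT).

Let sqr_le1_bound (f : R -> R) : sq_int F f -> (forall y, `|f y| <= 1) -> ip F f f <= mass.
Proof.
move=> [mf fi] f1; rewrite /mass -[leRHS]mul1r -(@Rintegral_cst _ _ _ F setT)//.
apply: le_Rintegral => //.
- exact: integrable_cst.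
by move=> y _; rewrite -expr2 -real_normK ?num_real// exprn_ile1.
Qed.

Let cs_bound v : ip F (cs v) (cs v) <= mass.
Proof. by apply: sqr_le1_bound => // y; rewrite ler_norml cos_geN1 cos_le1. Qed.

Let sn_bound v : ip F (sn v) (sn v) <= mass.
Proof. by apply: sqr_le1_bound => // y; rewrite ler_norml sin_geN1 sin_le1. Qed.

(** With [char_sin], the characteristic function at frequency [b y] of a measure carried by
    [0, 1]. *)
Definition char_cos mu : R -> R := bary cs mu.
Definition char_sin mu : R -> R := bary sn mu.
Notation gc := char_cos.
Notation gs := char_sin.

Let lgc mu : sq_int F (gc mu).
Proof. exact: (sq_int_bary cs_continuous cs_clamp lc cs_bound). Qed.
Let lgs mu : sq_int F (gs mu).
Proof. exact: (sq_int_bary sn_continuous sn_clamp ls sn_bound). Qed.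

Let ip_gc mu f : sq_int F f -> ip F f (gc mu) = \int[mu]_v ip F f (cs v).
Proof. exact: (ip_bary cs_continuous cs_clamp lc cs_bound). Qed.
Let ip_gs mu f : sq_int F f -> ip F f (gs mu) = \int[mu]_v ip F f (sn v).
Proof. exact: (ip_bary sn_continuous sn_clamp ls sn_bound). Qed.

Let int_gc mu f : sq_int F f -> mu.-integrable setT (EFin \o (fun v => ip F f (cs v))).
Proof. exact: (ip_path_integrable cs_continuous cs_clamp lc cs_bound). Qed.
Let int_gs mu f : sq_int F f -> mu.-integrable setT (EFin \o (fun v => ip F f (sn v))).
Proof. exact: (ip_path_integrable sn_continuous sn_clamp ls sn_bound). Qed.

(** The spectral isometry: [e^(i v b y)] in L^2(F) corresponds to [G v]. The imaginary part of the
    product is treated in [spectral_quadrature]. *)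
Lemma spectral_covariance u v :
  ip F (cs u) (cs v) + ip F (sn u) (sn v) = ip P (G u) (G v).
Proof.
have [h _] := @specF (aff a b (clamp01 v)) (aff a b (clamp01 u)) (Iaff v) (Iaff u).
rewrite (ipC P) -(covXE gX)//; apply: EFin_inj; rewrite h -RintegralD//; try exact: sq_int_mul.
rewrite Rintegral_EFin; last by apply: integrable_add; exact: sq_int_mul.
apply: eq_integral => y _; rewrite -cosB; congr (cos _)%:E.
by rewrite /aff a0; ring.
Qed.

Lemma spectral_quadrature u v : ip F (sn u) (cs v) - ip F (cs u) (sn v) = 0.
Proof.
have [_ h] := @specF (aff a b (clamp01 v)) (aff a b (clamp01 u)) (Iaff v) (Iaff u).
apply: EFin_inj; etransitivity; last exact: h.
rewrite -RintegralB//; try exact: sq_int_mul.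
rewrite Rintegral_EFin; last by apply: integrable_sub; exact: sq_int_mul.
apply: eq_integral => y _; rewrite -sinB; congr (sin _)%:E.
by rewrite /aff a0; ring.
Qed.

Notation ip2 := (ip2 F).

Lemma char_potential mu v : ip F (cs v) (gc mu) + ip F (sn v) (gs mu) = potential mu v.
Proof.
rewrite ip_gc// ip_gs// -RintegralD//; [|exact: int_gc|exact: int_gs].
rewrite /potential ip_mix//; apply: eq_Rintegral => u _.
by rewrite spectral_covariance.
Qed.

Lemma char_quadrature mu v : ip F (sn v) (gc mu) - ip F (cs v) (gs mu) = 0.
Proof.
rewrite ip_gc// ip_gs// -RintegralB//; [|exact: int_gc|exact: int_gs].
rewrite -[RHS](Rintegral_prob_cst mu); apply: eq_Rintegral => u _.
by rewrite spectral_quadrature.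
Qed.

Lemma char_ip2 mu (h : (R -> R) * (R -> R)) : sq_int F h.1 -> sq_int F h.2 ->
  ip2 h (gc mu, gs mu) = \int[mu]_v (ip F (cs v) h.1 + ip F (sn v) h.2).
Proof.
move=> l1 l2; rewrite /ip2/= ip_gc// ip_gs// -(RintegralD measurableT (int_gc mu l1) (int_gs mu l2)).
by apply: eq_Rintegral => v _; rewrite (ipC F (cs v)) (ipC F (sn v)).
Qed.

(** The isometry averaged over time: the energy of a measure is the squared norm of its
    characteristic function in L^2(F), so the estimates for mixtures have twins on the spectral
    side. *)
Lemma char_ip2_mix mu nu : ip2 (gc nu, gs nu) (gc mu, gs mu) = ip P (mix mu) (mix nu).
Proof.
rewrite char_ip2//= ip_mix_potential; apply: eq_Rintegral => v _.
exact: char_potential.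
Qed.

Lemma in_L2FE (h1 h2 : R -> R) : in_L2F F h1 h2 <-> sq_int F h1 /\ sq_int F h2.
Proof.
split.
  move=> [m1 [m2 fin]].
  have i : F.-integrable setT (EFin \o (fun y => h1 y ^+ 2 + h2 y ^+ 2)).
    apply/integrableP; split.
      by apply/measurable_EFinP; apply: measurable_funD; exact: measurable_funX.
    apply: le_lt_trans fin; apply: ge0_le_integral => //=.
    - apply/measurable_EFinP; apply: measurableT_comp => //.
      by apply: measurable_funD; exact: measurable_funX.
    - by apply/measurable_EFinP; apply: measurable_funD; exact: measurable_funX.
    - by move=> y _; rewrite lee_fin ger0_norm// addr_ge0// sqr_ge0.
  split; split => //; apply: integrable_dominated i.
  - exact: measurable_funX.
  - by move=> y; rewrite ger0_norm ?sqr_ge0// lerDl sqr_ge0.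
  - exact: measurable_funX.
  - by move=> y; rewrite ger0_norm ?sqr_ge0// lerDr sqr_ge0.
move=> [[m1 i1] [m2 i2]]; split => //; split => //.
by rewrite -Rintegral_EFin ?ltry//; exact: integrable_add.
Qed.

Lemma normFE (h : (R -> R) * (R -> R)) : sq_int F h.1 -> sq_int F h.2 -> normF F h.1 h.2 = (ip2 h h)%:E.
Proof.
move=> [m1 i1] [m2 i2]; rewrite /normF -Rintegral_EFin; last exact: integrable_add.
by rewrite RintegralD.
Qed.

Lemma feasible_specE (h : (R -> R) * (R -> R)) : feasible_spec F b h.1 h.2 <->
  [/\ sq_int F h.1, sq_int F h.2 &
      forall v, 1 <= ip F (cs v) h.1 + ip F (sn v) h.2 /\
        ip F (sn v) h.1 - ip F (cs v) h.2 = 0].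
Proof.
have e1 v : 0 <= v <= 1 -> sq_int F h.1 -> sq_int F h.2 ->
    (\int[F]_y (cos (v * b * y) * h.1 y + sin (v * b * y) * h.2 y)%:E =
     (ip F (cs v) h.1 + ip F (sn v) h.2)%:E)%E.
  move=> v01 l1 l2; rewrite -RintegralD//; try exact: sq_int_mul.
  rewrite Rintegral_EFin; last by apply: integrable_add; exact: sq_int_mul.
  by apply: eq_integral => y _; rewrite /cs /sn clamp01_id.
have e2 v : 0 <= v <= 1 -> sq_int F h.1 -> sq_int F h.2 ->
    (\int[F]_y (sin (v * b * y) * h.1 y - cos (v * b * y) * h.2 y)%:E =
     (ip F (sn v) h.1 - ip F (cs v) h.2)%:E)%E.
  move=> v01 l1 l2; rewrite -RintegralB//; try exact: sq_int_mul.
  rewrite Rintegral_EFin; last by apply: integrable_sub; exact: sq_int_mul.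
  by apply: eq_integral => y _; rewrite /cs /sn clamp01_id.
split=> [[/in_L2FE[l1 l2] fh]|[l1 l2 fh]].
  split=> // v; have v01 := clamp01_itv v.
  have [] := fh _ v01; rewrite e1// e2// lee_fin.
  have -> : cs (clamp01 v) = cs v by apply/funext => y.
  have -> : sn (clamp01 v) = sn v by apply/funext => y.
  by move=> h1 [h2].
split; first exact/in_L2FE.
by move=> v v01; rewrite e1// e2// lee_fin; have [h1 ->] := fh v.
Qed.

Lemma feasible_spec_char mu (h : (R -> R) * (R -> R)) : feasible_spec F b h.1 h.2 -> 1 <= ip2 h (gc mu, gs mu).
Proof.
move=> /feasible_specE[l1 l2 fh]; rewrite char_ip2// -(Rintegral_prob_cst mu 1).
apply: le_Rintegral => //.
- exact: integrable_cst.
- have := integrable_add (int_gc mu l1) (int_gs mu l2).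
  by apply: eq_integrable => // v _ /=; rewrite (ipC F h.1) (ipC F h.2).
- by move=> v _; case: (fh v).
Qed.

(** At zero energy the quadratic in l reduces to N minus 2l times the product of h with the
    characteristic function, N being the squared norm of h. That product is at least 1, so
    [l = N + 1] makes it negative. *)
Lemma spectral_infeasible mu : D mu = 0 -> CXspec F b = +oo%E.
Proof.
move=> D0; rewrite /CXspec (_ : [set _ | _ in _] = set0) ?ereal_inf0//.
apply/seteqP; split => // y [h fh _].
have h1 := feasible_spec_char mu fh; have /feasible_specE[l1 l2 _] := fh.
have := ip2_quadratic (ip2 h h + 1) l1 l2 (lgc mu : sq_int F (gc mu, gs mu).1) (lgs mu).
rewrite char_ip2_mix D0 mulr0 addr0 => h2.
have h0 : 0 <= ip2 h h by rewrite addr_ge0// ip_ge0.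
have : (ip2 h h + 1) * 1 <= (ip2 h h + 1) * ip2 h (gc mu, gs mu).
  by rewrite ler_wpM2l// addr_ge0.
by move: h2; lra.
Qed.

Section spectral_optimum.
Variable mu0 : probability R R.
Hypothesis W0 : W mu0.
Let m := D mu0.
Hypothesis m0 : 0 < m.

Definition optimal_h : (R -> R) * (R -> R) :=
  (fun y => m^-1 * gc mu0 y, fun y => m^-1 * gs mu0 y).

Let l1 : sq_int F optimal_h.1. Proof. exact: sq_intZ. Qed.
Let l2 : sq_int F optimal_h.2. Proof. exact: sq_intZ. Qed.

Lemma optimal_h_feasible : feasible_spec F b optimal_h.1 optimal_h.2.
Proof.
apply/feasible_specE; split => // v /=.
rewrite !ipZr// -mulrDr -mulrBr char_potential char_quadrature mulr0; split => //.
by rewrite mulrC ler_pdivlMr// mul1r Wab_potential_ge.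
Qed.

Lemma optimal_h_norm : ip2 optimal_h optimal_h = m^-1.
Proof.
have := char_ip2_mix mu0 mu0; rewrite -/m /ip2 /= => e.
by rewrite !ipZr// !ipZl// -!mulrDr e mulVf ?mulr1// gt_eqF.
Qed.

(** The twin of [feasible_dist]; both components of the distance are kept, as uniqueness needs each
    of them to vanish. *)
Lemma feasible_spec_dist (h : (R -> R) * (R -> R)) : feasible_spec F b h.1 h.2 ->
  ip F (fun y => h.1 y - optimal_h.1 y) (fun y => h.1 y - optimal_h.1 y) +
  ip F (fun y => h.2 y - optimal_h.2 y) (fun y => h.2 y - optimal_h.2 y) <= ip2 h h - m^-1.
Proof.
move=> fh; have /feasible_specE[lh1 lh2 _] := fh.
rewrite ip2_dist// optimal_h_norm.
have hm : m^-1 <= ip2 h optimal_h.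
  rewrite /ip2 !ipZr// -mulrDr ler_peMr ?invr_ge0 ?(ltW m0)//.
  exact: (feasible_spec_char mu0 fh).
by rewrite -addrA lerD2l -lerBrDr -opprD lerN2 mulr_natl mulr2n lerD.
Qed.

Lemma CXspec_positive : CXspec F b = (m^-1)%:E.
Proof.
apply/eqP; rewrite eq_le; apply/andP; split.
  apply: ereal_inf_lbound; exists optimal_h; first exact: optimal_h_feasible.
  by rewrite normFE// optimal_h_norm.
apply: le_ereal_inf_tmp => _ [h fh <-].
have /feasible_specE[lh1 lh2 _] := fh.
rewrite normFE// lee_fin -subr_ge0; apply: le_trans (feasible_spec_dist fh).
by rewrite addr_ge0 ?ip_ge0.
Qed.

Lemma optimal_h_unique (h : (R -> R) * (R -> R)) : feasible_spec F b h.1 h.2 ->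
  normF F h.1 h.2 = (m^-1)%:E -> {ae F, forall y, h.1 y = optimal_h.1 y /\ h.2 y = optimal_h.2 y}.
Proof.
move=> fh; have /feasible_specE[lh1 lh2 _] := fh; rewrite normFE// => -[e].
have := feasible_spec_dist fh; rewrite e subrr => hle.
set n1 := ip F _ _ in hle; set n2 := ip F _ _ in hle.
have n10 : 0 <= n1 by exact: ip_ge0.
have n20 : 0 <= n2 by exact: ip_ge0.
have /(ip_eq0 (sq_intB lh1 l1)) ae1 : n1 = 0 by lra.
have /(ip_eq0 (sq_intB lh2 l2)) ae2 : n2 = 0 by lra.
apply: filterS2 ae1 ae2 => y /eqP + /eqP.
by rewrite !subr_eq0 => /eqP -> /eqP ->.
Qed.

End spectral_optimum.

(** Minimizers share their mixture in mean square, and the isometry carries the zero distance over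
    to L^2(F). *)
Lemma char_unique mu nu : W mu -> W nu ->
  {ae F, forall y, gc mu y = gc nu y /\ gs mu y = gs nu y}.
Proof.
move=> Wmu Wnu; have [_ e] := Wab_ip_eq Wmu Wnu.
have := @ip2_dist _ _ _ F (gc mu, gs mu) (gc nu, gs nu) (lgc mu) (lgs mu) (lgc nu) (lgs nu).
rewrite !char_ip2_mix (ipC P (mix nu)) -ip_sqrB// e /= => /eqP.
rewrite paddr_eq0 ?ip_ge0// => /andP[/eqP e1 /eqP e2].
have ae1 := ip_eq0 (sq_intB (lgc mu) (lgc nu)) e1.
have ae2 := ip_eq0 (sq_intB (lgs mu) (lgs nu)) e2.
apply: filterS2 ae1 ae2 => y /eqP + /eqP.
by rewrite !subr_eq0 => /eqP -> /eqP ->.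
Qed.

Lemma char_cosE mu y : prob01 mu ->
  fine (\int[mu]_(v in `[0%R, 1%R]%classic) (cos (v * b * y))%:E)%E = gc mu y.
Proof.
move=> mu01; rewrite (@prob01_eq mu _ (cs ^~ y))//.
by move=> v v01; rewrite /cs clamp01_id.
Qed.

Lemma char_sinE mu y : prob01 mu ->
  fine (\int[mu]_(v in `[0%R, 1%R]%classic) (sin (v * b * y))%:E)%E = gs mu y.
Proof.
move=> mu01; rewrite (@prob01_eq mu _ (sn ^~ y))//.
by move=> v v01; rewrite /sn clamp01_id.
Qed.

Lemma spectral_solution : CX P I X a b = CXspec F b /\
  ((exists H, feasibleH P I X a b H) ->
   exists h : (R -> R) * (R -> R),
     [/\ feasible_spec F b h.1 h.2,
         normF F h.1 h.2 = CX P I X a b,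
         (forall h' : (R -> R) * (R -> R), feasible_spec F b h'.1 h'.2 ->
            normF F h'.1 h'.2 = CX P I X a b ->
            {ae F, forall x, h'.1 x = h.1 x /\ h'.2 x = h.2 x}) &
         (forall mu, W mu ->
            {ae F, forall x,
               h.1 x = fine (CX P I X a b) * fine (\int[mu]_(v in `[0%R, 1%R]%classic)
                                         (cos (v * b * x))%:E)%E /\
               h.2 x = fine (CX P I X a b) * fine (\int[mu]_(v in `[0%R, 1%R]%classic)
                                         (sin (v * b * x))%:E)%E})]).
Proof.
have [mu0 W0] := minimizer_exists; have mu01 : prob01 mu0 by case: W0.
split=> [|[H fH]].
  have := ip_ge0 P (mix mu0); rewrite le_eqVlt => /predU1P[D0|D0].
    by rewrite (CX_einv W0) DI_mix// -D0 /einv eqxx (spectral_infeasible (esym D0)).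
  by rewrite (CX_positive W0 D0) (CXspec_positive W0 D0).
have m0 := feasible_energy_gt0 mu0 fH.
rewrite (CX_positive W0 m0).
exists (optimal_h mu0); split.
- exact: optimal_h_feasible.
- by rewrite normFE ?optimal_h_norm//; exact: sq_intZ.
- by move=> h' fh'; exact: optimal_h_unique.
- move=> mu Wmu; have nu01 : prob01 mu by case: Wmu.
  apply: filterS (char_unique W0 Wmu) => y [e1 e2].
  by rewrite char_cosE// char_sinE// -e1 -e2.
Qed.

Hypothesis b0 : 0 < b.
Hypothesis full_support : forall O : set R, open O -> O !=set0 -> (0 < F O)%E.

Let gc_continuous mu : continuous (gc mu).
Proof.
apply: sequentially_continuous => y u uy.
apply: (@Rintegral_bdct _ _ _ _ _ _ 1).
- move=> n; apply: continuous_measurable_fun; exact: cs_continuous.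
- by move=> n v; rewrite ler_norml cos_geN1 cos_le1.
- move=> v; apply: (continuous_cvg _ (@continuous_cos R _)).
  by apply: cvgM => //; exact: cvg_cst.
Qed.

Let gs_continuous mu : continuous (gs mu).
Proof.
apply: sequentially_continuous => y u uy.
apply: (@Rintegral_bdct _ _ _ _ _ _ 1).
- move=> n; apply: continuous_measurable_fun; exact: sn_continuous.
- by move=> n v; rewrite ler_norml sin_geN1 sin_le1.
- move=> v; apply: (continuous_cvg _ (@continuous_sin R _)).
  by apply: cvgM => //; exact: cvg_cst.
Qed.

(** The set where two continuous functions differ is open; being null, it is empty. *)
Lemma full_support_eq (f g : R -> R) : continuous f -> continuous g ->
  {ae F, forall y, f y = g y} -> forall y, f y = g y.
Proof.
move=> cf cg [N [mN N0 hN]] y; apply: contrapT => fgy.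
pose O := (fun y => f y - g y) @^-1` [set~ 0].
have oO : open O.
  apply: open_comp; last exact/closed_openC/closed_eq.
  by move=> z _; apply: cvgB; [exact: cf|exact: cg].
have : (0 < F O)%E.
  by apply: full_support => //; exists y; rewrite /O/= => /eqP; rewrite subr_eq0 => /eqP.
rewrite (_ : F O = 0%E) ?ltxx//.
apply: (subset_measure0 _ mN _ N0); first exact: open_measurable.
by move=> z Oz; apply: hN => /= e; apply: Oz; rewrite /= e subrr.
Qed.

Lemma prob01_clamp_ae mu : prob01 mu -> {ae mu, forall v, clamp01 v = v}.
Proof.
move=> mu01; exists (~` `[0, 1]%classic); split => //; first exact: measurableC.
by move=> v /= nv v01; apply: nv; rewrite clamp01_id//; move: v01; rewrite in_itv.
Qed.

Lemma prob01_clamp_cdf mu s : prob01 mu ->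
  \int[mu]_v (clamp01 v <= s)%R%:R = fine (mu `]-oo, s]%classic).
Proof.
move=> mu01; rewrite -Rintegral_indic// /Rintegral; congr fine.
have mcl : measurable_fun setT (@clamp01 R).
  by apply: continuous_measurable_fun; exact: continuous_clamp01.
apply: ae_eq_integral => //.
- by apply/measurable_EFinP; exact: measurable_leP.
- exact/measurable_EFinP/measurable_indic.
apply: filterS (prob01_clamp_ae mu01) => v e _.
by rewrite e indicE mem_setE in_itv.
Qed.

(** Continuity and full support turn almost everywhere equality into equality at every point.
    Evaluating at [k / b] gives equal characteristic functions at each frequency k, and
    [weighted_char_le] with weight 1 gives equal distribution functions. *)
Lemma full_support_unique mu nu : W mu -> W nu -> forall A, measurable A -> mu A = nu A.
Proof.
move=> Wmu Wnu; have mu01 : prob01 mu by case: Wmu.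
have nu01 : prob01 nu by case: Wnu.
have aeg := char_unique Wmu Wnu.
have ec : forall y, gc mu y = gc nu y.
  by apply: full_support_eq; [exact: gc_continuous|exact: gc_continuous|apply: filterS aeg => y []].
have es : forall y, gs mu y = gs nu y.
  by apply: full_support_eq; [exact: gs_continuous|exact: gs_continuous|apply: filterS aeg => y []].
have mcl : measurable_fun setT (@clamp01 R).
  by apply: continuous_measurable_fun; exact: continuous_clamp01.
have char (rho : probability R R) k c :
    \int[rho]_v (1 * cos (k * clamp01 v + c)) = cos c * gc rho (k / b) - sin c * gs rho (k / b).
  rewrite /gc /gs /bary.
  have i1 : rho.-integrable setT (EFin \o (cs ^~ (k / b))).
    apply: clamped_integrable; first exact: cs_continuous.
    by move=> v; exact: cs_clamp.
  have i2 : rho.-integrable setT (EFin \o (sn ^~ (k / b))).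
    apply: clamped_integrable; first exact: sn_continuous.
    by move=> v; exact: sn_clamp.
  rewrite -!RintegralZl// -RintegralB//; try exact: integrable_scale.
  apply: eq_Rintegral => v _; rewrite mul1r addrC cosD /cs /sn.
  by rewrite (_ : clamp01 v * b * (k / b) = k * clamp01 v)//; field; rewrite gt_eqF.
apply: eq_prob_cdf => s.
rewrite -[LHS]fineK ?fin_num_measure// -[RHS]fineK ?fin_num_measure//; congr EFin.
rewrite -!prob01_clamp_cdf//.
have one (rho : probability R R) : \int[rho]_v (clamp01 v <= s)%R%:R = \int[rho]_v (1 * (clamp01 v <= s)%R%:R).
  by apply: eq_Rintegral => v _; rewrite mul1r.
rewrite !one; apply: (@weighted_char_le _ _ _ _ _ mu nu (cst 1) _ (cst 1) _ 1) => //.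
- by move=> v; rewrite normr1.
- by move=> v; rewrite normr1.
- by move=> k c; rewrite /= !char ec es.
Qed.

End spectral_problem.

End reparametrized_process.

Theorem theorem5p1 (d : measure_display) (T : measurableType d) (R : realType)
    (P : probability T R) (X : R -> T -> R) (I : set R) (a b : R) :
  a < b -> is_interval I -> `[a, b]%classic `<=` I ->
  centered_gaussian_process P I X -> continuous_paths I X ->
  let C := CX P I X a b in
  ((* the large deviation limit exists and equals -C/2 *)
   ((fun u => logPsi P X a b u * (u ^- 2)%:E) @ +oo%R --> - (C * (2^-1)%:E))%E) /\
   (* the minimum over M_1^+([0,1]) is attained, and C = [min]^{-1} *)
   (exists2 mu0 : probability R R, Wab P X a b mu0 & C = einv (DI P X a b mu0)) /\
   (* W_{a,b} is convex and weakly compact *)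
   convex_meas (Wab P X a b) /\ weakly_compact01 (Wab P X a b) /\
   (* characterisation of W_{a,b} *)
   (forall mu : probability R R, prob01 mu ->
      (Wab P X a b mu <->
        ((forall v, 0 <= v <= 1 ->
            (DI P X a b mu <= \int[mu]_(u in `[0%R, 1%R]%classic)
                                 (covX P X (aff a b u) (aff a b v))%:E)%E) /\
         exists2 v, 0 <= v <= 1 &
            (\int[mu]_(u in `[0%R, 1%R]%classic)
                (covX P X (aff a b u) (aff a b v))%:E)%E = DI P X a b mu))) /\
   (* consequences of feasibility *)
   ((exists H, feasibleH P I X a b H) ->
    [/\ (forall mu, Wab P X a b mu -> (0 < DI P X a b mu)%E),
        (exists H : T -> R,
           [/\ feasibleH P I X a b H,
               ('E_P[fun w => (H w ^+ 2)%R])%E = C,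
               (forall H', feasibleH P I X a b H' ->
                  ('E_P[fun w => (H' w ^+ 2)%R])%E = C ->
                  {ae P, forall w, H' w = H w}) &
               (forall mu, Wab P X a b mu ->
                  {ae P, forall w, H w = fine C * Xint X a b mu w})]) &
        (forall mu, Wab P X a b mu ->
           let x := fun t => fine C * fine (covint P X a b mu t) in
           (forall f, test_functional a b f ->
              cond_exp_f P X a b f @ +oo%R --> f x) /\
           mu [set v | 0 <= v <= 1 /\ 1 < x (aff a b v)] = 0%E)]) /\
   (* stationary case: C_X(b) = C_X(0,b) via the spectral measure *)
   (forall F : {finite_measure set R -> \bar R},
      spectral_measure P I X F -> a = 0 ->
      C = CXspec F b /\
      ((exists H, feasibleH P I X a b H) ->
       exists h : (R -> R) * (R -> R),
         [/\ feasible_spec F b h.1 h.2,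
             normF F h.1 h.2 = C,
             (forall h' : (R -> R) * (R -> R), feasible_spec F b h'.1 h'.2 ->
                normF F h'.1 h'.2 = C ->
                {ae F, forall x, h'.1 x = h.1 x /\ h'.2 x = h.2 x}) &
             (forall mu, Wab P X a b mu ->
                {ae F, forall x,
                   h.1 x = fine C * fine (\int[mu]_(v in `[0%R, 1%R]%classic)
                                             (cos (v * b * x))%:E)%E /\
                   h.2 x = fine C * fine (\int[mu]_(v in `[0%R, 1%R]%classic)
                                             (sin (v * b * x))%:E)%E})])) /\
   (* stationary case with spectral support = R: W_{0,b} is a singleton *)
   (forall F : {finite_measure set R -> \bar R},
      spectral_measure P I X F -> a = 0 ->
      (forall O : set R, open O -> O !=set0 -> (0 < F O)%E) ->
      exists2 mu0 : probability R R, Wab P X a b mu0 &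
        forall mu, Wab P X a b mu -> forall A, measurable A -> mu A = mu0 A).
Proof.
move=> ab _ subI gX cX C.
split; first exact: (logPsi_cvg ab subI gX cX).
split.
  have [mu0 W0] := minimizer_exists ab subI gX cX.
  by exists mu0 => //; exact: (CX_einv ab subI gX cX W0).
split; first exact: (Wab_convex ab subI gX cX).
split; first exact: (Wab_weakly_compact ab subI gX cX).
split; first by move=> mu mu01; exact: (Wab_charact ab subI gX cX mu01).
split.
  move=> fH; have [Dpos solH] := feasible_solution ab subI gX cX fH.
  split => // mu Wmu x.
  have m0 : 0 < ip P (mix X a b mu) (mix X a b mu).
    by rewrite -lte_fin -(DI_mix ab subI gX cX) ?Dpos//; case: Wmu.
  split; first by move=> f; exact: (cond_exp_cvg ab subI gX cX Wmu m0).
  exact: (limit_function_gt1_null ab subI gX cX Wmu m0).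
split=> [F specF a0|F specF a0 full].
  exact: (spectral_solution ab subI gX cX specF a0).
have [mu0 W0] := minimizer_exists ab subI gX cX.
exists mu0 => // mu Wmu.
have b0 : 0 < b by rewrite -a0.
exact: (full_support_unique ab subI gX cX specF a0 b0 full).
Qed.
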